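(* Let $L_+,L_-$ be self-adjoint operators on a Hilbert space $\mathcal{X}$ satisfying assumptions (P1) and (P2) of the context, let $A$, $K$, $\mathcal{H}$, $\delta$ be as in the context, and assume that all embedded eigenvalues of the generalized eigenvalue problem $Au=\gamma Ku$, $u\in\mathcal{H}$, are simple. Let $N_{\rm neg}=\dim(\mathcal{H}_{A+\delta K}^-)+\dim(\mathcal{H}_K^-)$ be the total negative index of the shifted problem $(A+\delta K)u=(\gamma+\delta)Ku$, and let $N_{\rm unst}=N_p^-+N_n^-+2N_{c^+}$ be the total number of unstable eigenvalues (including $N^-=N_p^-+N_n^-$ negative eigenvalues $\gamma<0$ and $N_c=N_{c^+}+N_{c^-}$ complex eigenvalues with $\operatorname{Im}\gamma\neq0$). Then $$\Delta N=N_{\rm neg}-N_{\rm unst}=2N_n^++2N_n^0\ge0.$$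
   Context: Let $\mathcal{X}$ be a Hilbert space with inner product $(\cdot,\cdot)$ and $L_\pm$ self-adjoint operators on it such that: (P1) the essential spectrum of $L_\pm$ consists of an absolutely continuous part $\sigma_c(L_\pm)$, bounded from below by $\omega_+\ge0$ for $L_+$ and by $\omega_->0$ for $L_-$, and finitely many embedded eigenvalues of finite multiplicities; (P2) the discrete spectrum of $L_\pm$ consists of finitely many isolated eigenvalues of finite multiplicities, with $p(L_\pm)$ positive, $z(L_\pm)$ zero and $n(L_\pm)$ negative eigenvalues (counted with multiplicity). Let $\mathcal{H}=\{u\in\mathcal{X}:u\perp\ker L_-\}$, let $\mathcal{P}$ be the orthogonal projection of $\mathcal{X}$ onto $\mathcal{H}$, and let $A=\mathcal{P}L_+\mathcal{P}$, $K=\mathcal{P}L_-^{-1}\mathcal{P}$, considered as self-adjoint operators on $\mathcal{H}$ ($K$ is bounded with trivial kernel). For a self-adjoint operator $S$ on $\mathcal{H}$, $\mathcal{H}_S^-$ denotes the span of the eigenvectors of $S$ for its negative isolated eigenvalues. The number $\delta$ satisfies $0<\delta<|\sigma_{-1}|$, where $\sigma_{-1}$ is the negative eigenvalue of $K^{-1}A$ smallest in absolute value. It is assumed that $\omega_{A+\delta K}:=\min\sigma_c(A+\delta K)>0$ for $\delta>0$ even if $\omega_+=0$ (so that $A+\delta K$ is continuously invertible). Put $[u,v]=(Ku,v)$. Eigenvalues $\gamma$ of $Au=\gamma Ku$ are those of $K^{-1}A$; isolated/embedded means isolated from/embedded in the essential spectrum. For a real eigenvalue $\gamma_0$ with generalized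 eigenspace $\mathcal{H}_{\gamma_0}$ (span of all Jordan chains), let $N_p(\gamma_0)$ (resp. $N_n(\gamma_0)$) be the maximal dimension of a subspace of $\mathcal{H}_{\gamma_0}$ on which $[u,u]\ge0$ (resp. $[u,u]\le0$). Explicitly, for an isolated eigenvalue with a single Jordan chain $f_1,\dots,f_n$: $N_p=N_n=k$ if $n=2k$; if $n=2k+1$, then $(N_p,N_n)=(k+1,k)$ when $[f_1,f_n]>0$ and $(k,k+1)$ when $[f_1,f_n]<0$. For a simple embedded eigenvalue with eigenvector $f_1$: $(N_p,N_n)=(1,0)$ if $[f_1,f_1]>0$, $(0,1)$ if $[f_1,f_1]<0$, $(1,1)$ if $[f_1,f_1]=0$. $N_p^-,N_n^-$ are the sums of $N_p(\gamma_0)$, $N_n(\gamma_0)$ over negative eigenvalues $\gamma_0<0$; $N_n^0$ is $N_n(0)$; $N_n^+$ is the sum of $N_n(\gamma_0)$ over positive eigenvalues $\gamma_0>0$ (isolated and embedded). $N_{c^+}$ ($N_{c^-}$) is the number of complex eigenvalues with $\operatorname{Im}\gamma>0$ ($\operatorname{Im}\gamma<0$), with algebraic multiplicity. *)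

(* Defs.v *)
From HB Require Import structures.
From mathcomp Require Import all_boot all_order all_algebra.
From mathcomp Require Import sesquilinear complex.
From mathcomp Require Import all_classical all_reals all_analysis.

Set Implicit Arguments.
Unset Strict Implicit.
Unset Printing Implicit Defensive.

Import Order.TTheory GRing.Theory Num.Theory Num.Def.
Import numFieldNormedType.Exports.

Local Open Scope classical_set_scope.
Local Open Scope ring_scope.
Local Open Scope complex_scope.

(* A Hilbert space is a complete normed space X over R[i]
   together with ip : {dot X for conjC} (linear in the first argument) such
   that ip u u = `|u| ^+ 2.

   An unbounded operator is identified with its graph, a set (X * X); its
   domain is the set of first components.  Operators in a closed subspace M of
   X have their graph in M `*` M; the notions that depend on the ambient space
   (adjoint, resolvent set, spectrum) take M as a parameter. *)

Section LinearAlgebra.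
Variables (R : realType) (V : lmodType R[i]).
Implicit Types (W G : set V).

Definition subspace W : Prop :=
  W 0 /\ forall (a : R[i]) u v, W u -> W v -> W (a *: u + v).

Definition lin_indep n (f : 'I_n -> V) : Prop :=
  forall c : 'I_n -> R[i], \sum_i c i *: f i = 0 -> forall i, c i = 0.

Definition span G : set V :=
  [set u | exists n (c : 'I_n -> R[i]) (f : 'I_n -> V),
     (forall i, G (f i)) /\ u = \sum_i c i *: f i].

(* +oo for an infinite-dimensional W. *)
Definition lindim W : \bar R :=
  ereal_sup [set n%:R%:E | n in
    [set n | exists f : 'I_n -> V, lin_indep f /\ forall i, W (f i)]].

End LinearAlgebra.

Section Operators.
Variables (R : realType) (X : completeNormedModType R[i]).
Variable ip : {dot X for conjC}.
Implicit Types (M : set X) (S T A K : set (X * X)) (z : R[i]).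

Definition dom S : set X := [set u | exists v, S (u, v)].

Definition ker S : set X := [set u | S (u, 0)].

Definition ortho_compl M : set X := [set u | forall v, M v -> ip u v = 0].

Definition adjoint M S : set (X * X) :=
  [set uv | [/\ M uv.1, M uv.2 &
     forall ab, S ab -> ip ab.2 uv.1 = ip ab.1 uv.2]].

Definition self_adjoint M S : Prop :=
  [/\ subspace S, S `<=` M `*` M, (forall v, S (0, v) -> v = 0),
      M `<=` closure (dom S) & S = adjoint M S].

Definition proj M : set (X * X) :=
  [set xp | M xp.2 /\ forall m, M m -> ip (xp.1 - xp.2) m = 0].

(* P S P as an operator in M, where P is the orthogonal projection onto M;
   S may be multivalued, as the inverse of an operator with a kernel is.
   The library's B \; A applies A first. *)
Definition compression M S : set (X * X) :=
  [set uv | M uv.1] `&` (proj M \; (S \; proj M))%relation.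

Definition addZ A (d : R[i]) K : set (X * X) :=
  [set uv | exists v w, [/\ A (uv.1, v), K (uv.1, w) & uv.2 = v + d *: w]].

(* S - z is onto M and bounded below, i.e. has a bounded inverse on M. *)
Definition resolvent_set M S : set R[i] :=
  [set z | (forall f, M f -> exists u, S (u, f + z *: u)) /\
    exists k : R[i], forall u v, S (u, v) -> `|u| <= k * `|v - z *: u|].

Definition spectrum M S : set R[i] := ~` resolvent_set M S.

Definition eigenvalue S : set R[i] := [set z | exists2 u, u != 0 & S (u, z *: u)].

Definition eigenvector S : set X :=
  [set u | u != 0 /\ exists z, S (u, z *: u)].

(* u lies in the kernel of (S - z)^n *)
Fixpoint root_vector S z n (u : X) : Prop :=
  if n is n'.+1 then exists2 v, S (u, z *: u + v) & root_vector S z n' v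
  else u = 0.

Definition root_space S z : set X := [set u | exists n, root_vector S z n u].

(* Algebraic multiplicity; for self-adjoint S the root space is the eigenspace. *)
Definition multiplicity S z : \bar R := lindim (root_space S z).

Definition discrete_spectrum M S : set R[i] :=
  [set z | [/\ isolated (spectrum M S : set R[i]^o) z, eigenvalue S z &
    (multiplicity S z < +oo)%E]].

Definition essential_spectrum M S : set R[i] :=
  spectrum M S `\` discrete_spectrum M S.

Definition embedded_eigenvalue M S : set R[i] :=
  essential_spectrum M S `&` eigenvalue S.

(* mu is the spectral measure of f with respect to the self-adjoint S, as
   determined by its Borel transform
     ((S - z)^-1 f, f) = \int (l - z)^-1 dmu(l),   z not real. *)
Definition spectral_measure S (f : X)
    (mu : {finite_measure set (measurableTypeR R) -> \bar R}) : Prop :=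
  forall z, complex.Im z != 0 -> exists2 g, S (g, f + z *: g) &
    ip g f = (\int[mu]_l complex.Re (l%:C - z)^-1)%R
         +i* (\int[mu]_l complex.Im (l%:C - z)^-1)%R.

Definition ac_space M S : set X :=
  [set f | M f /\ exists mu : {finite_measure set (measurableTypeR R) -> \bar R},
     spectral_measure S f mu /\ mu `<< (@lebesgue_measure R)].

Definition cont_space M S : set X := M `&` ortho_compl (eigenvector S).

(* sigma_c: the spectrum of the part of S in its continuous subspace, the
   orthogonal complement of the eigenvectors. *)
Definition cont_spectrum M S : set R[i] :=
  spectrum (cont_space M S) (S `&` (cont_space M S `*` cont_space M S)).

(* In the order of R[i], w%:C <= z forces z to be real. *)
Definition essential_spectrum_cond S (w : R) : Prop :=
  [/\ cont_space setT S `<=` ac_space setT S,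
      essential_spectrum setT S =
        cont_spectrum setT S `|` embedded_eigenvalue setT S,
      (forall z, cont_spectrum setT S z -> w%:C <= z),
      finite_set (embedded_eigenvalue setT S) &
      (forall z, embedded_eigenvalue setT S z -> (multiplicity S z < +oo)%E)].

Definition discrete_spectrum_cond S : Prop :=
  finite_set (discrete_spectrum setT S).

Definition neg_space M S : set X :=
  span [set u | u != 0 /\ exists2 z, discrete_spectrum M S z & z < 0 /\ S (u, z *: u)].

(* With T = K^-1 A: maximal dimension of a subspace of the root space of T at g
   on which the form [u, u] = (K u, u) is nonnegative, resp. nonpositive. *)
Definition Np K T (g : R) : \bar R :=
  ereal_sup [set lindim W | W in [set W | [/\ subspace W, W `<=` root_space T g%:C &
    forall u w, W u -> K (u, w) -> 0 <= ip w u]]].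

Definition Nn K T (g : R) : \bar R :=
  ereal_sup [set lindim W | W in [set W | [/\ subspace W, W `<=` root_space T g%:C &
    forall u w, W u -> K (u, w) -> ip w u <= 0]]].

Definition neg_eigenvalue T : set R := [set g | g < 0 /\ eigenvalue T g%:C].

Definition pos_eigenvalue T : set R := [set g | 0 < g /\ eigenvalue T g%:C].

Definition upper_eigenvalue T : set R[i] :=
  [set z | 0 < complex.Im z /\ eigenvalue T z].

End Operators.

(* Main.v *)
From HB Require Import structures.
Require Import Defs.
From mathcomp Require Import all_boot all_order all_algebra.
From mathcomp Require Import sesquilinear spectral mxpoly complex.
From mathcomp Require Import all_classical all_reals all_analysis.
From mathcomp Require Import ring lra.
Import Order.TTheory GRing.Theory Num.Theory Num.Def.
Import numFieldNormedType.Exports.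
Set Implicit Arguments.
Unset Strict Implicit.
Unset Printing Implicit Defensive.
Local Open Scope classical_set_scope.
Local Open Scope ring_scope.
Local Open Scope complex_scope.

(** The problem A u = g K u is turned into an eigenvalue problem for a product of
   two bounded operators.  K and (A + delta K)^-1 are bounded, symmetric and
   injective on H; put S = (A + delta K)^-1 K and S' = K (A + delta K)^-1.  Then
   A u = g K u means S u = z u with z = 1 / (g + delta), also for root vectors
   (root_space_shifted).  S is symmetric for the form (K u, u), and S' for the form
   of (A + delta K)^-1.  The negative indices of these two forms are the dimensions
   of the negative spectral spaces of K and of A + delta K (neg_space_operator,
   neg_space_inverse).  They are finite because the forms of L_- and L_+ are
   nonnegative off finitely many vectors (self_adjoint_neg_index,
   compressed_inverse, sum_inverse).

   The heart is Pontryagin's theorem.  Let A and B now be any bounded symmetric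
   injective operators, the form of B having negative index k.  Then A B has an
   invariant subspace of dimension k on which the form of B is nonpositive and
   where the spectrum lies in the closed lower half-plane (invariant_subspace).
   For matrices perturbed by i eps this follows from Lyapunov's inertia theorem
   (dissipative_invariant); in general one takes weak limits of finite-dimensional
   compressions.  Root spaces at points that are not conjugate are orthogonal in the
   form, so k is the sum, over the points of the closed lower half-plane, of the
   largest dimensions of nonpositive subspaces of the root spaces, the whole root
   space counting off the real axis (sum_sector_index).

   This is applied to S with the form of K and to S' with the form of
   (A + delta K)^-1, and the results are added.  Below the real axis, K maps the
   root spaces of S isomorphically to those of S', so that each upper eigenvalue g
   counts twice.  At a real point mu let q be a polynomial with q^2 X = mu on the
   root space of S.  The map u -> K q(S) u multiplies the form by mu
   (spans_exchange).  For mu > 0 both sums therefore count N_n(g), while for mu < 0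
   one counts N_n(g) and the other N_p(g).  As no eigenvalue lies in
   [- delta, 0[, the points mu < 0 correspond to the negative eigenvalues and the
   points mu > 0 to zero and the positive ones (index_count).  Hence
   N_neg = N_p^- + N_n^- + 2 N_{c+} + 2 N_n^+ + 2 N_n^0.

   The spectral theory needed for unbounded self-adjoint operators is obtained from
   the resolvent at a point below the spectrum: a real polynomial that is
   nonnegative on the spectrum of a bounded symmetric operator has a nonnegative
   form (poly_nonneg).  Negative eigenvectors come from minimising sequences
   (negative_spectral). *)

(** * Real and imaginary parts *)

Section ComplexParts.
Variable R : realType.
Implicit Types (z w : R[i]) (x : R).

Definition sqn z : R := complex.Re z ^+ 2 + complex.Im z ^+ 2.

Lemma ReD z w : complex.Re (z + w) = complex.Re z + complex.Re w.
Proof. by case: z; case: w. Qed.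
Lemma ImD z w : complex.Im (z + w) = complex.Im z + complex.Im w.
Proof. by case: z; case: w. Qed.
Lemma ReN z : complex.Re (- z) = - complex.Re z.
Proof. by case: z. Qed.
Lemma ImN z : complex.Im (- z) = - complex.Im z.
Proof. by case: z. Qed.
Lemma ReM z w : complex.Re (z * w) =
  complex.Re z * complex.Re w - complex.Im z * complex.Im w.
Proof. by case: z; case: w. Qed.
Lemma ImM z w : complex.Im (z * w) =
  complex.Re z * complex.Im w + complex.Im z * complex.Re w.
Proof. by case: z; case: w. Qed.
Lemma ReJ z : complex.Re (conjC z) = complex.Re z.
Proof. by case: z. Qed.
Lemma ImJ z : complex.Im (conjC z) = - complex.Im z.
Proof. by case: z. Qed.
Lemma ReR x : complex.Re x%:C = x. Proof. by []. Qed.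
Lemma ImR x : complex.Im x%:C = 0. Proof. by []. Qed.
Lemma ReZ x z : complex.Re (x%:C * z) = x * complex.Re z.
Proof. by rewrite ReM ReR ImR mul0r subr0. Qed.

Definition reimE := (ReD, ImD, ReN, ImN, ReM, ImM, ReJ, ImJ, ReR, ImR).

Lemma complexP z w :
  complex.Re z = complex.Re w -> complex.Im z = complex.Im w -> z = w.
Proof. by case: z w => [a b] [c d] /= -> ->. Qed.

Lemma sqn_ge0 z : 0 <= sqn z.
Proof. by rewrite addr_ge0 ?sqr_ge0. Qed.

Lemma sqn_eq0 z : (sqn z == 0) = (z == 0).
Proof.
rewrite /sqn paddr_eq0 ?sqr_ge0// !sqrf_eq0.
by apply/andP/eqP => [[/eqP a /eqP b]|->]; [exact: complexP|].
Qed.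

Lemma sqn_mulJ z : z * conjC z = (sqn z)%:C.
Proof. by apply: complexP; rewrite !reimE /sqn; ring. Qed.

Lemma conjR x : conjC (x%:C : R[i]) = x%:C.
Proof. by apply: complexP; rewrite !reimE ?oppr0. Qed.

Lemma sqnM z w : sqn (z * w) = sqn z * sqn w.
Proof. by rewrite /sqn !reimE; ring. Qed.

Lemma sqnJ z : sqn (conjC z) = sqn z.
Proof. by rewrite /sqn !reimE sqrrN. Qed.

Lemma sqnN z : sqn (- z) = sqn z.
Proof. by rewrite /sqn !reimE !sqrrN. Qed.

Lemma sqnR x : sqn x%:C = x ^+ 2.
Proof. by rewrite /sqn !reimE expr0n /= addr0. Qed.

Lemma sqnD_le z w : sqn (z + w) <= 2 * (sqn z + sqn w).
Proof. 
rewrite /sqn !reimE.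
have := sqr_ge0 (complex.Re z - complex.Re w).
have := sqr_ge0 (complex.Im z - complex.Im w); nra. Qed.

Lemma Re_sqr_le z : complex.Re z ^+ 2 <= sqn z.
Proof. by rewrite lerDl sqr_ge0. Qed.

Lemma sqn_normE z : `|z| ^+ 2 = (sqn z)%:C.
Proof. by rewrite normCK sqn_mulJ. Qed.

Lemma ge0_Re z : 0 <= z -> 0 <= complex.Re z.
Proof. by case: z => a b; rewrite lecE /= => /andP[]. Qed.

Lemma ge0_complexP z : 0 <= z <-> complex.Im z = 0 /\ 0 <= complex.Re z.
Proof.
case: z => a b; rewrite lecE /=; split; first by case/andP=> /eqP.
by case=> -> ->; rewrite eqxx.
Qed.

End ComplexParts.

(** * Inner product geometry *)

Section Geometry.
Variables (R : realType) (X : completeNormedModType R[i]).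
Variable ip : {dot X for conjC}.
Hypothesis hilbert : forall u, ip u u = `|u| ^+ 2.
Implicit Types (B : {linear X -> X}) (V : set X) (u v : X).

(** The squared norm as an element of R: estimates are carried out in the
   ordered field R, and only at the end translated to norms in R[i]. *)
Definition nsq u : R := complex.Re (ip u u).

Lemma ipDl u v w : ip (u + v) w = ip u w + ip v w.
Proof. exact: linearDl. Qed.
Lemma ipDr u v w : ip u (v + w) = ip u v + ip u w.
Proof. exact: linearDr. Qed.
Lemma ipNl u w : ip (- u) w = - ip u w.
Proof. exact: linearNl. Qed.
Lemma ipNr u w : ip u (- w) = - ip u w.
Proof. exact: linearNr. Qed.
Lemma ipBl u v w : ip (u - v) w = ip u w - ip v w.
Proof. exact: linearBl. Qed.
Lemma ipBr u v w : ip u (v - w) = ip u v - ip u w.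
Proof. exact: linearBr. Qed.
Lemma ipZl (a : R[i]) u w : ip (a *: u) w = a * ip u w.
Proof. exact: linearZl_LR. Qed.
Lemma ipZr (a : R[i]) u w : ip u (a *: w) = conjC a * ip u w.
Proof. exact: linearZr_LR. Qed.
Lemma ip0l u : ip 0 u = 0.
Proof. exact: linear0l. Qed.
Lemma ip0r u : ip u 0 = 0.
Proof. exact: linear0r. Qed.
Lemma ip_suml I (r : seq I) (F : I -> X) u :
  ip (\sum_(i <- r) F i) u = \sum_(i <- r) ip (F i) u.
Proof. exact: linear_sumlz. Qed.
Lemma ip_sumr I (r : seq I) (F : I -> X) u :
  ip u (\sum_(i <- r) F i) = \sum_(i <- r) ip u (F i).
Proof. exact: linear_sumr. Qed.
Lemma opD (D : {linear X -> X}) u v : D (u + v) = D u + D v.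
Proof. exact: linearD. Qed.
Lemma opB (D : {linear X -> X}) u v : D (u - v) = D u - D v.
Proof. exact: linearB. Qed.
Lemma opN (D : {linear X -> X}) u : D (- u) = - D u.
Proof. exact: linearN. Qed.
Lemma op0 (D : {linear X -> X}) : D 0 = 0.
Proof. exact: linear0. Qed.
Lemma opZ (D : {linear X -> X}) (a : R[i]) u : D (a *: u) = a *: D u.
Proof. exact: linearZ. Qed.
Lemma op_sum (D : {linear X -> X}) I (r : seq I) (F : I -> X) :
  D (\sum_(i <- r) F i) = \sum_(i <- r) D (F i).
Proof. exact: linear_sum. Qed.
Definition ipE := (ipDl, ipDr, ipNl, ipNr, ipZl, ipZr, ip0l, ip0r).

Lemma ipC u v : ip u v = conjC (ip v u).
Proof. by rewrite hermC expr0 mul1r. Qed.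

Lemma nsqE u : ip u u = (nsq u)%:C.
Proof.
have e : complex.Im (ip u u) = - complex.Im (ip u u) by rewrite {1}ipC ImJ.
by apply: complexP => //; rewrite ImR; lra.
Qed.

Lemma nsq_ge0 u : 0 <= nsq u.
Proof. by apply: ge0_Re; rewrite hilbert exprn_ge0. Qed.

Lemma nsq_eq0 u : (nsq u == 0) = (u == 0).
Proof.
apply/eqP/eqP => [e|->]; last by rewrite /nsq linear0l.
by have := hilbert u; rewrite nsqE e => /esym/eqP; rewrite expf_eq0 normr_eq0 => /eqP.
Qed.

Lemma nsq0 : nsq 0 = 0.
Proof. by rewrite /nsq ip0l. Qed.

Lemma nsq_normE u : `|u| ^+ 2 = (nsq u)%:C.
Proof. by rewrite -hilbert nsqE. Qed.

Lemma norm_nsqE u : `|u| = (Num.sqrt (nsq u))%:C.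
Proof.
have /ge0_complexP[im re] := normr_ge0 u.
apply: complexP; rewrite ?ImR ?ReR //; apply/eqP.
rewrite -(@eqrXn2 _ 2) ?sqrtr_ge0 // sqr_sqrtr ?nsq_ge0 //.
have /(congr1 (@complex.Re R)) := nsq_normE u.
by rewrite expr2 ReM im mul0r subr0 ReR expr2 => ->.
Qed.

Lemma nsqZ a u : nsq (a *: u) = sqn a * nsq u.
Proof.
apply: (@complexI R); rewrite -nsqE ipZl ipZr mulrA sqn_mulJ.
by rewrite nsqE rmorphM.
Qed.

Lemma nsqN u : nsq (- u) = nsq u.
Proof. by rewrite /nsq ipNl ipNr opprK. Qed.

Lemma nsqD u v : nsq (u + v) = nsq u + nsq v + 2 * complex.Re (ip u v).
Proof.
rewrite /nsq ipDl !ipDr !ReD (ipC v u) ReJ; ring.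
Qed.

Lemma nsqB u v : nsq (u - v) = nsq u + nsq v - 2 * complex.Re (ip u v).
Proof. by rewrite nsqD nsqN ipNr ReN; ring. Qed.

Lemma nsqD_le u v : nsq (u + v) <= 2 * (nsq u + nsq v).
Proof. have := nsq_ge0 (u - v); rewrite nsqB nsqD; lra. Qed.

Lemma nsqB_le u v : nsq (u - v) <= 2 * (nsq u + nsq v).
Proof. have := nsq_ge0 (u + v); rewrite nsqD nsqB; lra. Qed.

(** The discriminant argument is run for the form (D u, v) of an arbitrary
   operator D that is symmetric and nonnegative on a subspace only: it is used
   for the inner product itself, for compressed operators and for forms that
   are indefinite on the whole space. *)
Lemma form_CS (D : {linear X -> X}) V : Defs.subspace V ->
  (forall u v, V u -> V v -> ip (D u) v = ip u (D v)) ->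
  (forall u, V u -> 0 <= complex.Re (ip (D u) u)) ->
  forall u v, V u -> V v ->
  sqn (ip (D u) v) <= complex.Re (ip (D u) u) * complex.Re (ip (D v) v).
Proof.
move=> [V0 Vl] Ds Dp u v Vu Vv.
have Dvu : ip (D v) u = conjC (ip (D u) v) by rewrite Ds // -ipC.
have Dim w : V w -> complex.Im (ip (D w) w) = 0.
  move=> Vw; suff : complex.Im (ip (D w) w) = - complex.Im (ip (D w) w) by lra.
  by rewrite {1}Ds // {1}ipC ImJ.
have main s : 0 <= complex.Re (ip (D u) u) - 2 * s * sqn (ip (D u) v)
     + s ^+ 2 * sqn (ip (D u) v) * complex.Re (ip (D v) v).
  have Vw : V ((- s%:C * ip (D u) v) *: v + u) by exact: Vl.
  have := Dp _ Vw; rewrite opD opZ !ipE Dvu.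
  rewrite !reimE /sqn !Dim //.
  by move=> /le_trans; apply; rewrite le_eqVlt; apply/orP; left; apply/eqP; ring.
have a0 := Dp _ Vu; have b0 := Dp _ Vv; have Z0 := sqn_ge0 (ip (D u) v).
move: (complex.Re (ip (D u) u)) (complex.Re (ip (D v) v)) (sqn _) main a0 b0 Z0.
move=> a b Z main a0 b0 Z0; have [b_0|bn] := eqVneq b 0; last first.
  have bp : 0 < b by rewrite lt_def bn.
  have := main b^-1.
  have -> : a - 2 * b^-1 * Z + b^-1 ^+ 2 * Z * b = a - Z / b by field.
  by rewrite subr_ge0 ler_pdivrMr.
rewrite b_0 mulr0; have [//|Zp] := leP Z 0.
have := main ((a + 1) / (2 * Z)); rewrite b_0 mulr0 addr0.
have -> : a - 2 * ((a + 1) / (2 * Z)) * Z = -1 by field; rewrite gt_eqF.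
by rewrite oppr_ge0 ler10.
Qed.

Lemma subspaceT : Defs.subspace [set: X]. Proof. by []. Qed.

Lemma CS u v : sqn (ip u v) <= nsq u * nsq v.
Proof.
exact: (@form_CS idfun setT subspaceT (fun _ _ _ _ => erefl)
  (fun w _ => nsq_ge0 w)).
Qed.

End Geometry.

(** * Closed subspaces, projections and the Riesz representation *)

Section Projection.
Variables (R : realType) (X : completeNormedModType R[i]).
Variable ip : {dot X for conjC}.
Hypothesis hilbert : forall u, ip u u = `|u| ^+ 2.
Implicit Types (V : set X) (u v : X).
Local Notation nsq := (nsq ip).

Lemma le0_eps (x c : R) : 0 <= c -> (forall e, 0 < e -> x <= e * c) -> x <= 0.
Proof.
move=> c0 h; have [//|xp] := leP x 0.
have := h (x / (2 * (c + 1))) ltac:(by apply: divr_gt0 => //; lra).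
rewrite mulrAC ler_pdivlMr; last by lra.
by nra.
Qed.

(** The closure of V; closed subspaces are those with approx V `<=` V. *)
Definition approx V : set X :=
  [set l | forall e : R, 0 < e -> exists2 m, V m & nsq (l - m) < e].

Lemma approx_sub V : V `<=` approx V.
Proof. by move=> u Vu e e0; exists u => //; rewrite subrr nsq0. Qed.

Lemma approx_approx V : approx (approx V) `<=` approx V.
Proof.
move=> u Vu e e0.
have [m Vm um] := Vu (e / 4) ltac:(by lra).
have [m' Vm' mm'] := Vm (e / 4) ltac:(by lra).
exists m' => //; have -> : u - m' = (u - m) + (m - m') by rewrite addrA subrK.
by have := nsqD_le hilbert (u - m) (m - m'); lra.
Qed.

Lemma approx_subspace V : Defs.subspace V -> Defs.subspace (approx V).
Proof.
move=> [V0 Vl]; split=> [|a u v Vu Vv e e0]; first exact: approx_sub.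
have s0 := sqn_ge0 a.
have [m Vm um] := Vu (e / (4 * (sqn a + 1))) ltac:(by apply: divr_gt0 => //; lra).
have [m' Vm' vm'] := Vv (e / 4) ltac:(by lra).
exists (a *: m + m'); first exact: Vl.
have -> : a *: u + v - (a *: m + m') = a *: (u - m) + (v - m').
  by rewrite scalerBr opprD addrACA.
have := nsqD_le hilbert (a *: (u - m)) (v - m'); rewrite nsqZ //.
have : sqn a * nsq (u - m) <= e / 4.
  move: um; rewrite ltr_pdivlMr; last by lra.
  by have := nsq_ge0 hilbert (u - m); nra.
by lra.
Qed.

Lemma norm_lt u (e : R) : 0 < e -> (`|u| < e%:C) = (nsq u < e ^+ 2).
Proof.
move=> e0; rewrite (norm_nsqE hilbert) ltcR -(ltr_pXn2r (isT : (0 < 2)%N)) ?nnegrE ?sqrtr_ge0 ?ltW //.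
by rewrite sqr_sqrtr ?nsq_ge0.
Qed.

Lemma natSinv_small (e : R) : 0 < e -> exists N, forall n, (N <= n)%N -> n.+1%:R^-1 < e.
Proof.
by move=> e0; have [N _ hN] := near_infty_natSinv_lt (PosNum e0); exists N => n /hN.
Qed.

Lemma gt0_realC (e : R[i]) : 0 < e -> exists2 r : R, 0 < r & e = r%:C.
Proof.
by case: e => a b; rewrite ltcE /= => /andP[/eqP -> a0]; exists a.
Qed.

Lemma nsq_complete (u : nat -> X) :
  (forall e : R, 0 < e -> exists N, forall m n,
     (N <= m)%N -> (N <= n)%N -> nsq (u m - u n) < e) ->
  exists l, forall e : R, 0 < e -> exists N, forall n, (N <= n)%N ->
    nsq (l - u n) < e.
Proof.
move=> cu; have /cauchy_cvgP uc : cauchy (u @ \oo).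
  apply/cauchy_ballP => _ /gt0_realC[r r0 ->].
  have [N hN] := cu (r ^+ 2) (exprn_gt0 _ r0).
  pose T := [set u n | n in [set n | (N <= n)%N]].
  exists (T, T); first by split; exists N => // n Nn; exists n.
  move=> [_ _] /= [[m Nm <-] [n Nn <-]]; rewrite -ball_normE /ball_ /= norm_lt //.
  exact: hN.
exists (lim (u @ \oo)) => e e0.
have /cvgrPdist_lt/(_ (Num.sqrt e)%:C) := uc.
rewrite ltcR sqrtr_gt0 => /(_ e0)[N _ hN]; exists N => n Nn.
by have := hN n Nn; rewrite norm_lt ?sqrtr_gt0 // sqr_sqrtr // ltW.
Qed.

(** If w is within eta of being shortest in its coset modulo the line of m,
   then it is nearly orthogonal to m. *)
Lemma nearly_ortho (w m : X) (d eta : R) :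
  (forall s : R[i], d <= nsq (w - s *: m)) -> nsq w <= d + eta ->
  sqn (ip w m) <= eta * nsq m.
Proof.
move=> dmin wd; have [m0|mn] := eqVneq (nsq m) 0.
  by have := CS hilbert w m; rewrite m0 !mulr0.
have mp : 0 < nsq m by rewrite lt_def mn nsq_ge0.
have := dmin (ip w m * ((nsq m)^-1)%:C); rewrite nsqB nsqZ // ipZr.
have -> : complex.Re (conjC (ip w m * ((nsq m)^-1)%:C) * ip w m) = sqn (ip w m) / nsq m.
  by rewrite !reimE /sqn; ring.
rewrite sqnM sqnR.
have -> : sqn (ip w m) * (nsq m)^-1 ^+ 2 * nsq m = sqn (ip w m) / nsq m by field.
move=> h; rewrite -ler_pdivrMr //; lra.
Qed.

(** Nearly shortest vectors of the coset of u are nearly orthogonal to V, which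
   makes a minimising sequence Cauchy and its limit orthogonal to V. *)
Lemma projection V : Defs.subspace V -> approx V `<=` V ->
  forall u, exists2 p, V p & forall m, V m -> ip (u - p) m = 0.
Proof.
move=> [V0 Vl] Vc u.
pose D := [set nsq (u - m) | m in V].
have hD : has_inf D.
  split; first by exists (nsq (u - 0)), 0.
  by exists 0 => _ [m _ <-]; exact: nsq_ge0.
pose d := inf D.
have dmin m : V m -> d <= nsq (u - m).
  by move=> Vm; apply: ge_inf; [exact: hD.2|exists m].
have ex n : exists m, V m /\ nsq (u - m) < d + n.+1%:R^-1.
  have n0 : 0 < (n.+1%:R^-1 : R) by rewrite invr_gt0.
  have [_ [m Vm <-] ?] := inf_adherent n0 hD.
  by exists m.
have [f hf] := choice ex.
have VB a b : V a -> V b -> V (a - b).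
  by move=> Va Vb; rewrite -scaleN1r addrC; exact: Vl.
have small n : forall m, V m -> sqn (ip (u - f n) m) <= n.+1%:R^-1 * nsq m.
  move=> m Vm; apply: (@nearly_ortho _ _ d); last exact/ltW/(hf n).2.
  move=> s; have -> : u - f n - s *: m = u - (s *: m + f n).
    by rewrite opprD addrA addrAC.
  by apply: dmin; apply: Vl => //; exact: (hf n).1.
have tail := natSinv_small.
have [p hp] : exists l, forall e : R, 0 < e -> exists N, forall n, (N <= n)%N ->
    nsq (l - f n) < e.
  apply: nsq_complete => e e0.
  have [N hN] := tail (e / 4) ltac:(by lra).
  exists N => a b /hN Na /hN Nb.
  have Vab : V (f a - f b) by apply: VB; [exact: (hf a).1|exact: (hf b).1].
  set w := f a - f b in Vab *.
  have wE : ip w w = ip (u - f b) w - ip (u - f a) w.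
    by rewrite -ipBl; congr (ip _ _); rewrite opprB addrC addrA subrK.
  have ww : sqn (ip w w) <= 2 * (sqn (ip (u - f b) w) + sqn (ip (u - f a) w)).
    by rewrite wE; apply: le_trans (sqnD_le _ _) _; rewrite sqnN.
  have [sa sb] := (small a w Vab, small b w Vab).
  have w0 := nsq_ge0 hilbert w.
  move: ww; rewrite nsqE // sqnR => ww; rewrite ltNge; apply/negP => ew.
  move: sa sb ww Na Nb w0 ew; move: (nsq w) (a.+1%:R^-1) (b.+1%:R^-1) => x y z.
  by move: (sqn _) (sqn _) => s t *; nra.
have Vp : V p.
  apply: Vc => e /hp[N hN]; exists (f N); first exact: (hf N).1.
  exact: hN.
exists p => // m Vm; apply/eqP; rewrite -sqn_eq0 eq_le sqn_ge0 andbT.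
have m0 := nsq_ge0 hilbert m.
apply: (@le0_eps _ (4 * nsq m)); first by lra.
move=> e e0; have [N1 h1] := hp e e0; have [N2 h2] := tail e e0.
pose n := maxn N1 N2.
have {}h1 := h1 n (leq_maxl _ _); have {}h2 := h2 n (leq_maxr _ _).
have -> : u - p = (u - f n) + (f n - p) by rewrite addrA subrK.
rewrite ipDl; apply: le_trans (sqnD_le _ _) _.
have := small n m Vm; have := CS hilbert (f n - p) m.
rewrite -[nsq (f n - p)]nsqN // opprB.
move: h1 h2 m0; move: (nsq m) (nsq _) (n.+1%:R^-1) (sqn _) (sqn _) => x y z s t.
by move=> ye ze x0 txy szx; nra.
Qed.

(** The representing vector is a multiple of the component, orthogonal to the
   kernel of phi, of a vector on which phi does not vanish. *)
Lemma riesz (phi : X -> R[i]) (k : R) : 0 <= k ->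
  (forall a u v, phi (a *: u + v) = a * phi u + phi v) ->
  (forall u, sqn (phi u) <= k * nsq u) ->
  exists2 b, (forall u, phi u = ip u b) & nsq b <= k.
Proof.
move=> k0 phil phib.
have phi0 : phi 0 = 0.
  by have := phil (-1) 0 0; rewrite scaler0 addr0 mulN1r addNr.
have phiZ a u : phi (a *: u) = a * phi u.
  by have := phil a u 0; rewrite phi0 !addr0.
have phiB u v : phi (u - v) = phi u - phi v.
  by have := phil (-1) v u; rewrite scaleN1r mulN1r addrC => ->; rewrite addrC.
pose V := [set u | phi u = 0].
have Vs : Defs.subspace V.
  by split=> // a u v; rewrite /V /= phil => -> ->; rewrite mulr0 addr0.
have Vc : approx V `<=` V.
  move=> u Vu; apply/eqP; rewrite -sqn_eq0 eq_le sqn_ge0 andbT.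
  apply: (@le0_eps _ k) => // e e0; have [m Vm um] := Vu e e0.
  have -> : phi u = phi (u - m) by rewrite phiB Vm subr0.
  by apply: le_trans (phib _) _; rewrite mulrC ler_wpM2r // ltW.
have kk b : (forall u, phi u = ip u b) -> nsq b <= k.
  move=> hb; have := phib b; rewrite hb nsqE // sqnR.
  have := nsq_ge0 hilbert b; rewrite le_eqVlt => /predU1P[<- //|b0].
  by rewrite expr2 ler_pM2r.
have [all0|] := pselect (forall u, phi u = 0).
  have h0 u : phi u = ip u 0 by rewrite all0 ip0r.
  by exists 0 => //; exact: kk.
move=> /existsNP[w /eqP pw].
have [p Vp wp] := projection Vs Vc w; set q := w - p in wp.
have pq : phi q != 0 by rewrite phiB Vp subr0.
have q0 : ip q q != 0.
  rewrite nsqE // -[0]/(0%:C) (inj_eq (@complexI R)) nsq_eq0 //.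
  by apply: contra pq => /eqP ->; rewrite phi0.
have hb u : phi u = ip u ((conjC (phi q / ip q q)) *: q).
  rewrite ipZr conjCK; have : V (u - (phi u / phi q) *: q).
    by rewrite /V /= phiB phiZ divfK // subrr.
  move=> /wp; rewrite ipC // => /eqP; rewrite conjC_eq0 => /eqP.
  rewrite ipBl ipZl => /eqP; rewrite subr_eq0 => /eqP ->.
  by field; apply/andP.
by exists ((conjC (phi q / ip q q)) *: q) => //; exact: kk.
Qed.

(** By the lower bound, the preimages of a convergent sequence form a Cauchy
   sequence, so the range is closed; it is dense because nothing in V is
   orthogonal to it. *)
Lemma bounded_below_onto (D : {linear X -> X}) (V : set X) (c : R) :
  Defs.subspace V -> approx V `<=` V -> (forall u, V u -> V (D u)) ->
  0 < c -> (forall u, V u -> c * nsq u <= nsq (D u)) ->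
  (exists k : R, forall u, nsq (D u) <= k * nsq u) ->
  (forall v, V v -> (forall u, V u -> ip (D u) v = 0) -> v = 0) ->
  forall f, V f -> exists2 u, V u & D u = f.
Proof.
move=> Vs Vc DV c0 Dc [k Dk] Dd f Vf; have [V0 Vl] := Vs.
have VB a b : V a -> V b -> V (a - b).
  by move=> Va Vb; rewrite -scaleN1r addrC; exact: Vl.
pose M := [set D u | u in V].
have Ms : Defs.subspace M.
  split; first by exists 0; rewrite ?op0.
  move=> a _ _ [u Vu <-] [v Vv <-]; exists (a *: u + v); first exact: Vl.
  by rewrite opD opZ.
have Mc : approx M `<=` M.
  move=> l Ml; have ex n : exists u, V u /\ nsq (l - D u) < n.+1%:R^-1.
    by have [_ [u Vu <-] h] := Ml n.+1%:R^-1 ltac:(by rewrite invr_gt0); exists u.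
  have [g hg] := choice ex.
  have tail := natSinv_small.
  have cau : forall e : R, 0 < e -> exists N, forall m n,
     (N <= m)%N -> (N <= n)%N -> nsq (g m - g n) < e.
    move=> e e0; have [N hN] := tail (e * c / 4) ltac:(by apply: divr_gt0 => //; nra).
    exists N => m n Nm Nn; rewrite -(ltr_pM2l c0).
    apply: le_lt_trans (Dc _ (VB _ _ (hg m).1 (hg n).1)) _.
    have -> : D (g m - g n) = (l - D (g n)) - (l - D (g m)).
      by rewrite opB opprB [RHS]addrC addrA subrK.
    have := nsqB_le hilbert (l - D (g n)) (l - D (g m)).
    have := (hg m).2; have := (hg n).2; have := hN _ Nm; have := hN _ Nn.
    by move: (nsq _) (nsq _) (nsq _) (m.+1%:R^-1) (n.+1%:R^-1) => x y z s t *; lra.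
  have [u hu] := nsq_complete cau.
  have Vu : V u.
    by apply: Vc => e /hu[N hN]; exists (g N); [exact: (hg N).1|exact: hN].
  exists u => //; apply/eqP; rewrite -subr_eq0 -(nsq_eq0 hilbert) eq_le nsq_ge0 // andbT.
  have k0 := normr_ge0 k.
  apply: (@le0_eps _ (2 * `|k| + 2)); first by lra.
  move=> e e0; have [N1 h1] := hu e e0; have [N2 h2] := tail e e0.
  pose n := maxn N1 N2; have {}h1 := h1 n (leq_maxl _ _).
  have {}h2 := h2 n (leq_maxr _ _).
  have -> : D u - l = D (u - g n) - (l - D (g n)).
    by rewrite opB opprB addrA subrK.
  apply: le_trans (nsqB_le hilbert _ _) _.
  have := Dk (u - g n); have := (hg n).2; have := nsq_ge0 hilbert (u - g n).
  move: h1 h2 (ler_norm k).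
  move: (nsq _) (nsq _) (nsq _) (n.+1%:R^-1) => x y z s *; nra.
have [_ [u Vu <-] hp] := projection Ms Mc f.
exists u => //; apply/esym/eqP; rewrite -subr_eq0; apply/eqP.
have VDu := DV _ Vu.
apply: Dd; first exact: VB.
by move=> w Vw; rewrite ipC hp ?rmorph0 //; exists w.
Qed.

Lemma ortho_compl_subspace (V : set X) : Defs.subspace (ortho_compl ip V).
Proof.
split=> [v _|a u v hu hv w Vw]; first by rewrite ip0l.
by rewrite ipDl ipZl hu // hv // mulr0 addr0.
Qed.

Lemma ortho_compl_closed (V : set X) :
  approx (ortho_compl ip V) `<=` ortho_compl ip V.
Proof.
move=> u hu v Vv; apply/eqP; rewrite -sqn_eq0 eq_le sqn_ge0 andbT.
apply: (le0_eps (nsq_ge0 hilbert v)) => e e0; have [m Hm um] := hu e e0.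
have -> : ip u v = ip (u - m) v by rewrite ipBl Hm // subr0.
apply: le_trans (CS hilbert _ _) _; rewrite ler_wpM2r ?nsq_ge0 // ltW //.
Qed.

End Projection.

(** * Polynomials of a bounded symmetric operator *)

Section BoundedSymmetric.
Variables (R : realType) (X : completeNormedModType R[i]).
Variable ip : {dot X for conjC}.
Hypothesis hilbert : forall u, ip u u = `|u| ^+ 2.
Implicit Types (V : set X) (u v : X) (D G : {linear X -> X}).
Local Notation nsq := (nsq ip).
Local Notation approx := (approx ip).

Definition bounded D := exists2 k : R, 0 <= k & forall u, nsq (D u) <= k * nsq u.

Definition symmetric D := forall u v, ip (D u) v = ip u (D v).

Definition bounded_below (D : X -> X) :=
  exists2 c : R, 0 < c & forall u, c * nsq u <= nsq (D u).

Definition shift D (z : R[i]) : {linear X -> X} := D \- z \*: idfun.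

Lemma shiftE D z u : shift D z u = D u - z *: u.
Proof. by []. Qed.

Lemma symmetric_im D u : symmetric D -> complex.Im (ip (D u) u) = 0.
Proof.
move=> Ds; suff : complex.Im (ip (D u) u) = - complex.Im (ip (D u) u) by lra.
by rewrite {1}Ds {1}ipC ImJ.
Qed.

Lemma form_real D u : symmetric D -> ip (D u) u = (complex.Re (ip (D u) u))%:C.
Proof. by move=> Ds; apply: complexP => //; rewrite symmetric_im. Qed.

Lemma shift_symmetric D (x : R) : symmetric D -> symmetric (shift D x%:C).
Proof.
by move=> Ds u v; rewrite !shiftE ipBl ipBr ipZl ipZr Ds conjR.
Qed.

Lemma shift_bounded D z : bounded D -> bounded (shift D z).
Proof.
move=> [k k0 Dk]; exists (2 * (k + sqn z)).
  by have := sqn_ge0 z; lra.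
move=> u; rewrite shiftE; have := nsqB_le hilbert (D u) (z *: u).
by rewrite nsqZ //; have := Dk u; lra.
Qed.

Lemma comp_bounded D G : bounded D -> bounded G -> bounded (D \o G).
Proof.
move=> [k k0 Dk] [l l0 Gl]; exists (k * l); first exact: mulr_ge0.
move=> u /=; have := Dk (G u); have := Gl u; have := nsq_ge0 hilbert u; nra.
Qed.

Lemma bounded_form D k u : 0 <= k -> (forall u, nsq (D u) <= k * nsq u) ->
  `|complex.Re (ip (D u) u)| <= (k + 1) * nsq u.
Proof.
move=> k0 Dk; have := CS hilbert (D u) u.
have := Re_sqr_le (ip (D u) u); have := Dk u; have := nsq_ge0 hilbert u.
move: (nsq u) (nsq (D u)) (sqn _) (complex.Re _) => n d s r n0 dn rs sd.
rewrite -(ler_pXn2r (isT : (0 < 2)%N)) ?nnegrE ?normr_ge0 ?mulr_ge0 //; last lra.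
rewrite real_normK ?num_real //; apply: le_trans rs (le_trans sd _).
apply: le_trans (_ : k * n * n <= _); first exact: ler_wpM2r.
have : 0 <= n ^+ 2 by exact: sqr_ge0.
rewrite exprMn; nra.
Qed.

(** Applying the Cauchy-Schwarz inequality of the form of D to the pair
   (u, D u) bounds D u by the form at u. *)
Lemma nonneg_form_bound D V k : Defs.subspace V -> (forall u, V u -> V (D u)) ->
  symmetric D -> 0 <= k -> (forall u, nsq (D u) <= k * nsq u) ->
  (forall u, V u -> 0 <= complex.Re (ip (D u) u)) ->
  forall u, V u -> nsq (D u) <= (k + 1) * complex.Re (ip (D u) u).
Proof.
move=> Vs DV Ds k0 Dk Dp u Vu.
have VDu := DV _ Vu.
have := form_CS Vs (fun u v _ _ => Ds u v) Dp Vu VDu.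
rewrite nsqE // sqnR.
have := bounded_form (D u) k0 Dk; have := Dp _ VDu; have := Dp _ Vu.
have := nsq_ge0 hilbert (D u).
move: (nsq _) (complex.Re (ip (D u) u)) (complex.Re (ip (D (D u)) (D u))).
move=> x a b x0 a0 b0; rewrite ger0_norm // => bx xab.
have [->|xn] := eqVneq x 0; first by rewrite mulr_ge0 //; lra.
have xp : 0 < x by rewrite lt_def xn.
rewrite -(ler_pM2r xp); apply: le_trans (_ : a * b <= _); first by rewrite -expr2.
have -> : (k + 1) * a * x = a * ((k + 1) * x) by ring.
exact: ler_wpM2l.
Qed.

(** The infimum m of the numerical range of D is an approximate eigenvalue,
   because D - m has a nonnegative form. *)
Lemma numerical_bottom D V : Defs.subspace V -> (forall u, V u -> V (D u)) ->
  symmetric D -> bounded D ->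
  (exists2 u, V u & complex.Re (ip (D u) u) < 0) ->
  exists m : R, [/\ m < 0,
    (forall u, V u -> m * nsq u <= complex.Re (ip (D u) u)) &
    (forall e : R, 0 < e -> exists u,
       [/\ V u, nsq u = 1 & nsq (shift D m%:C u) < e])].
Proof.
move=> Vs DV Ds Db [w Vw w0]; have [V0 Vl] := Vs; have [k k0 Dk] := Db.
have VZ a u : V u -> V (a *: u).
  by move=> Vu; rewrite -[_ *: _]addr0; exact: Vl.
have DZ a u : complex.Re (ip (D (a *: u)) (a *: u)) = sqn a * complex.Re (ip (D u) u).
  by rewrite opZ ipZl ipZr mulrA sqn_mulJ ReZ.
have unit u : u != 0 -> nsq (((Num.sqrt (nsq u))^-1)%:C *: u) = 1 /\
    sqn ((Num.sqrt (nsq u))^-1)%:C = (nsq u)^-1.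
  move=> u0; have n0 : nsq u != 0 by rewrite nsq_eq0.
  have e : sqn ((Num.sqrt (nsq u))^-1)%:C = (nsq u)^-1.
    by rewrite sqnR exprVn sqr_sqrtr ?nsq_ge0.
  by rewrite nsqZ // e mulVf.
pose E := [set complex.Re (ip (D u) u) | u in [set u | V u /\ nsq u = 1]].
have wn0 : w != 0 by apply: contraTneq w0 => ->; rewrite op0 ip0l ltxx.
have [wu ws] := unit _ wn0; set w1 := _ *: w in wu.
have Ew : E (complex.Re (ip (D w1) w1)) by exists w1 => //; split => //; exact: VZ.
have hE : has_inf E.
  split; first by eexists; exact: Ew.
  exists (- (k + 1)) => _ [u [Vu u1] <-].
  have := bounded_form u k0 Dk; rewrite u1 mulr1.
  have := ler_norm (- complex.Re (ip (D u) u)); rewrite normrN; lra.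
pose m := inf E.
have mlow u : V u -> m * nsq u <= complex.Re (ip (D u) u).
  move=> Vu; have [->|u0] := eqVneq u 0; first by rewrite nsq0 op0 ip0l mulr0.
  have np : 0 < nsq u by rewrite lt_def nsq_eq0 // u0 nsq_ge0.
  have [uu us] := unit _ u0; rewrite -ler_pdivlMr // mulrC -us -DZ.
  apply: ge_inf; first exact: hE.2.
  by eexists; last reflexivity; split => //; exact: VZ.
have m0 : m < 0.
  apply: le_lt_trans (ge_inf hE.2 Ew) _.
  by rewrite DZ ws pmulr_rlt0 // invr_gt0 lt_def nsq_eq0 // wn0 nsq_ge0.
exists m; split=> // e e0.
have [K K0 sK] := shift_bounded m%:C Db.
have e1 : 0 < e / (K + 1) by apply: divr_gt0 => //; lra.
have [_ [u [Vu u1] <-] hu] := inf_adherent e1 hE.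
exists u; split=> //.
have sV v : V v -> V (shift D m%:C v).
  by move=> Vv; rewrite shiftE -scaleNr addrC; apply: Vl => //; exact: DV.
have sp v : V v -> 0 <= complex.Re (ip (shift D m%:C v) v).
  by move=> Vv; rewrite shiftE ipBl ipZl ReD ReN ReZ subr_ge0; exact: mlow.
have h := nonneg_form_bound Vs sV (shift_symmetric m Ds) K0 sK sp Vu.
apply: le_lt_trans h _.
rewrite shiftE ipBl ipZl ReD ReN ReZ -/(nsq u) u1 mulr1.
by move: hu; rewrite -/m -ltrBlDl ltr_pdivlMr; [rewrite mulrC|lra].
Qed.

Section Evaluation.
Variable G : {linear X -> X}.
Implicit Types (p q : {poly R[i]}) (z : R[i]).

(** The polynomial p of the operator G, applied to u. *)
Definition ev p u : X := \sum_(i < size p) p`_i *: iter i G u.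

Lemma ev_wide n p u : (size p <= n)%N -> ev p u = \sum_(i < n) p`_i *: iter i G u.
Proof.
move=> pn; rewrite /ev (big_ord_widen n (fun i => p`_i *: iter i G u)) // big_mkcond /=.
apply: eq_bigr => i _; case: ifPn => // ; rewrite -leqNgt => h.
by rewrite nth_default // scale0r.
Qed.

Lemma iter_linear n : linear (iter n G).
Proof. by elim: n => [|n IH] a u v //; rewrite iterS IH opD opZ. Qed.

Lemma ev_is_linear p : linear (ev p).
Proof.
move=> a u v; rewrite /ev scaler_sumr -big_split /=; apply: eq_bigr => i _.
by rewrite iter_linear scalerDr scalerA mulrC -scalerA.
Qed.

HB.instance Definition _ p := GRing.isLinear.Build _ _ _ _ (ev p) (@ev_is_linear p).

Lemma evD p q u : ev (p + q) u = ev p u + ev q u.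
Proof.
pose n := maxn (size p) (size q).
rewrite (@ev_wide n) ?(leq_trans (size_polyD _ _)) //.
rewrite (@ev_wide n p) ?leq_maxl // (@ev_wide n q) ?leq_maxr // -big_split /=.
by apply: eq_bigr => i _; rewrite coefD scalerDl.
Qed.

Lemma evC z u : ev z%:P u = z *: u.
Proof.
rewrite (@ev_wide 1) ?size_polyC ?leq_b1 // big_ord_recl big_ord0 addr0.
by rewrite coefC.
Qed.

Lemma evMX p u : ev (p * 'X) u = ev p (G u).
Proof.
rewrite (@ev_wide (size p).+1); last first.
  by apply: leq_trans (size_polyMleq _ _) _; rewrite size_polyX addn2.
rewrite big_ord_recl /= coefMX /= scale0r add0r; apply: eq_bigr => i _.
by rewrite coefMX /= -iterSr.
Qed.

Lemma ev_comm p u : ev p (G u) = G (ev p u).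
Proof.
by rewrite /ev op_sum; apply: eq_bigr => i _; rewrite -iterSr opZ.
Qed.

Lemma evZ z p u : ev (z *: p) u = z *: ev p u.
Proof.
rewrite (@ev_wide (size p)) ?size_scale_leq // scaler_sumr.
by apply: eq_bigr => i _; rewrite coefZ scalerA.
Qed.

Lemma evM p q u : ev (p * q) u = ev p (ev q u).
Proof.
elim/poly_ind: p u => [|p c IH] u.
  by rewrite mul0r -polyC0 !evC !scale0r.
by rewrite mulrDl mulrAC !evD !evMX IH ev_comm mul_polyC evZ evC.
Qed.

Lemma evB p q u : ev (p - q) u = ev p u - ev q u.
Proof. by rewrite -scaleN1r evD evZ scaleN1r. Qed.

Lemma evX u : ev 'X u = G u.
Proof. by rewrite -['X]mul1r evMX evC scale1r. Qed.

Lemma evXsub z u : ev ('X - z%:P) u = shift G z u.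
Proof. by rewrite evB evX evC. Qed.

Lemma ev_bounded p : bounded G -> bounded (ev p).
Proof.
move=> Gb; elim/poly_ind: p => [|p c IH].
  by exists 0 => // u; rewrite /= -polyC0 evC scale0r nsq0 mul0r.
have [k k0 hk] := comp_bounded IH Gb.
exists (2 * (k + sqn c)); first by have := sqn_ge0 c; lra.
move=> u; rewrite /= evD evMX evC; have := nsqD_le hilbert (ev p (G u)) (c *: u).
by rewrite nsqZ //; have := hk u; rewrite /=; lra.
Qed.

Lemma ev_symmetric (q : {poly R}) : symmetric G ->
  symmetric (ev (map_poly (real_complex R) q)).
Proof.
move=> Gs; elim/poly_ind: q => [|q c IH] u v.
  by rewrite rmorph0 /= -polyC0 !evC !scale0r ip0l ip0r.
rewrite rmorphD rmorphM /= map_polyX map_polyC /= !evD !evMX !evC.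
by rewrite ipDl ipDr ipZl ipZr conjR IH Gs ev_comm.
Qed.

Lemma ev_stable p V : Defs.subspace V -> (forall u, V u -> V (G u)) ->
  forall u, V u -> V (ev p u).
Proof.
move=> [V0 Vl] GV; elim/poly_ind: p => [|p c IH] u Vu.
  by rewrite -polyC0 evC scale0r.
by rewrite evD evMX evC addrC; apply: Vl => //; apply: IH; exact: GV.
Qed.

Lemma bounded_below_prod (rs : seq R[i]) :
  (forall z, z \in rs -> bounded_below (shift G z)) ->
  bounded_below (ev (\prod_(z <- rs) ('X - z%:P))).
Proof.
elim: rs => [|z rs IH] h.
  by exists 1 => // u; rewrite big_nil /= evC scale1r mul1r.
have [c c0 hc] := h z ltac:(by rewrite inE eqxx).
have [d d0 hd] := IH (fun w hw => h w ltac:(by rewrite inE hw orbT)).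
exists (c * d); first exact: mulr_gt0.
move=> u; rewrite big_cons /= evM evXsub; apply: le_trans (hc _).
by rewrite -mulrA ler_pM2l.
Qed.

(** A real polynomial that is nonnegative on the spectrum has a nonnegative
   form: were the infimum m of its form negative, q - m would split into
   factors G - z with z outside the spectrum, hence be bounded below. *)
Lemma poly_nonneg (q : {poly R}) : symmetric G -> bounded G -> 0 <= q.[0] ->
  (forall z, z != 0 -> ~ bounded_below (shift G z) ->
     0 <= (map_poly (real_complex R) q).[z]) ->
  forall u, 0 <= complex.Re (ip (ev (map_poly (real_complex R) q) u) u).
Proof.
move=> Gs Gb q0 qpos u; set Q := map_poly _ q.
have [//|neg] := leP 0 (complex.Re (ip (ev Q u) u)).
have [m [m0 _ hm]] := numerical_bottom (subspaceT X) (fun _ _ => I)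
  (ev_symmetric q Gs) (ev_bounded Q Gb) (ex_intro2 _ _ u I neg).
pose P := Q - (m%:C)%:P.
have rootP z : root P z -> bounded_below (shift G z).
  rewrite /root hornerD hornerN hornerC subr_eq0 => /eqP Qz.
  apply: contrapT => nb; have [z0|z0] := eqVneq z 0.
    move: Qz q0; rewrite z0 -[0](rmorph0 (real_complex R)) horner_map /=.
    by move=> /complexI ->; lra.
  by have := qpos z z0 nb; rewrite -/Q Qz lecR; lra.
have Pn0 : P != 0.
  apply/eqP => P0; have : P.[0] = 0 by rewrite P0 horner0.
  rewrite /P hornerD hornerN hornerC /Q -{1}[0](rmorph0 (real_complex R)) horner_map /=.
  by move=> /eqP; rewrite subr_eq0 => /eqP/complexI; lra.
have [rs Prs] := closed_field_poly_normal P.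
have [c c0 hc] : bounded_below (ev P).
  have [d d0 hd] := @bounded_below_prod rs (fun z zr => rootP z
     ltac:(by rewrite Prs rootZ ?lead_coef_eq0 // root_prod_XsubC)).
  exists (sqn (lead_coef P) * d).
    by rewrite mulr_gt0 // lt_def sqn_ge0 sqn_eq0 lead_coef_eq0 Pn0.
  move=> v; rewrite Prs evZ nsqZ // -Prs -mulrA; apply: ler_wpM2l => //.
  exact: sqn_ge0.
have [v [_ v1 hv]] := hm c c0.
by have := hc v; rewrite v1 mulr1 evB evC -shiftE leNgt hv.
Qed.

End Evaluation.
End BoundedSymmetric.

(** * Dimension *)

Section Dimension.
Variables (R : realType) (V : lmodType R[i]).
Implicit Types (W : set V).

Lemma lindim_ge W n (f : 'I_n -> V) : lin_indep f -> (forall i, W (f i)) ->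
  (n%:R%:E <= lindim W)%E.
Proof. by move=> fi Wf; apply: ereal_sup_ubound; exists n => //; exists f. Qed.

Lemma lindim_le W k :
  (forall n (f : 'I_n -> V), lin_indep f -> (forall i, W (f i)) -> (n <= k)%N) ->
  (lindim W <= k%:R%:E)%E.
Proof.
move=> h; apply: ge_ereal_sup => _ [n [f [fi Wf]] <-].
by rewrite lee_fin ler_nat; exact: h fi Wf.
Qed.

Lemma lindim_attained W : (lindim W < +oo)%E ->
  exists n, lindim W = n%:R%:E /\
    exists f : 'I_n -> V, lin_indep f /\ forall i, W (f i).
Proof.
move=> Wfin.
pose P n := `[< exists f : 'I_n -> V, lin_indep f /\ forall i, W (f i) >].
have P0 : exists n, P n.
  exists 0%N; apply/asboolP; exists (fun=> 0); split=> [c _|] [] //.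
have [r hr] : exists r : R, (lindim W <= r%:E)%E.
  case: (lindim W) Wfin => [r _|//|_]; first by exists r.
  by exists 0; rewrite leNye.
have Pb n : P n -> (n <= Num.truncn r)%N.
  move=> /asboolP[f [fi Wf]]; have := le_trans (lindim_ge fi Wf) hr.
  by rewrite lee_fin => nr; rewrite truncn_ge_nat // (le_trans _ nr).
pose m := ex_maxn P0 Pb.
have [Pm mmax] : P m /\ forall n, P n -> (n <= m)%N.
  by rewrite /m; case: ex_maxnP.
have /asboolP[f [fi Wf]] := Pm.
exists m; split; last by exists f.
apply/le_anti/andP; split; last exact: lindim_ge fi Wf.
by apply: lindim_le => n g gi Wg; apply: mmax; apply/asboolP; exists g.
Qed.

(** A vector that is not a combination of a maximal independent family would
   extend it. *)
Lemma lindim_span W : (lindim W < +oo)%E -> exists n (f : 'I_n -> V),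
  (forall i, W (f i)) /\ forall w, W w -> exists c, w = \sum_i c i *: f i.
Proof.
move=> /lindim_attained[n [dn [f [fi Wf]]]]; exists n, f; split=> // w Ww.
pose g (i : 'I_n.+1) := if unlift ord0 i is Some j then f j else w.
have /existsNP[c] : ~ lin_indep g.
  move=> gi; have : (n.+1%:R%:E <= lindim W)%E.
    by apply: lindim_ge gi _ => i; rewrite /g; case: unliftP.
  by rewrite dn lee_fin ler_nat ltnn.
move=> /not_implyP[]; rewrite big_ord_recl /g unlift_none.
under eq_bigr do rewrite liftK.
move=> c0 /existsNP[i ci].
have c00 : c ord0 != 0.
  apply: contra_notN ci => /eqP c_0; move: c0; rewrite c_0 scale0r add0r => c0.
  by case: (unliftP ord0 i) => [j ->|->//]; exact: (fi (fun j => c (lift ord0 j)) c0).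
exists (fun j => - (c ord0)^-1 * c (lift ord0 j)).
under eq_bigr do rewrite -scalerA.
rewrite -scaler_sumr; apply: (scalerI c00); rewrite scalerA mulrN divff // scaleN1r.
by apply/eqP; rewrite -addr_eq0 c0.
Qed.

End Dimension.

(** * Resolvents *)

Section Resolvent.
Variables (R : realType) (X : completeNormedModType R[i]).
Variable ip : {dot X for conjC}.
Hypothesis hilbert : forall u, ip u u = `|u| ^+ 2.
Implicit Types (M V : set X) (S L : set (X * X)) (u v : X) (D G : {linear X -> X}).
Local Notation nsq := (nsq ip).
Local Notation approx := (approx ip).

Lemma ip_ext u v : (forall w, ip u w = ip v w) -> u = v.
Proof.
move=> h; apply/eqP; rewrite -subr_eq0 -(nsq_eq0 hilbert) /nsq ipBl h subrr //.
Qed.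

Lemma projection_op V : Defs.subspace V -> approx V `<=` V ->
  exists P : {linear X -> X}, [/\ (forall u, V (P u)),
    (forall u, V u -> P u = u), symmetric ip P, (forall u, nsq (P u) <= nsq u) &
    (forall u m, V m -> ip (u - P u) m = 0)].
Proof.
move=> Vs Vc; have [V0 Vl] := Vs.
have ex u : exists p, V p /\ forall m, V m -> ip (u - p) m = 0.
  by have [p Vp hp] := projection hilbert Vs Vc u; exists p.
have [p hp] := choice ex.
have uniq u q : V q -> (forall m, V m -> ip (u - q) m = 0) -> p u = q.
  move=> Vq hq; have Vpq : V (p u - q).
    by rewrite -scaleN1r addrC; apply: Vl => //; exact: (hp u).1.
  apply/eqP; rewrite -subr_eq0 -(nsq_eq0 hilbert) /nsq.
  have -> : ip (p u - q) (p u - q) = ip (u - q) (p u - q) - ip (u - p u) (p u - q).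
    by rewrite -ipBl; congr (ip _ _); rewrite opprB [RHS]addrC addrA subrK.
  by rewrite hq // (hp u).2 // subrr.
have pl : linear p.
  move=> a u v; apply: uniq; first by apply: Vl; [exact: (hp u).1|exact: (hp v).1].
  move=> m Vm.
  have -> : a *: u + v - (a *: p u + p v) = a *: (u - p u) + (v - p v).
    by rewrite scalerBr opprD addrACA.
  by rewrite ipDl ipZl (hp u).2 // (hp v).2 // mulr0 addr0.
pose P : {linear X -> X} := HB.pack p (GRing.isLinear.Build _ _ _ _ p pl).
have PV u : V (P u) := (hp u).1.
have Po u m : V m -> ip (u - P u) m = 0 := (hp u).2 m.
have Pip u m : V m -> ip (P u) m = ip u m.
  by move=> Vm; apply/esym/eqP; rewrite -subr_eq0 -ipBl Po.
exists P; split=> //.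
- by move=> u Vu; apply: uniq => // m _; rewrite subrr ip0l.
- move=> u v; rewrite -[LHS](_ : ip (P u) (P v) = _).
    by rewrite Pip.
  by rewrite ipC Pip // -ipC.
- move=> u; have -> : nsq u = nsq (P u) + nsq (u - P u).
    by have := nsqD ip (u - P u) (P u); rewrite subrK (Po _ _ (PV u)) /= => ->; lra.
  by rewrite lerDl nsq_ge0.
Qed.

Lemma norm_nsq_le u v (k : R[i]) : `|u| <= k * `|v| -> nsq u <= sqn k * nsq v.
Proof.
move=> h; have kv : 0 <= k * `|v| by apply: le_trans h.
rewrite -lecR -(nsq_normE hilbert) rmorphM /= -(nsq_normE hilbert) -sqn_normE.
have -> : `|k| ^+ 2 * `|v| ^+ 2 = (k * `|v|) ^+ 2.
  by rewrite -exprMn -(normr_id v) -normrM ger0_norm // normr_id.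
by rewrite ler_pXn2r // nnegrE.
Qed.

Lemma nsq_le_norm u v (c : R) : 0 <= c -> nsq u <= c * nsq v ->
  `|u| <= (Num.sqrt c)%:C * `|v|.
Proof.
move=> c0 h; rewrite !(norm_nsqE hilbert) -rmorphM lecR /= -sqrtrM //.
by rewrite ler_sqrt // mulr_ge0 // nsq_ge0.
Qed.

(** The resolvent of an operator in the subspace M, extended by zero to the
   orthogonal complement of M. *)
Lemma resolvent_op M S (P : {linear X -> X}) z : Defs.subspace S ->
  (forall u, M (P u)) -> (forall u, M u -> P u = u) ->
  (forall u, nsq (P u) <= nsq u) -> resolvent_set M S z ->
  exists G : {linear X -> X}, [/\ bounded ip G,
    (forall f, S (G f, P f + z *: G f)) &
    (forall u v, S (u, v) -> M (v - z *: u) -> u = G (v - z *: u))].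
Proof.
move=> [S0 Sl] PM PV Pn [onto [k below]].
have uniq u v u' v' : S (u, v) -> S (u', v') -> v - z *: u = v' - z *: u' -> u = u'.
  move=> Suv Suv' e; have := Sl (-1) _ _ Suv' Suv.
  move=> /below /norm_nsq_le; rewrite !scaleN1r /=.
  have -> : - v' + v - z *: (- u' + u) = 0.
    rewrite scalerDr scalerN opprD opprK; have := subrr (v - z *: u).
    by rewrite {2}e opprB addrC [z *: u' - _]addrC addrACA.
  rewrite nsq0 mulr0 => h; apply/eqP; rewrite -subr_eq0 addrC -(nsq_eq0 hilbert).
  by rewrite eq_le h nsq_ge0.
have ex f : exists u, S (u, P f + z *: u) by exact: onto.
have [g hg] := choice ex.
have gl : linear g.
  move=> a u v; apply: (uniq _ _ _ _ (hg _) (Sl a _ _ (hg u) (hg v))) => /=.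
  rewrite addrK opD opZ !scalerDr [z *: (a *: _)]scalerA mulrC -scalerA.
  by rewrite addrACA addrK.
pose G : {linear X -> X} := HB.pack g (GRing.isLinear.Build _ _ _ _ g gl).
exists G; split=> [|//|u v Suv Mv].
  exists (sqn k); first exact: sqn_ge0.
  move=> u; have := norm_nsq_le (below _ _ (hg u)).
  rewrite addrK => h; apply: le_trans h _; apply: ler_wpM2l => //.
  exact: sqn_ge0.
by apply: (uniq _ _ _ _ Suv (hg _)); rewrite /= addrK PV.
Qed.

(** The form is continuous: with u = m + r and m in V, its cross term is at most
   h (1 + nsq (D u)) / 2 once nsq r < h^2. *)
Lemma form_nonneg_approx V D : symmetric ip D -> bounded ip D ->
  (forall u, V u -> 0 <= complex.Re (ip (D u) u)) ->
  forall u, approx V u -> 0 <= complex.Re (ip (D u) u).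
Proof.
move=> Ds [k k0 Dk] Vp u Vu; rewrite -oppr_le0.
have n0 := nsq_ge0 hilbert (D u).
apply: (@le0_eps _ _ (nsq (D u) + k + 2)); first by lra.
move=> e e0; pose h := Num.min e 1.
have h0 : 0 < h by rewrite lt_min e0 ltr01.
have [h1 he] : h <= 1 /\ h <= e by rewrite /h !ge_min !lexx orbT.
have [m Vm um] := Vu (h ^+ 2) (exprn_gt0 _ h0).
have [r rE] : exists r, r = u - m by exists (u - m).
rewrite -rE in um; have := Vp _ Vm; have -> : m = u - r by rewrite rE opprB addrC subrK.
rewrite opB !ipBl !ipBr (Ds r u) (ipC ip (D u) r) !reimE.
have := bounded_form hilbert r k0 Dk; rewrite ler_norml => /andP[_ dr].
have := nsq_ge0 hilbert (r + h%:C *: D u); rewrite nsqD nsqZ // sqnR ipZr conjR ReZ.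
have := nsq_ge0 hilbert r.
move: (complex.Re (ip (D u) u)) (complex.Re (ip r (D u))) (complex.Re _) dr => x y z dr.
move: (nsq r) (nsq (D u)) n0 um dr => a b b0 ah dr a0 i1 i2.
have yy : - (2 * y) <= h + h * b.
  have : 0 <= h * (h + h * b + 2 * y) by nra.
  by rewrite pmulr_rge0 //; lra.
have : a <= h by nra.
nra.
Qed.

(** The component of u orthogonal to the range of D lies in the kernel of D, by
   symmetry, and u is orthogonal to the kernel. *)
Lemma ker_compl_approx D : symmetric ip D ->
  forall u, (forall v, D v = 0 -> ip u v = 0) -> approx (range D) u.
Proof.
move=> Ds u hu.
have Rs : Defs.subspace (range D).
  split; first by exists 0; rewrite ?op0.
  by move=> a _ _ [x _ <-] [y _ <-]; exists (a *: x + y); rewrite ?opD ?opZ.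
have [p Ap hp] := projection hilbert (approx_subspace hilbert Rs)
  (approx_approx hilbert (V := range D)) u.
suff -> : u = p by [].
apply/eqP; rewrite -subr_eq0 -(nsq_eq0 hilbert) /nsq.
rewrite ipBr (hp p Ap) subr0 ipC hu ?rmorph0 //.
apply: ip_ext => w; rewrite Ds hp ?ip0l //; apply: approx_sub.
by exists w.
Qed.

End Resolvent.

(** * Self-adjoint operators with finitely many eigenvalues below the continuous spectrum *)

Section SelfAdjoint.
Variables (R : realType) (X : completeNormedModType R[i]).
Variable ip : {dot X for conjC}.
Hypothesis hilbert : forall u, ip u u = `|u| ^+ 2.
Implicit Types (L : set (X * X)) (u v : X) (E : seq R) (w : R).
Local Notation nsq := (nsq ip).
Local Notation approx := (approx ip).

(** What the proof retains of the assumptions on the spectrum: all of it is real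
   and, up to the finite list E of points with finite-dimensional root spaces,
   bounded from below by w. *)
Definition spectrum_above L w E :=
  [/\ (forall z, Defs.spectrum setT L z ->
        (exists2 x, x \in E & z = x%:C) \/ w%:C <= z) &
      forall x, x \in E -> (lindim (root_space L x%:C) < +oo)%E].

Lemma self_adjoint_sym L u v a b : self_adjoint ip setT L ->
  L (u, v) -> L (a, b) -> ip v a = ip u b.
Proof. by move=> [_ _ _ _ e] Luv; rewrite e => -[_ _ /(_ _ Luv)]. Qed.

Lemma self_adjoint_eigenvalue_real L z : self_adjoint ip setT L ->
  Defs.eigenvalue L z -> z = (complex.Re z)%:C.
Proof.
move=> Ls [u u0 Lu]; have := self_adjoint_sym Ls Lu Lu.
rewrite ipZl ipZr; have n0 : ip u u != 0.
  by rewrite nsqE // -[0]/(0%:C) (inj_eq (@complexI R)) nsq_eq0.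
move=> /(mulIf n0)/(congr1 (@complex.Im R)); rewrite ImJ => e.
by apply: complexP; rewrite ?ReR ?ImR //; lra.
Qed.

(** E collects the discrete and the embedded eigenvalues, and what is left of the
   spectrum is continuous. *)
Lemma essential_spectrum_above L w : self_adjoint ip setT L ->
  essential_spectrum_cond ip L w -> discrete_spectrum_cond L ->
  exists E, spectrum_above L w E.
Proof.
move=> Ls [_ ess cont embfin embmult] disfin.
pose F := discrete_spectrum setT L `|` embedded_eigenvalue setT L.
have Ff : finite_set F by rewrite finite_setU.
have [s sF] := (finite_seqP F).1 Ff.
have Feig z : F z -> z = (complex.Re z)%:C.
  by case=> [[_ ez _]|[_ ez]]; exact: (self_adjoint_eigenvalue_real Ls ez).
exists [seq complex.Re z | z <- s]; split=> [z sz|_ /mapP[z zs ->]].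
  have [Fz|nFz] := pselect (F z).
    left; exists (complex.Re z); last exact: Feig.
    by apply/mapP; exists z => //; move: Fz; rewrite sF.
  right; have : essential_spectrum setT L z by split=> // dz; apply: nFz; left.
  by rewrite ess => -[/cont //|ez]; case: nFz; right.
have Fz : F z by rewrite sF.
rewrite -Feig //; case: Fz => [[_ _]|] //; exact: embmult.
Qed.

(** A point below the spectrum: the resolvent there is a bounded symmetric
   operator, and the spectrum of L becomes that of the resolvent under
   x -> 1 / (x - t). *)
Lemma resolvent_below L w E : self_adjoint ip setT L -> 0 <= w ->
  spectrum_above L w E -> exists t (G : {linear X -> X}),
  [/\ t < 0 /\ {in E, forall x, t < x}, bounded ip G, symmetric ip G &
   (forall f, L (G f, f + t%:C *: G f)) /\
   (forall u v, L (u, v) -> u = G (v - t%:C *: u))].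
Proof.
move=> Ls w0 [spec _]; pose t : R := - (1 + \sum_(x <- E) `|x|).
have sum0 : 0 <= \sum_(x <- E) `|x| by apply: sumr_ge0.
have t0 : t < 0 by rewrite /t; lra.
have tE : {in E, forall x, t < x}.
  move=> x xE; have : `|x| <= \sum_(x <- E) `|x|.
    rewrite (big_rem x) //= lerDl; exact: sumr_ge0.
  have := ler_norm (- x); rewrite normrN /t; lra.
have tr : resolvent_set setT L t%:C.
  apply: contrapT => ts; have [[x xE /complexI tx]|] := spec _ ts.
    by have := tE x xE; rewrite tx ltxx.
  by rewrite lecR; lra.
have [Lsub _ _ _ _] := Ls.
have [G [Gb GL GU]] := @resolvent_op _ _ _ hilbert setT L idfun _ Lsub
  (fun _ => I) (fun _ _ => erefl) (fun u => lexx _) tr.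
exists t, G; split=> //; last by split=> [//|u v Luv]; exact: GU.
move=> f g; have := self_adjoint_sym Ls (GL f) (GL g).
by rewrite ipDl ipDr ipZl ipZr conjR => /addIr.
Qed.

(** Since (L - t - 1 / z) G = - (G - z) / z, a bound of G f by its image under
   L - t - 1 / z is a bound by (G - z) f, and z f = G f - (G - z) f. *)
Lemma resolvent_spectrum L t (G : {linear X -> X}) z : Defs.subspace L ->
  bounded ip G ->
  (forall f, L (G f, f + t%:C *: G f)) -> z != 0 ->
  ~ bounded_below ip (shift G z) -> Defs.spectrum setT L (t%:C + z^-1).
Proof.
move=> [_ Ll] Gb GL z0 nb [_ [k hk]]; apply: nb.
have kk f : nsq (G f) <= sqn (k / z) * nsq (shift G z f).
  have -> : sqn (k / z) * nsq (shift G z f) = sqn k * nsq (z^-1 *: shift G z f).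
    by rewrite nsqZ // sqnM mulrA.
  rewrite -[nsq (_ *: _)]nsqN //.
  apply: norm_nsq_le => //; apply: le_trans (hk _ _ (GL f)) _.
  rewrite le_eqVlt; apply/orP; left; apply/eqP; congr (_ * `|_|).
  rewrite scalerDl shiftE scalerBr scalerA mulVf // scale1r.
  by rewrite opprD addrA addrK opprB.
have sz : 0 < sqn z by rewrite lt_def sqn_ge0 sqn_eq0 z0.
have sk := sqn_ge0 (k / z).
exists (sqn z / (2 * (1 + sqn (k / z)))).
  by apply: divr_gt0 => //; lra.
move=> f; rewrite mulrAC ler_pdivrMr; last lra.
have : nsq (z *: f) <= 2 * (nsq (G f) + nsq (shift G z f)).
  have -> : z *: f = G f - shift G z f by rewrite shiftE opprB addrC subrK.
  exact: nsqB_le.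
rewrite nsqZ //; have := kk f; lra.
Qed.

(** Partial fractions: once the remaining factors have produced eigenvectors V h,
   subtracting the vectors V h / (h - g) leaves an eigenvector for g. *)
Lemma ker_prod_eigen (G : {linear X -> X}) (s : seq R[i]) v : uniq s ->
  ev G (\prod_(g <- s) ('X - g%:P)) v = 0 ->
  exists V : R[i] -> X, (forall g, G (V g) = g *: V g) /\ v = \sum_(g <- s) V g.
Proof.
elim: s v => [|g s IH] v /=.
  rewrite big_nil evC scale1r => _ ->; exists (fun=> 0).
  by rewrite big_nil; split=> // g; rewrite op0 scaler0.
move=> /andP[gs us]; rewrite big_cons mulrC evM evXsub.
move=> /(IH _ us)[V [GV sV]].
pose W h := (h - g)^-1 *: V h.
have GW h : G (W h) = h *: W h by rewrite opZ GV !scalerA mulrC.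
have gW : shift G g (v - \sum_(h <- s) W h) = 0.
  rewrite shiftE opB scalerBr opprB [g *: _ - _]addrC addrACA.
  rewrite [- _ + g *: _]addrC -shiftE sV.
  suff -> : g *: (\sum_(h <- s) W h) - G (\sum_(h <- s) W h) = - \sum_(h <- s) V h.
    by rewrite subrr.
  rewrite scaler_sumr op_sum -sumrB -sumrN; apply: eq_big_seq => h hs.
  rewrite GW -scalerBl /W scalerA -opprB mulNr divff ?scaleN1r //.
  by rewrite subr_eq0; apply: contraNneq gs => <-.
exists (fun h => if h == g then v - \sum_(h <- s) W h else W h); split.
  move=> h; case: eqP => [->|//]; apply/eqP.
  by rewrite -subr_eq0 -shiftE gW.
rewrite big_cons eqxx -[LHS](subrK (\sum_(h <- s) W h)); congr (_ + _).
by apply: eq_big_seq => h hs; case: eqP gs => // <-; rewrite hs.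
Qed.

(** For the resolvent G at t and b = - 1 / t, the polynomial X (b - X) is negative
   only at the images of the negative points of E.  Multiplied by d^2, where d
   vanishes at these images, it is nonnegative on the spectrum of G, so the form
   of G (b - G) is nonnegative on the closed range of d(G), the orthogonal
   complement of the corresponding eigenvectors.  At f = (L - t) u this form is
   b (L u, u). *)
Lemma self_adjoint_neg_index L w E : self_adjoint ip setT L -> 0 <= w ->
  spectrum_above L w E ->
  exists a : seq X, forall u v, L (u, v) -> (forall x, x \in a -> ip u x = 0) ->
    0 <= complex.Re (ip v u).
Proof.
move=> Ls w0 sp; have [t [G [[t0 tE] Gb Gs [GL GU]]]] := resolvent_below Ls w0 sp.
have [Lsub _ _ _ _] := Ls; have [spec mult] := sp.
have m1 : (-1)%:C = -1 :> R[i] by apply: complexP; rewrite /= ?oppr0.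
have ex (x : R) : exists a : seq X, x \in E -> forall h, L (h, x%:C *: h) ->
    forall u, (forall y, y \in a -> ip u y = 0) -> ip u h = 0.
  have [xE|] := boolP (x \in E); last by exists [::].
  have [n [f [_ hf]]] := lindim_span (mult x xE).
  exists (codom f) => _ h Lh u ua.
  have [|c ->] := hf h; first by exists 1%N, 0; rewrite // addr0.
  by rewrite ip_sumr big1 // => i _; rewrite ipZr ua ?mulr0 // codom_f.
have [a ha] := choice ex.
exists (flatten [seq a x | x <- E]) => u v Luv uperp.
pose b := - t^-1.
have b0 : 0 < b by rewrite oppr_gt0 invr_lt0.
pose s := undup [seq (x - t)^-1 | x <- E & x < 0].
pose Dp : {poly R} := \prod_(g <- s) ('X - g%:P).
pose Tp : {poly R} := 'X * (b%:P - 'X).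
pose C := map_poly (real_complex R).
have q0 : 0 <= (Dp * Tp * Dp).[0].
  by rewrite /Tp !hornerM hornerX !(mul0r, mulr0).
have CD : C Dp = \prod_(g <- [seq g%:C | g <- s]) ('X - g%:P).
  rewrite /C rmorph_prod big_map /=; apply: eq_bigr => g _.
  by rewrite rmorphB /= map_polyX map_polyC.
have TG f : ev G (C Tp) f = G (b%:C *: f - G f).
  by rewrite /C rmorphM rmorphB /= map_polyX map_polyC evM evX evB evX evC.
have qpos z : z != 0 -> ~ bounded_below ip (shift G z) -> 0 <= (C (Dp * Tp * Dp)).[z].
  move=> z0 nb; have sz := resolvent_spectrum Lsub Gb GL z0 nb.
  have [x [zx xE]] : exists x, z = ((x - t)^-1)%:C /\ (x \in E \/ 0 <= x).
    have zE x : t%:C + z^-1 = x%:C -> z = ((x - t)^-1)%:C.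
      move=> e; rewrite fmorphV rmorphB /= -e addrC addKr invrK //.
    have [[x xE e]|ge] := spec _ sz; first by exists x; split; [exact: zE|left].
    have /ge0_complexP[im re] : 0 <= t%:C + z^-1.
      by apply: le_trans ge; rewrite lecR.
    exists (complex.Re (t%:C + z^-1)); split; last by right.
    by apply: zE; apply: complexP.
  rewrite zx /C horner_map lecR /= !hornerM.
  set y := (x - t)^-1; have [xn|xp] := ltP x 0.
    suff -> : Dp.[y] = 0 by rewrite !mul0r.
    apply/eqP; rewrite -[_ == 0]/(root Dp y) root_prod_XsubC mem_undup.
    apply/mapP; exists x => //; rewrite mem_filter xn; case: xE => //; lra.
  rewrite mulrAC -expr2 mulr_ge0 ?sqr_ge0 //.
  have y0 : 0 < y by rewrite invr_gt0; lra.
  have yb : y <= b by rewrite /b -invrN lef_pV2 ?posrE; lra.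
  by rewrite !(hornerD, hornerN, hornerC, hornerX) mulr_ge0 ?subr_ge0 // ltW.
have Tpos f : approx (range (ev G (C Dp))) f ->
    0 <= complex.Re (ip (ev G (C Tp) f) f).
  apply: (form_nonneg_approx hilbert (V := range (ev G (C Dp)))
    (D := ev G (C Tp))).
  - exact: ev_symmetric.
  - exact: ev_bounded.
  move=> _ [g _ <-]; have := poly_nonneg hilbert Gs Gb q0 qpos g.
  by rewrite /C !rmorphM /= !evM (@ev_symmetric _ _ ip G Dp Gs).
pose f := v - t%:C *: u; have uG : u = G f := GU _ _ Luv.
have vE : v = f + t%:C *: u by rewrite /f subrK.
have fperp k : ev G (C Dp) k = 0 -> ip f k = 0.
  rewrite CD => /ker_prod_eigen[|V [GV ->]].
    by rewrite map_inj_uniq ?undup_uniq //; exact: complexI.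
  rewrite ip_sumr big1_seq // => _ /andP[_ /mapP[g gs ->]].
  move: gs; rewrite mem_undup => /mapP[x]; rewrite mem_filter => /andP[x0 xE] gx.
  have g0 : g != 0 by rewrite gx invr_eq0 gt_eqF // subr_gt0 tE.
  have gC : g%:C != 0 :> R[i] by rewrite -[0]/(0%:C) (inj_eq (@complexI R)).
  have gip : ip f (g%:C *: V g%:C) = g%:C * ip f (V g%:C) by rewrite ipZr conjR.
  apply: (mulfI gC); rewrite mulr0 -gip -GV -Gs -uG.
  apply: (ha x xE) => [|y ya]; last first.
    by apply: uperp; apply/flattenP; exists (a x) => //; apply/mapP; exists x.
  have := GL (V g%:C); rewrite GV => LV.
  have := Lsub.2 (g%:C)^-1 _ _ LV Lsub.1.
  suff -> : (g%:C)^-1 *: (g%:C *: V g%:C, V g%:C + t%:C *: (g%:C *: V g%:C)) + 0 =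
     (V g%:C, x%:C *: V g%:C) by [].
  rewrite addr0; congr pair => /=; first by rewrite scalerA mulVf // scale1r.
  rewrite scalerDr !scalerA mulrCA mulVf // mulr1 -scalerDl; congr (_ *: _).
  by rewrite gx fmorphV invrK -rmorphD subrK.
have fa : approx (range (ev G (C Dp))) f.
  by apply: ker_compl_approx => //; exact: ev_symmetric.
have Guf : ip (G u) f = ip u u by rewrite Gs -uG.
have := Tpos f fa; rewrite TG opB opZ ipBl ipZl -uG Guf ReD ReN ReZ -/(nsq u).
rewrite vE ipDl ipZl ReD ReZ -/(nsq u).
have -> : ip f u = ip u f by rewrite uG Gs.
move=> h; have : 0 <= b * (complex.Re (ip u f) + t * nsq u).
  have bt : b * t = -1 by rewrite /b mulNr mulVf // lt_eqF.
  by rewrite mulrDr mulrA bt mulN1r.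
by rewrite pmulr_rge0.
Qed.

Lemma finite_gap (E : seq R) w : 0 < w ->
  exists eta : R, [/\ 0 < eta, eta <= w & {in E, forall x, x != 0 -> eta <= `|x|}].
Proof.
move=> w0; elim: E => [|x E [eta [e0 ew eE]]]; first by exists w; split.
have [->|xn] := eqVneq x 0.
  by exists eta; split=> // y; rewrite inE => /predU1P[->|/eE //]; rewrite eqxx.
exists (Num.min eta `|x|); split; first by rewrite lt_min e0 normr_gt0.
  by rewrite ge_min ew.
move=> y; rewrite inE => /predU1P[-> _|/eE h /h yn]; rewrite ge_min ?lexx ?orbT //.
by rewrite yn.
Qed.

(** Zero is at most an isolated point of the spectrum; for the resolvent this
   isolates the value b, and D^2 (D^2 - eps^2) >= 0 with D = G - b says that D
   is bounded below by eps on its range, hence on (ker D)^perp = (ker L)^perp. *)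
Lemma self_adjoint_closed_range L w E : self_adjoint ip setT L -> 0 < w ->
  spectrum_above L w E ->
  exists2 k : R, 0 <= k & forall f, ortho_compl ip (ker L) f ->
    exists u, [/\ L (u, f), ortho_compl ip (ker L) u & nsq u <= k * nsq f].
Proof.
move=> Ls w0 sp; have [t [G [[t0 tE] Gb Gs [GL GU]]]] := resolvent_below Ls (ltW w0) sp.
have [Lsub _ _ _ _] := Ls; have [spec mult] := sp.
have m1 : (-1)%:C = -1 :> R[i] by apply: complexP; rewrite /= ?oppr0.
have [eta [eta0 etaw etaE]] := finite_gap E w0.
pose b := - t^-1; have b0 : 0 < b by rewrite oppr_gt0 invr_lt0.
have bt : b * t = -1 by rewrite /b mulNr mulVf // lt_eqF.
pose eps := eta / (- t * (eta - t)).
have eps0 : 0 < eps by apply: divr_gt0 => //; apply: mulr_gt0; lra.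
pose D : {linear X -> X} := shift G b%:C.
have Ds : symmetric ip D := shift_symmetric b Gs.
have Db : bounded ip D := shift_bounded hilbert b%:C Gb.
pose Dp : {poly R} := 'X - b%:P.
pose Tp : {poly R} := Dp * Dp - (eps ^+ 2)%:P.
pose C := map_poly (real_complex R).
have CD f : ev G (C Dp) f = D f.
  by rewrite /C rmorphB /= map_polyX map_polyC evXsub.
have CT f : ev G (C Tp) f = D (D f) - (eps ^+ 2)%:C *: f.
  by rewrite /C rmorphB rmorphM /= map_polyC evB evM evC -/(C Dp) !CD.
have hor y : (Dp * Tp * Dp).[y] = (y - b) ^+ 2 * ((y - b) ^+ 2 - eps ^+ 2).
  by rewrite /Tp !(hornerM, hornerD, hornerN, hornerC, hornerX); ring.
have eps_le x : t < x -> (x \in E /\ x != 0) \/ w <= x ->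
    eps ^+ 2 <= ((x - t)^-1 - b) ^+ 2.
  move=> tx xE.
  have -> : (x - t)^-1 - b = x / (t * (x - t)).
    by rewrite /b; field; apply/andP; split; [lra|rewrite lt_eqF].
  have eE : eps = eta / (- t * (eta - t)) by [].
  have ax : eta <= `|x|.
    case: xE => [[xE x0]|wx]; first exact: etaE.
    by apply: le_trans (ler_norm x); lra.
  suff key : eps <= `|x / (t * (x - t))|.
    rewrite -[X in _ <= X]real_normK ?num_real //.
    by rewrite ler_pXn2r ?nnegrE ?normr_ge0 // ltW.
  rewrite normrM normfV normrM (ltr0_norm t0) [`|x - t|]gtr0_norm ?subr_gt0 //.
  rewrite eE ler_pdivrMr; last by apply: mulr_gt0; lra.
  rewrite mulrAC ler_pdivlMr; last by apply: mulr_gt0; lra.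
  have : eta * (x - t) <= `|x| * (eta - t).
    move: ax; have [xp|xn] := leP 0 x; first by rewrite ger0_norm //; nra.
    by rewrite ltr0_norm //; nra.
  by nra.
have q0 : 0 <= (Dp * Tp * Dp).[0].
  rewrite hor sub0r sqrrN mulr_ge0 ?sqr_ge0 // subr_ge0.
  rewrite ler_pXn2r ?nnegrE ?(ltW eps0) ?(ltW b0) // /eps /b -invrN.
  rewrite ler_pdivrMr; last by apply: mulr_gt0; lra.
  by rewrite mulrA mulVf ?mul1r; lra.
have qpos z : z != 0 -> ~ bounded_below ip (shift G z) -> 0 <= (C (Dp * Tp * Dp)).[z].
  move=> z0 nb; have sz := resolvent_spectrum Lsub Gb GL z0 nb.
  have [x [zx tx xE]] : exists x, [/\ z = ((x - t)^-1)%:C, t < x & x \in E \/ w <= x].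
    have zE x : t%:C + z^-1 = x%:C -> z = ((x - t)^-1)%:C.
      move=> e; rewrite fmorphV rmorphB /= -e addrC addKr invrK //.
    have [[x xE e]|ge] := spec _ sz.
      by exists x; split; [exact: zE|exact: tE|left].
    move: ge; rewrite lecE ReR ImR => /andP[/eqP im re].
    exists (complex.Re (t%:C + z^-1)); split; [|lra|by right].
    by apply: zE; apply: complexP.
  rewrite zx /C horner_map lecR /= hor.
  have [x0|x0] := eqVneq x 0.
    by rewrite x0 sub0r invrN -/b subrr expr0n mul0r.
  rewrite mulr_ge0 ?sqr_ge0 // subr_ge0; apply: eps_le => //.
  by case: xE => ?; [left|right].
have kerD v : D v = 0 <-> ker L v.
  rewrite /D shiftE; split=> [/eqP|Lv].
    rewrite subr_eq0 => /eqP Gv; have := GL v; rewrite Gv scalerA -rmorphM /= mulrC bt.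
    rewrite m1 scaleN1r subrr => Lbv.
    have := Lsub.2 (b%:C)^-1 _ _ Lbv Lsub.1.
    suff -> : (b%:C)^-1 *: (b%:C *: v, 0 : X) + 0 = (v, 0) by [].
    congr pair; rewrite /= ?scaler0 ?addr0 //.
    rewrite scalerA mulVf ?scale1r // -[0]/(0%:C) (inj_eq (@complexI R)).
    by rewrite gt_eqF.
  have := GU _ _ Lv; rewrite sub0r opN opZ -scaleNr => vE.
  rewrite {2}vE scalerA mulrN -rmorphM /= bt m1 opprK scale1r subrr //.
have below f : ortho_compl ip (ker L) f -> eps ^+ 2 * nsq f <= nsq (D f).
  move=> hf; have fa : approx (range (ev G (C Dp))) f.
    apply: ker_compl_approx => //; first exact: ev_symmetric.
    by move=> v; rewrite /= CD => /kerD /hf.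
  suff : 0 <= complex.Re (ip (ev G (C Tp) f) f).
    by rewrite CT ipBl ipZl Ds ReD ReN ReZ subr_ge0.
  apply: (form_nonneg_approx hilbert (V := range (ev G (C Dp)))
    (D := ev G (C Tp))) => //.
  - exact: ev_symmetric.
  - exact: ev_bounded.
  move=> _ [g _ <-]; have := poly_nonneg hilbert Gs Gb q0 qpos g.
  by rewrite /C !rmorphM /= !evM (@ev_symmetric _ _ ip G Dp Gs).
have DV u : ortho_compl ip (ker L) (D u).
  by move=> v /kerD Dv; rewrite Ds Dv ip0r.
have [kD _ hkD] := Db.
have onto := @bounded_below_onto _ _ ip hilbert D (ortho_compl ip (ker L)) (eps ^+ 2)
  (ortho_compl_subspace ip (ker L)) (ortho_compl_closed hilbert (V := ker L))
  (fun u _ => DV u) (exprn_gt0 _ eps0) below (ex_intro _ kD hkD).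
have {}onto : forall f, ortho_compl ip (ker L) f ->
    exists2 u, ortho_compl ip (ker L) u & D u = f.
  apply: onto => v Vv hv; have Dv : D v = 0.
    by apply/eqP; rewrite -(nsq_eq0 hilbert) /nsq -Ds hv.
  by apply/eqP; rewrite -(nsq_eq0 hilbert) /nsq; apply/eqP; rewrite Vv //; apply/kerD.
have [Os Ol] := ortho_compl_subspace ip (ker L).
pose ti : R[i] := (t^-1)%:C.
exists (2 * (1 + b ^+ 2 / eps ^+ 2) * sqn ti).
  apply: mulr_ge0; last exact: sqn_ge0.
  apply: mulr_ge0 => //; apply: addr_ge0 => //; apply: divr_ge0; exact: sqr_ge0.
have OZ a g : ortho_compl ip (ker L) g -> ortho_compl ip (ker L) (a *: g).
  by move=> Og; rewrite -[_ *: _]addr0; exact: Ol.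
move=> f Of; have [y Oy Dy] := onto _ (OZ ti f Of).
have Gy : G y = ti *: f + b%:C *: y by rewrite -Dy shiftE subrK.
exists (G y); split.
- have := GL y; congr (L (_, _)); rewrite Gy scalerDr !scalerA -!rmorphM /=.
  rewrite mulfV ?lt_eqF // [t * b]mulrC bt m1 scaleN1r scale1r.
  by rewrite addrCA subrr addr0.
- by rewrite Gy addrC; apply: Ol => //; exact: OZ.
have := below y Oy; rewrite Dy nsqZ // => hy.
rewrite Gy; apply: le_trans (nsqD_le hilbert _ _) _; rewrite !nsqZ // (sqnR b).
have hb : b ^+ 2 * nsq y <= b ^+ 2 / eps ^+ 2 * (sqn ti * nsq f).
  by rewrite -mulrA ler_wpM2l ?sqr_ge0 // ler_pdivlMl // exprn_gt0.
move: hb; move: (b ^+ 2 / _) (b ^+ 2 * nsq y) => q B hb.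
have := hb; rewrite mulrA => {}hb; lra.
Qed.

End SelfAdjoint.

(** * Invariant subspaces of dissipative matrices *)

Lemma rank_kermxpolyM (F : fieldType) n (M : 'M[F]_n) (p q : {poly F}) : coprimep p q ->
  (\rank (kermxpoly M (p * q)) <= \rank (kermxpoly M p) + \rank (kermxpoly M q))%N.
Proof. by move=> cop; rewrite (kermxpolyM M cop); exact: (mxrank_adds_leqif _ _).1. Qed.

Lemma rank_kermxpoly_prod (F : fieldType) n (M : 'M[F]_n) (I : eqType) (r : seq I)
    (p : I -> {poly F}) : uniq r -> (forall i j, i != j -> coprimep (p i) (p j)) ->
  (\rank (kermxpoly M (\prod_(i <- r) p i)) <=
   \sum_(i <- r) \rank (kermxpoly M (p i)))%N.
Proof.
move=> + cop; elim: r => [|i r IH] /=; first by rewrite !big_nil kermxpoly1 mxrank0.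
move=> /andP[ir ur]; rewrite !big_cons; apply: leq_trans (rank_kermxpolyM _ _) _; last first.
  by rewrite leq_add2l IH.
elim: r ir {IH ur} => [|j r IH]; first by rewrite big_nil coprimep1.
by rewrite inE negb_or => /andP[ij ir]; rewrite big_cons coprimepMr IH // andbT cop.
Qed.

Section Lyapunov.
Variable R : realType.
Local Notation C := R[i].

Definition adjmx m n (A : 'M[C]_(m, n)) : 'M[C]_(n, m) := map_mx conjC A^T.

Lemma adjmxM m n p (A : 'M[C]_(m, n)) (B : 'M[C]_(n, p)) :
  adjmx (A *m B) = adjmx B *m adjmx A.
Proof. by rewrite /adjmx trmx_mul map_mxM. Qed.

Lemma adjmxK m n (A : 'M[C]_(m, n)) : adjmx (adjmx A) = A.
Proof. by apply/matrixP => i j; rewrite !mxE conjCK. Qed.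

Lemma adjmxD m n (A B : 'M[C]_(m, n)) : adjmx (A + B) = adjmx A + adjmx B.
Proof. by apply/matrixP => i j; rewrite !mxE rmorphD. Qed.

Lemma adjmx_row m n1 n2 (A : 'M[C]_(m, n1)) (B : 'M[C]_(m, n2)) :
  adjmx (row_mx A B) = col_mx (adjmx A) (adjmx B).
Proof. by rewrite /adjmx tr_row_mx map_col_mx. Qed.

Lemma adjmxZ m n (a : R) (A : 'M[C]_(m, n)) : adjmx (a%:C *: A) = a%:C *: adjmx A.
Proof. by apply/matrixP => i j; rewrite !mxE rmorphM /= conjR. Qed.

Definition hform n (M : 'M[C]_n) (x : 'rV[C]_n) : C := (x *m M *m adjmx x) 0 0.

Lemma hformM n m (M : 'M[C]_n) (B : 'M[C]_(m, n)) x :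
  hform M (x *m B) = hform (B *m M *m adjmx B) x.
Proof. by rewrite /hform adjmxM !mulmxA. Qed.

Lemma hformZ n (M : 'M[C]_n) a x : hform (a *: M) x = a * hform M x.
Proof. by rewrite /hform -scalemxAr -scalemxAl mxE. Qed.

Lemma hformD n (M N : 'M[C]_n) x : hform (M + N) x = hform M x + hform N x.
Proof. by rewrite /hform mulmxDr mulmxDl mxE. Qed.

Lemma hform_adj n (M : 'M[C]_n) x : hform (adjmx M) x = conjC (hform M x).
Proof.
rewrite /hform; have -> : x *m adjmx M *m adjmx x = adjmx (x *m M *m adjmx x).
  by rewrite !adjmxM adjmxK mulmxA.
by rewrite !mxE.
Qed.

Lemma hform_real n (M : 'M[C]_n) x : adjmx M = M -> complex.Im (hform M x) = 0.
Proof.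
move=> e; have := hform_adj M x; rewrite e => /(congr1 (@complex.Im R)).
rewrite ImJ; lra.
Qed.

Lemma hform1 n (x : 'rV[C]_n) : hform 1%:M x = (\sum_j sqn (x 0 j))%:C.
Proof.
rewrite /hform mulmx1 mxE rmorph_sum; apply: eq_bigr => j _.
by rewrite !mxE sqn_mulJ.
Qed.

Lemma hform1_ge0 n (x : 'rV[C]_n) : 0 <= complex.Re (hform 1%:M x).
Proof. by rewrite hform1; apply: sumr_ge0 => j _; exact: sqn_ge0. Qed.

Lemma hform1_gt0 n (x : 'rV[C]_n) : x != 0 -> 0 < complex.Re (hform 1%:M x).
Proof.
move=> x0; rewrite lt_def hform1_ge0 andbT; apply: contra x0.
rewrite hform1 ReR psumr_eq0 => [/allP h|j _]; last exact: sqn_ge0.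
apply/eqP/matrixP => i j; rewrite ord1 mxE; apply/eqP; rewrite -sqn_eq0.
by have := h j; rewrite mem_index_enum; apply.
Qed.

(** Lyapunov's inertia theorem for a triangular matrix T.  Completing the
   square in the first coordinate, whose coefficient is negative, leaves the
   Schur complement, for which T loses its first row and column. *)
Lemma lyapunov_trig n (T H : 'M[C]_n) : is_trig_mx T -> adjmx H = H ->
  (forall x, x != 0 -> 0 < complex.Im (hform (T *m H) x)) ->
  (forall i, complex.Im (T i i) < 0) ->
  forall x, x != 0 -> complex.Re (hform H x) < 0.
Proof.
elim: n T H => [|n IH] T H Tt Hh Tp Td x x0.
  by move: x0; rewrite thinmx0 eqxx.
move: T H Tt Hh Tp Td x x0; rewrite -[n.+1]/(1 + n)%N => T H Tt Hh Tp Td x x0.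
have T12 : ursubmx T = 0.
  apply/matrixP => i j; rewrite !mxE; apply/(is_trig_mxP Tt).
  by rewrite /= ord1.
have TE : T = block_mx (ulsubmx T) 0 (dlsubmx T) (drsubmx T).
  by rewrite -T12 submxK.
set a := ulsubmx T in TE; set c := dlsubmx T in TE; set D := drsubmx T in TE.
have HE : H = block_mx (ulsubmx H) (ursubmx H) (dlsubmx H) (drsubmx H).
  by rewrite submxK.
set h := ulsubmx H in HE; set b := dlsubmx H in HE; set K := drsubmx H in HE.
have bE : ursubmx H = adjmx b.
  by rewrite -[in LHS]Hh; apply/matrixP => i j; rewrite !mxE.
have KE : adjmx K = K.
  by rewrite -[in RHS]/K /K -[in RHS]Hh; apply/matrixP => i j; rewrite !mxE.
rewrite bE in HE.
pose h0 := complex.Re (h 0 0).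
have hE : h = (h0%:C)%:M.
  apply/matrixP => i j; rewrite !ord1 [in RHS]mxE eqxx mulr1n.
  apply: complexP; rewrite // ImR.
  have : adjmx h = h by rewrite /h -[in RHS]Hh; apply/matrixP => i' j'; rewrite !mxE.
  move=> /matrixP/(_ 0 0)/(congr1 (@complex.Im R)).
  by rewrite [in LHS]mxE [in LHS]mxE ImJ; lra.
have a0 : complex.Im (a 0 0) < 0.
  by have := Td (lshift n 0); rewrite /a !mxE.
have h0_lt0 : h0 < 0.
  have : 0 < complex.Im (hform (T *m H) (row_mx 1%:M 0)).
    apply: Tp; apply/eqP => /matrixP/(_ 0 (lshift n 0)).
    by rewrite row_mxEl !mxE eqxx => /eqP; rewrite oner_eq0.
  rewrite /hform adjmx_row mulmxA TE mul_row_block !mul1mx !mul0mx !addr0.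
  rewrite HE mul_row_block !mul0mx !addr0 mul_row_col hE mul_mx_scalar.
  have -> : adjmx (0 : 'M[C]_(1, n)) = 0 by apply/matrixP => i j; rewrite !mxE rmorph0.
  have -> : adjmx (1%:M : 'M[C]_1) = 1%:M.
    by apply/matrixP => i j; rewrite !mxE !ord1 eqxx rmorph1.
  rewrite mulmx0 addr0 mulmx1 mxE !reimE mul0r addr0.
  by move=> hh; nra.
pose hi : C := (h0^-1)%:C.
pose K' := K - hi *: (b *m adjmx b).
pose x0f (x1 : 'rV[C]_n) := - hi *: (x1 *m b).
have HX x1 : H *m adjmx (row_mx (x0f x1) x1) = col_mx 0 (K' *m adjmx x1).
  have ax0 : adjmx (x0f x1) = - hi *: (adjmx b *m adjmx x1).
    by rewrite /x0f -adjmxM; apply/matrixP => i j; rewrite !mxE rmorphM rmorphN /hi /= conjR.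
  rewrite adjmx_row HE mul_block_col ax0 hE mul_scalar_mx scalerA.
  have -> : h0%:C * - hi = -1.
    by rewrite mulrN -rmorphM /= mulfV ?lt_eqF // ; apply: complexP; rewrite /= ?oppr0.
  rewrite scaleN1r addNr; congr col_mx.
  by rewrite -scalemxAr scaleNr mulmxBl -scalemxAl mulmxA addrC.
have hX (M : 'M[C]_(1 + n)) x1 : hform (M *m H) (row_mx (x0f x1) x1) =
    (rsubmx (row_mx (x0f x1) x1 *m M) *m (K' *m adjmx x1)) 0 0.
  rewrite /hform mulmxA -mulmxA HX -{1}(hsubmxK (_ *m M)) mul_row_col mulmx0 add0r //.
have K'neg x1 : x1 != 0 -> complex.Re (hform K' x1) < 0.
  apply: (IH D).
  - apply/is_trig_mxP => i j ij; rewrite /D !mxE; apply/(is_trig_mxP Tt).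
    by rewrite /= ltn_add2l.
  - rewrite /K'; apply/matrixP => i j; rewrite -[in RHS]KE !mxE rmorphB rmorphM /hi /= conjR.
    congr (_ - _ * _); rewrite rmorph_sum; apply: eq_bigr => l _.
    by rewrite !mxE rmorphM /= conjCK mulrC.
  - move=> y y0; have := Tp (row_mx (x0f y) y).
    rewrite hX TE mul_row_block row_mxKr mulmx0 add0r /hform !mulmxA; apply.
    by apply: contra y0 => /eqP/(congr1 rsubmx); rewrite row_mxKr linear0 => ->.
  - by move=> i; have := Td (rshift 1 i); rewrite /D !mxE.
pose y1 := rsubmx x; pose z := lsubmx x - x0f y1.
have xE : x = row_mx (x0f y1) y1 + row_mx z 0.
  by rewrite add_row_mx addr0 /z addrC subrK /y1 hsubmxK.
have HXz : hform H x = hform K' y1 + (h0 * sqn (z 0 0))%:C.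
  have XHz : row_mx z 0 *m H *m adjmx (row_mx (x0f y1) y1) = 0.
    by rewrite -mulmxA HX mul_row_col mulmx0 mul0mx addr0.
  have zHX : row_mx (x0f y1) y1 *m H *m adjmx (row_mx z 0) = 0.
    have := congr1 (@adjmx _ _) XHz; rewrite !adjmxM adjmxK Hh mulmxA => ->.
    by apply/matrixP => i j; rewrite !mxE rmorph0.
  rewrite /hform {1 2}xE adjmxD mulmxDl mulmxDr !mulmxDl XHz zHX addr0 add0r.
  rewrite mxE; congr (_ + _).
    have := hX 1%:M y1; rewrite mul1mx mulmx1 row_mxKr /hform => ->.
    by rewrite mulmxA.
  rewrite HE mul_row_block !mul0mx !addr0 adjmx_row mul_row_col hE mul_mx_scalar.
  have -> : adjmx (0 : 'M[C]_(1, n)) = 0 by apply/matrixP => i j; rewrite !mxE rmorph0.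
  by rewrite mulmx0 addr0 -scalemxAl mxE mxE big_ord1 !mxE sqn_mulJ rmorphM.
rewrite HXz ReD ReR.
have [y10|y10] := eqVneq y1 0.
  have z0 : z 0 0 != 0.
    apply: contra x0 => /eqP z00; rewrite xE y10 /x0f mul0mx scaler0 row_mx0 add0r.
    suff -> : z = 0 by rewrite row_mx0.
    by apply/matrixP => i j; rewrite !ord1 z00 mxE.
  rewrite /hform y10 !mul0mx mxE ReR add0r nmulr_rlt0 //.
  by rewrite lt_def sqn_eq0 z0 sqn_ge0.
have := K'neg _ y10; have := sqn_ge0 (z 0 0); nra.
Qed.

(** Schur's unitary triangularisation preserves the assumptions. *)
Lemma lyapunov n (T H : 'M[C]_n) : adjmx H = H ->
  (forall x, x != 0 -> 0 < complex.Im (hform (T *m H) x)) ->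
  (forall a, eigenvalue T a -> complex.Im a < 0) ->
  forall x, x != 0 -> complex.Re (hform H x) < 0.
Proof.
case: n T H => [|n] T H Hh Tp Te x x0; first by move: x0; rewrite thinmx0 eqxx.
have [P Pu Pt] := @Schur _ _ T isT.
have Pun : P \in unitmx by exact: unitarymx_unit.
have [S SE St] : exists2 S, P *m T = S *m P & is_trig_mx S.
  exists (conjmx P T) => //; rewrite conjumx // -!mulmxA mulVmx // mulmx1 //.
have xP : x = (x *m invmx P) *m P by rewrite mulmxKV.
rewrite xP hformM; apply: (@lyapunov_trig _ S) => //.
- by rewrite !adjmxM adjmxK Hh mulmxA.
- move=> y y0; rewrite !mulmxA -SE -[P *m T *m H]mulmxA -hformM; apply: Tp.
  by apply: contra y0 => /eqP yP; rewrite -(mulmxK Pun y) yP mul0mx.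
- move=> i; apply: Te.
  have /eigenvalueP[v vS v0] : eigenvalue S (S i i).
    rewrite eigenvalue_root_char char_poly_trig // /root horner_prod.
    by rewrite (bigD1 i) //= hornerXsubC subrr mul0r.
  apply/eigenvalueP; exists (v *m P).
    by rewrite -mulmxA SE mulmxA vS scalemxAl.
  by apply: contra v0 => /eqP vP; rewrite -(mulmxK Pun v) vP mul0mx.
- by apply: contra x0 => /eqP yP; rewrite xP yP mul0mx.
Qed.

Lemma eigen_horner_mx n (A : 'M[C]_n.+1) (p : {poly C}) (v : 'rV[C]_n.+1) a :
  v *m A = a *: v -> v *m horner_mx A p = p.[a] *: v.
Proof.
move=> vA; elim/poly_ind: p => [|p c IH].
  by rewrite rmorph0 mulmx0 horner0 scale0r.
rewrite rmorphD rmorphM /= horner_mx_X horner_mx_C mulmxDr hornerMXaddC scalerDl.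
by rewrite mul_mx_scalar -mulmxE mulmxA IH -scalemxAl vA scalerA.
Qed.

Lemma eigen_kermxpoly n (M : 'M[C]_n) p (w : 'rV[C]_n) a :
  w *m M = a *: w -> w != 0 -> (w <= kermxpoly M p)%MS -> root p a.
Proof.
case: n M w => [|n] M w; first by rewrite (thinmx0 w) eqxx.
move=> wM w0 /sub_kermxP; rewrite (eigen_horner_mx _ wM) => /eqP.
by rewrite scaler_eq0 (negbTE w0) orbF.
Qed.

(** The kernel of p(M), where p has all its roots on one side of the real axis, is
   invariant under M; Lyapunov's theorem for the restriction of M, or of - M if
   s < 0, makes H definite there.  Applied to both sides, this yields the indices
   of inertia of H. *)
Lemma definite_eigenspace n (M H : 'M[C]_n) (p : {poly C}) (s : R) :
  s != 0 -> adjmx H = H -> (forall x, x != 0 -> 0 < complex.Im (hform (M *m H) x)) ->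
  (forall a, root p a -> s * complex.Im a < 0) ->
  exists k (B : 'M[C]_(k, n)) (T : 'M[C]_k),
   [/\ k = \rank (kermxpoly M p), B *m M = T *m B, row_free B,
      (forall x, x != 0 -> s * complex.Re (hform H (x *m B)) < 0) &
      (forall a, eigenvalue T a -> root p a)].
Proof.
move=> s0 Hh Mp ps.
have [k [B [T [kE BM Bf Teig]]]] : exists k (B : 'M[C]_(k, n)) (T : 'M[C]_k),
    [/\ k = \rank (kermxpoly M p), B *m M = T *m B, row_free B &
        forall a, eigenvalue T a -> root p a].
  pose U := kermxpoly M p.
  have st : (row_base U *m M <= row_base U)%MS.
    have UM : (U *m M <= U)%MS := comm_mx_stable_kermxpoly p (comm_mx_refl M).
    by rewrite eq_row_base; apply: submx_trans UM; apply: submxMr; rewrite eq_row_base.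
  exists (\rank U), (row_base U), (row_base U *m M *m pinvmx (row_base U)).
  split; [by []|by rewrite mulmxKpV|exact: row_base_free|].
  move=> a /eigenvalueP[v vT v0]; apply: (@eigen_kermxpoly _ M p (v *m row_base U)).
  - by rewrite -mulmxA -(mulmxKpV st) mulmxA vT scalemxAl.
  - apply: contra v0 => /eqP e; apply/eqP; apply: (row_free_inj (row_base_free U)).
    by rewrite e mul0mx.
  - by rewrite (submx_trans (submxMl _ _)) // eq_row_base.
exists k, B, T; split=> //.
have xB (x : 'rV[C]_k) : (x *m B == 0) = (x == 0).
  apply/eqP/eqP => [e|->]; last by rewrite mul0mx.
  by apply: (row_free_inj Bf); rewrite e mul0mx.
pose c : R := Num.sg s.
have cs : c * s = `|s| by rewrite /c -normrEsg.
have cc : c * c = 1 by rewrite /c -expr2 sqr_sg s0.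
move=> x x0.
have Ls : c * complex.Re (hform (B *m H *m adjmx B) x) < 0.
  rewrite -ReZ -hformZ.
  apply: (@lyapunov _ (c%:C *: T) (c%:C *: (B *m H *m adjmx B)) _ _ _ x x0).
  - by rewrite adjmxZ !adjmxM adjmxK Hh mulmxA.
  - move=> y y0; rewrite -scalemxAr -scalemxAl scalerA -rmorphM /= cc scale1r.
    have -> : T *m (B *m H *m adjmx B) = B *m (M *m H) *m adjmx B.
      by rewrite !mulmxA -BM.
    by rewrite -hformM; apply: Mp; rewrite xB.
  - move=> a /eigenvalueP[v vT v0].
    have /ps : root p (c%:C * a).
      apply: Teig; apply/eigenvalueP; exists v => //.
      by rewrite -scalerA -vT -scalemxAr scalerA -rmorphM /= cc scale1r.
    by rewrite ImM ReR ImR mul0r addr0 mulrA [s * c]mulrC cs pmulr_rlt0 ?normr_gt0.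
have sE : s = `|s| * c by rewrite /c mulrC -numEsg.
by rewrite hformM sE -mulrA pmulr_rlt0 ?normr_gt0.
Qed.

Lemma rank_kermxpoly_char n (M : 'M[C]_n) :
  \rank (kermxpoly M (char_poly M)) = n.
Proof.
case: n M => [|n] M; first by apply/eqP; rewrite -leqn0 rank_leq_row.
by rewrite (kermxpoly_min (mxminpoly_dvd_char M)) mxrank1.
Qed.

Lemma horner_char_poly n (A : 'M[C]_n) a : (char_poly A).[a] = \det (a%:M - A).
Proof.
rewrite /char_poly -[_.[a]]/(horner_eval a _) -det_map_mx; congr (\det _).
apply/matrixP => i j; rewrite !mxE /= horner_evalE hornerD hornerN hornerC.
by rewrite hornerMn hornerX.
Qed.

Lemma char_poly_split n (A : 'M[C]_n) : exists rs : seq C,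
  char_poly A = \prod_(r <- rs) ('X - r%:P) /\ size rs = n.
Proof.
have [rs e] := closed_field_poly_normal (char_poly A).
have /monicP lc := char_poly_monic A.
rewrite lc scale1r in e; exists rs; split=> //.
by have := size_char_poly A; rewrite e size_prod_XsubC => -[].
Qed.

Definition signmx k p : 'M[C]_(k + p) := block_mx (- 1%:M) 0 0 1%:M.

Lemma adj_signmx k p : adjmx (signmx k p) = signmx k p.
Proof.
rewrite /signmx /adjmx tr_block_mx map_block_mx !trmx0 !map_mx0.
rewrite linearN /= !trmx1 map_mxN !map_mx1 //.
Qed.

Lemma signmxK k p : signmx k p *m signmx k p = 1%:M.
Proof.
rewrite /signmx mulmx_block !mul0mx !mulmx0 !addr0 !add0r mulmx1 mulNmx mul1mx.
by rewrite opprK -scalar_mx_block.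
Qed.

Lemma hform_signmx k p (x : 'rV[C]_k) (y : 'rV[C]_p) :
  hform (signmx k p) (row_mx x y) = hform 1%:M y - hform 1%:M x.
Proof.
rewrite /hform /signmx mul_row_block !mulmx0 addr0 add0r adjmx_row mul_row_col.
by rewrite mulmxN mulNmx mxE addrC [in X in _ + X]mxE.
Qed.

(** M = (S + i eps) J has no real eigenvalue, because Im (M J) > 0.  Its
   invariant subspace for the lower half-plane is negative for J and, the one
   for the upper half-plane being positive, has dimension k: it is the graph of a
   contraction G.  That the eigenvalues of T lie in the lower half-plane is
   recorded as a lower bound of the characteristic polynomial in the upper one,
   which survives limits of matrices. *)
Lemma dissipative_invariant k p (S : 'M[C]_(k + p)) (eps : R) :
  adjmx S = S -> 0 < eps ->
  exists (G : 'M[C]_(k, p)) (T : 'M[C]_k),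
  [/\ row_mx 1%:M G *m (S + (eps%:C * 'i)%:M) *m signmx k p = T *m row_mx 1%:M G,
     (forall c : 'rV[C]_k,
        complex.Re (hform 1%:M (c *m G)) <= complex.Re (hform 1%:M c)) &
     (forall a, 0 < complex.Im a ->
        (complex.Im a ^+ 2) ^+ k <= sqn (\det (a%:M - T)))].
Proof.
move=> Sh eps0; set S' := S + _; set J := signmx k p; pose M := S' *m J.
have Jh : adjmx J = J by exact: adj_signmx.
have Mp x : x != 0 -> 0 < complex.Im (hform (M *m J) x).
  move=> x0; rewrite /M -mulmxA signmxK mulmx1 /S'.
  have -> : hform (S + (eps%:C * 'i)%:M) x = hform S x + (eps%:C * 'i) * hform 1%:M x.
    by rewrite hformD -scalemx1 hformZ.
  rewrite ImD hform_real // add0r -mulrA ImM ReR ImR mul0r addr0.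
  by rewrite mulr_gt0 // mulrC ImM /= mulr0 mulr1 addr0 hform1_gt0.
have real_eig a : eigenvalue M a -> complex.Im a != 0.
  move=> /eigenvalueP[v vM v0]; have := Mp v v0.
  have -> : hform (M *m J) v = a * hform J v.
    by rewrite /hform mulmxA vM -!scalemxAl mxE.
  rewrite ImM (hform_real _ Jh) mulr0 add0r.
  by apply: contraTneq => ->; rewrite mul0r ltxx.
have [rs [chM _]] := char_poly_split M.
have rs_eig r : r \in rs -> eigenvalue M r.
  by rewrite eigenvalue_root_char chM root_prod_XsubC.
pose lower := [seq r <- rs | complex.Im r < 0].
pose upper := [seq r <- rs | ~~ (complex.Im r < 0)].
pose pl : {poly C} := \prod_(r <- lower) ('X - r%:P).
pose pu : {poly C} := \prod_(r <- upper) ('X - r%:P).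
have chE : char_poly M = pl * pu.
  by rewrite chM /pl /pu !big_filter [LHS](bigID (fun r => complex.Im r < 0)).
have pl_root a : root pl a -> complex.Im a < 0.
  by rewrite root_prod_XsubC mem_filter => /andP[].
have pu_root a : root pu a -> 0 < complex.Im a.
  rewrite root_prod_XsubC mem_filter -leNgt => /andP[a0 /rs_eig/real_eig an].
  by rewrite lt_def an.
have [|kl [Bl [Tl [klE BlM Blf Bln Tle]]]] :=
    @definite_eigenspace _ M J pl 1 (oner_neq0 _) Jh Mp.
  by move=> a /pl_root; rewrite mul1r.
have [|ku [Bu [_ [kuE _ Buf Bup _]]]] :=
    @definite_eigenspace _ M J pu (-1) ltac:(by rewrite oppr_eq0 oner_eq0) Jh Mp.
  by move=> a /pu_root; rewrite mulN1r oppr_lt0.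
have Bl0 (x : 'rV[C]_kl) : x *m lsubmx Bl = 0 -> x = 0.
  move=> e; apply/eqP; apply: contraT => /Bln; rewrite mul1r.
  rewrite -(hsubmxK (x *m Bl)) -mulmx_lsub e hform_signmx.
  have -> : hform 1%:M (0 : 'rV[C]_k) = 0 by rewrite /hform !mul0mx mxE.
  by rewrite subr0 ltNge hform1_ge0.
have Bu0 (x : 'rV[C]_ku) : x *m rsubmx Bu = 0 -> x = 0.
  move=> e; apply/eqP; apply: contraT => /Bup; rewrite mulN1r oppr_lt0.
  rewrite -(hsubmxK (x *m Bu)) -mulmx_rsub e hform_signmx.
  have -> : hform 1%:M (0 : 'rV[C]_p) = 0 by rewrite /hform !mul0mx mxE.
  by rewrite sub0r ReN oppr_gt0 ltNge hform1_ge0.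
have free_le m n (B : 'M[C]_(m, n)) : (forall x : 'rV[C]_m, x *m B = 0 -> x = 0) ->
    row_free B.
  move=> h; rewrite -kermx_eq0; apply/eqP/row_matrixP => i; rewrite row0.
  by apply: h; rewrite -row_mul mulmx_ker row0.
have kl_le : (kl <= k)%N.
  by have /eqP <- := free_le _ _ _ Bl0; exact: rank_leq_col.
have ku_le : (ku <= p)%N.
  by have /eqP <- := free_le _ _ _ Bu0; exact: rank_leq_col.
have kl_k : kl = k.
  apply/eqP; rewrite eqn_leq kl_le /= -(leq_add2r p).
  apply: leq_trans (_ : kl + ku <= _)%N; last by rewrite leq_add2l.
  rewrite klE kuE -{1}(rank_kermxpoly_char M) chE.
  have cop : coprimep pl pu.
    apply/Pdiv.ClosedField.coprimepP => a /pl_root an; apply/negP.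
    by rewrite -/(root pu a) => /pu_root; lra.
  exact: rank_kermxpolyM cop.
clear Bu0 Bup Buf kuE ku_le kl_le klE; subst kl.
have Blu : lsubmx Bl \in unitmx by rewrite -row_free_unit; exact: free_le.
set Q := lsubmx Bl in Blu Bl0.
have rowE : row_mx 1%:M (invmx Q *m rsubmx Bl) = invmx Q *m Bl.
  by rewrite -[in RHS](hsubmxK Bl) mul_mx_row mulVmx.
exists (invmx Q *m rsubmx Bl), (invmx Q *m Tl *m Q); split.
- by rewrite rowE -!mulmxA -/M BlM (mulmxA Q) mulmxV // mul1mx.
- move=> c; rewrite -subr_le0 -ReN -ReD.
  rewrite -hform_signmx -{1}[c]mulmx1 -mul_mx_row rowE mulmxA.
  have [->|cn] := eqVneq (c *m invmx Q) 0.
    by rewrite mul0mx /hform !mul0mx mxE.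
  by have := Bln _ cn; rewrite mul1r => /ltW.
move=> a a0.
have -> : a%:M - invmx Q *m Tl *m Q = invmx Q *m (a%:M - Tl) *m Q.
  by rewrite mulmxBr mulmxBl scalar_mxC -[a%:M *m _ *m _]mulmxA mulVmx // mulmx1.
rewrite !det_mulmx mulrAC -det_mulmx mulVmx // det1 mul1r -horner_char_poly.
have [ts [chT tsn]] := char_poly_split Tl.
have tsr r : r \in ts -> complex.Im r < 0.
  by move=> rt; apply: pl_root; apply: Tle; rewrite eigenvalue_root_char chT root_prod_XsubC.
rewrite chT horner_prod -tsn; elim: ts tsr {chT tsn} => [|r ts IH] tsr.
  by rewrite big_nil expr0 sqnR expr1n.
rewrite big_cons sqnM /= (exprS _ (size ts)); apply: ler_pM.
- exact: sqr_ge0.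
- by apply: exprn_ge0; exact: sqr_ge0.
- have := tsr r ltac:(by rewrite inE eqxx).
  rewrite hornerXsubC /sqn !reimE => r0.
  have := sqr_ge0 (complex.Re a - complex.Re r); nra.
- by apply: IH => w wt; apply: tsr; rewrite inE wt orbT.
Qed.

End Lyapunov.

(** * Limits along an ultrafilter *)

Section UltraLimits.
Variables (R : realType) (I : Type) (U : set_system I).
Hypothesis UU : UltraFilter U.
Local Notation C := R[i].

Let UF : Filter U. Proof. by case: UU => -[]. Qed.

Lemma ultra_common (A B : set I) : U A -> U B -> exists i, A i /\ B i.
Proof.
have UP : ProperFilter U by case: UU.
by move=> UA UB; apply: (@filter_ex _ _ UP); apply: filterI.
Qed.

(** A segment is compact, so every ultrafilter on it converges. *)
Lemma ultra_cvg_real (f : I -> R) k : (forall i, `|f i| <= k) ->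
  exists l : R, f @ U --> l.
Proof.
move=> fk; have := @segment_compact R (- k) k; rewrite compact_ultra.
have UP : UltraFilter (f @ U).
  split; first exact: fmap_proper_filter.
  move=> G Gp GU; apply/seteqP; split=> // A GA.
  have [//|] := in_ultra_setVsetC (f @^-1` A) UU.
  move=> UC; have GC : G (~` A) by apply: GU; exact: UC.
  exfalso.
  by have /filter_ex[x []] : G (A `&` ~` A) by exact: filterI.
move=> /(_ _ UP) []; last by move=> l [_ fl]; exists l.
suff : U (f @^-1` `[- k, k]) by [].
apply: filterS filterT => i _ /=; rewrite in_itv /=.
by rewrite -ler_norml; exact: fk.
Qed.

(** Convergence along U, stated with the squared modulus. *)
Definition ucvg (z : I -> C) (l : C) : Prop :=
  forall e : R, 0 < e -> U [set i | sqn (z i - l) < e].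

Lemma ucvg_ex (z : I -> C) k : (forall i, sqn (z i) <= k) -> exists l, ucvg z l.
Proof.
move=> zk.
have sq1 (x y : R) : y <= x -> 0 <= y -> y <= (x + 1) ^+ 2 by move=> *; nra.
have k1 (i : I) : 0 <= k by exact: le_trans (sqn_ge0 (z i)) (zk i).
have [|a za] := @ultra_cvg_real (fun i => complex.Re (z i)) (k + 1).
  move=> i; rewrite -(ler_pXn2r (isT : (0 < 2)%N)) ?nnegrE ?normr_ge0 ?addr_ge0 ?(k1 i) //.
  rewrite real_normK ?num_real //; apply: sq1 (sqr_ge0 _).
  exact: le_trans (Re_sqr_le _) (zk i).
have [|b zb] := @ultra_cvg_real (fun i => complex.Im (z i)) (k + 1).
  move=> i; rewrite -(ler_pXn2r (isT : (0 < 2)%N)) ?nnegrE ?normr_ge0 ?addr_ge0 ?(k1 i) //.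
  rewrite real_normK ?num_real //; apply: sq1 (sqr_ge0 _).
  by apply: le_trans (zk i); rewrite /sqn lerDr sqr_ge0.
exists (a +i* b); clear k1 => e e0.
have e1 : 0 < Num.sqrt (e / 2) by rewrite sqrtr_gt0; lra.
have sq x : `|x| < Num.sqrt (e / 2) -> x ^+ 2 < e / 2.
  move=> xe; rewrite -real_normK ?num_real // -[e / 2]sqr_sqrtr; last lra.
  by rewrite ltr_pXn2r // nnegrE ltW.
move/cvgrPdist_lt/(_ _ e1) : za => za; move/cvgrPdist_lt/(_ _ e1) : zb => zb.
apply: filterS2 za zb => i /= /sq ha /sq hb.
rewrite /sqn !reimE /=; lra.
Qed.

Lemma ucvg_cst (c : C) : ucvg (fun=> c) c.
Proof.
move=> e e0; apply: filterS filterT => i _ /=.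
by rewrite subrr (_ : sqn 0 = 0) //; apply/eqP; rewrite sqn_eq0.
Qed.

Lemma ucvgD (z w : I -> C) (l m : C) : ucvg z l -> ucvg w m ->
  ucvg (fun i => z i + w i) (l + m).
Proof.
move=> zl wm e e0; have e4 : 0 < e / 4 by lra.
apply: filterS2 (zl _ e4) (wm _ e4) => i /= zi wi.
rewrite opprD addrACA; apply: le_lt_trans (sqnD_le _ _) _; lra.
Qed.

Lemma ucvgM (z w : I -> C) (l m : C) : ucvg z l -> ucvg w m ->
  ucvg (fun i => z i * w i) (l * m).
Proof.
move=> zl wm e e0; have l0 := sqn_ge0 l; have m0 := sqn_ge0 m.
pose d := Num.min 1 (e / (3 + 4 * (sqn l + sqn m))).
have d0 : 0 < d by rewrite lt_min ltr01 divr_gt0 //; lra.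
have d1 : d <= 1 by rewrite ge_min lexx.
have de : d * (3 + 4 * (sqn l + sqn m)) <= e.
  by rewrite -ler_pdivlMr ?ge_min ?lexx ?orbT //; lra.
apply: filterS2 (zl _ d0) (wm _ d0) => i /= zi wi.
have -> : z i * w i - l * m = (z i - l) * (w i - m) + ((z i - l) * m + l * (w i - m)).
  by ring.
have h1 := sqnD_le ((z i - l) * (w i - m)) ((z i - l) * m + l * (w i - m)).
have h2 := sqnD_le ((z i - l) * m) (l * (w i - m)).
have a0 := sqn_ge0 (z i - l); have b0 := sqn_ge0 (w i - m).
apply: le_lt_trans h1 _; move: h2; rewrite !sqnM.
move: (sqn (_ + _)) (sqn (z i - l)) (sqn (w i - m)) (sqn l) (sqn m) zi wi l0 m0 a0 b0 de.
move=> t a b x y ad bd x0 y0 a0 b0 de tle.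
have : a * b <= d by nra.
have : a * y <= d * y by apply: ler_wpM2r => //; exact: ltW.
have : x * b <= x * d by apply: ler_wpM2l => //; exact: ltW.
nra.
Qed.

Lemma ucvgZ (c : C) (z : I -> C) (l : C) : ucvg z l ->
  ucvg (fun i => c * z i) (c * l).
Proof. exact/ucvgM/ucvg_cst. Qed.

Lemma ucvgN (z : I -> C) (l : C) : ucvg z l -> ucvg (fun i => - z i) (- l).
Proof.
move=> zl; rewrite -mulN1r; under eq_fun do rewrite -mulN1r; exact: ucvgZ.
Qed.

Lemma ucvgB (z w : I -> C) (l m : C) : ucvg z l -> ucvg w m ->
  ucvg (fun i => z i - w i) (l - m).
Proof. by move=> zl wm; apply: ucvgD => //; exact: ucvgN. Qed.

Lemma ucvg_sum J (r : seq J) (z : J -> I -> C) (l : J -> C) :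
  (forall j, ucvg (z j) (l j)) ->
  ucvg (fun i => \sum_(j <- r) z j i) (\sum_(j <- r) l j).
Proof.
move=> h; elim: r => [|j r IH].
  by rewrite big_nil; under eq_fun do rewrite big_nil; exact: ucvg_cst.
by rewrite big_cons; under eq_fun do rewrite big_cons; exact: ucvgD.
Qed.

Lemma ucvg_prod J (r : seq J) (z : J -> I -> C) (l : J -> C) :
  (forall j, ucvg (z j) (l j)) ->
  ucvg (fun i => \prod_(j <- r) z j i) (\prod_(j <- r) l j).
Proof.
move=> h; elim: r => [|j r IH].
  by rewrite big_nil; under eq_fun do rewrite big_nil; exact: ucvg_cst.
by rewrite big_cons; under eq_fun do rewrite big_cons; exact: ucvgM.
Qed.

Lemma ucvg_det n (A : I -> 'M[C]_n) (L : 'M[C]_n) :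
  (forall i j, ucvg (fun x => A x i j) (L i j)) ->
  ucvg (fun x => \det (A x)) (\det L).
Proof.
move=> h; rewrite /determinant; apply: ucvg_sum => s.
by apply: ucvgZ; exact: ucvg_prod.
Qed.

Lemma ucvg_unique (z : I -> C) (l m : C) : ucvg z l -> ucvg z m -> l = m.
Proof.
move=> zl zm; apply/eqP; rewrite -subr_eq0 -sqn_eq0 eq_le sqn_ge0 andbT.
apply: (@le0_eps _ _ 4) => // e e0.
have [i /= [il im]] := ultra_common (zl e e0) (zm e e0).
have -> : l - m = (z i - m) - (z i - l) by rewrite opprB [RHS]addrC addrA subrK.
by apply: le_trans (sqnD_le _ _) _; rewrite sqnN; lra.
Qed.

Lemma ucvg_eq (z w : I -> C) (l : C) : U [set i | z i = w i] -> ucvg z l -> ucvg w l.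
Proof. by move=> zw zl e e0; apply: filterS2 zw (zl e e0) => i /= ->. Qed.

Lemma ucvg_small (z : I -> C) (w : I -> R) k : 0 <= k ->
  (forall e : R, 0 < e -> U [set i | w i < e]) ->
  (forall i, sqn (z i) <= w i * k) -> ucvg z 0.
Proof.
move=> k0 ws zw e e0.
have e1 : 0 < e / (k + 1) by apply: divr_gt0 => //; lra.
apply: filterS (ws _ e1) => i /= wi; rewrite subr0; apply: le_lt_trans (zw i) _.
by move: wi; rewrite ltr_pdivlMr; last lra; have := zw i; have := sqn_ge0 (z i); nra.
Qed.

Lemma ucvg_sqn_le (z : I -> C) (l : C) k : ucvg z l ->
  U [set i | sqn (z i) <= k] -> sqn l <= k.
Proof.
move=> zl zk; rewrite -subr_le0.
(* with sqn (z - l) < h^2 and h <= 1, sqn l - sqn z is at most h (2 + 2 sqn l) *)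
apply: (@le0_eps _ _ (2 + 2 * sqn l)); first by have := sqn_ge0 l; lra.
move=> e e0; pose h := Num.min e 1.
have h0 : 0 < h by rewrite lt_min e0 ltr01.
have [h1 he] : h <= 1 /\ h <= e by rewrite /h !ge_min !lexx orbT.
have [i /= [il ik]] := ultra_common (zl (h ^+ 2) (exprn_gt0 _ h0)) zk.
have : sqn (z i) = sqn (z i - l) + sqn l +
   2 * (complex.Re (z i - l) * complex.Re l + complex.Im (z i - l) * complex.Im l).
  by rewrite /sqn !reimE; ring.
have l0 := sqn_ge0 l; move: il; rewrite /sqn in l0 *.
move: (complex.Re (z i - l)) (complex.Im (z i - l)) (complex.Re l) (complex.Im l) l0.
move=> a b c d l0 il zE; rewrite -/(sqn _) in ik zE.
have i1 : 0 <= (a + h * c) ^+ 2 by exact: sqr_ge0.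
have i2 : 0 <= (b + h * d) ^+ 2 by exact: sqr_ge0.
have i3 : - (2 * (a * c + b * d)) <= h + h * (c ^+ 2 + d ^+ 2).
  have : 0 <= h * (h + h * (c ^+ 2 + d ^+ 2) + 2 * (a * c + b * d)) by nra.
  by rewrite pmulr_rge0 //; lra.
have i4 : 0 <= a ^+ 2 + b ^+ 2 by apply: addr_ge0; exact: sqr_ge0.
nra.
Qed.

Lemma ucvg_sqn_ge (z : I -> C) (l : C) k : 0 <= k -> ucvg z l ->
  U [set i | k <= sqn (z i)] -> k <= 4 * sqn l.
Proof.
move=> k0 zl zk; rewrite -subr_le0; apply: (@le0_eps _ _ 4) => // e e0.
have [i /= [il ik]] := ultra_common (zl e e0) zk.
have := sqnD_le (z i - l) l; rewrite subrK; have := sqn_ge0 l; lra.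
Qed.

End UltraLimits.

(** * Weak limits and negative eigenvectors *)

Section Weak.
Variables (R : realType) (X : completeNormedModType R[i]).
Variable ip : {dot X for conjC}.
Hypothesis hilbert : forall u, ip u u = `|u| ^+ 2.
Implicit Types (V : set X) (u v : X) (B D : {linear X -> X}).
Local Notation nsq := (nsq ip).
Local Notation approx := (approx ip).
Local Notation C := R[i].

Section Limit.
Variables (I : Type) (U : set_system I).
Hypothesis UU : UltraFilter U.

Lemma ucvgJ (z : I -> C) l : ucvg U z l -> ucvg U (fun i => conjC (z i)) (conjC l).
Proof.
have UF : Filter U by case: UU => -[].
by move=> zl e e0; apply: filterS (zl e e0) => i /=; rewrite -rmorphB sqnJ.
Qed.

(** The functionals ip ^~ (v i) converge pointwise along the ultrafilter, and the
   limit is bounded, hence represented by a vector. *)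
Lemma weak_limit (v : I -> X) k : (forall i, nsq (v i) <= k) ->
  exists2 b, nsq b <= k & forall y, ucvg U (fun i => ip (v i) y) (ip b y).
Proof.
move=> vk; have UF : Filter U by case: UU => -[].
have k0 : 0 <= k.
  have [i _] := ultra_common UU (filterT : U setT) (filterT : U setT).
  exact: le_trans (nsq_ge0 hilbert (v i)) (vk i).
have bd y i : sqn (ip y (v i)) <= k * nsq y.
  apply: le_trans (CS hilbert _ _) _; rewrite mulrC.
  by apply: ler_wpM2r; [exact: nsq_ge0|exact: vk].
have ex y : exists l, ucvg U (fun i => ip y (v i)) l by exact: ucvg_ex (bd y).
have [phi hphi] := choice ex.
have phil a u w : phi (a *: u + w) = a * phi u + phi w.
  apply: (ucvg_unique UU (hphi _)).
  under eq_fun do rewrite ipDl ipZl.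
  by apply: ucvgD => //; apply: ucvgZ.
have phib u : sqn (phi u) <= k * nsq u.
  by apply: (ucvg_sqn_le UU (hphi u)); apply: filterS filterT => i _; exact: bd.
have [b bE bk] := riesz hilbert k0 phil phib.
exists b => // y; rewrite ipC -bE; under eq_fun do rewrite ipC.
exact: ucvgJ.
Qed.

(** The vector b - p, where p is the projection of b to V, is orthogonal to all
   v i, hence to b and to p. *)
Lemma weak_limit_closed V (v : I -> X) b : Defs.subspace V -> approx V `<=` V ->
  (forall i, V (v i)) -> (forall y, ucvg U (fun i => ip (v i) y) (ip b y)) -> V b.
Proof.
move=> Vs Vc Vv vb; have UF : Filter U by case: UU => -[].
have [p Vp hp] := projection hilbert Vs Vc b.
suff -> : b = p by [].
apply/eqP; rewrite -subr_eq0 -(nsq_eq0 hilbert) /nsq ipBl.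
rewrite (ipC ip p) hp // rmorph0 subr0.
have -> : ip b (b - p) = 0; last by [].
apply: (ucvg_unique UU (vb _)); under eq_fun => i do rewrite ipC hp // rmorph0.
exact: ucvg_cst.
Qed.

End Limit.

Lemma gram_schmidt B V (ys : seq X) : Defs.subspace V -> symmetric ip B ->
  (forall u, V u -> u != 0 -> 0 < complex.Re (ip (B u) u)) ->
  (forall y, y \in ys -> V y) ->
  exists n (g : 'I_n -> X), [/\ (forall i, V (g i)),
    (forall i j, ip (B (g i)) (g j) = (i == j)%:R) &
    (forall y, y \in ys -> y = \sum_i ip (B y) (g i) *: g i)].
Proof.
move=> [V0 Vl] Bs Bp; elim: ys => [|y ys IH] Vys.
  by exists 0%N, (fun=> 0); split=> // -[].
have [|n [g [Vg gg gys]]] := IH; first by move=> z zs; apply: Vys; rewrite inE zs orbT.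
have Vy : V y by apply: Vys; rewrite inE eqxx.
pose s := \sum_i ip (B y) (g i) *: g i.
have Vs : V s.
  rewrite /s; elim/big_ind: _ => // [u w Vu Vw|i _].
    by rewrite -[u]scale1r; exact: Vl.
  by rewrite -[_ *: _]addr0; exact: Vl.
pose z := y - s; have Vz : V z by rewrite /z -scaleN1r addrC; exact: Vl.
have zg j : ip (B z) (g j) = 0.
  rewrite /z opB ipBl /s op_sum ip_suml (bigD1 j) //= opZ ipZl gg eqxx mulr1.
  rewrite big1 ?addr0 ?subrr // => i /negbTE ij.
  by rewrite opZ ipZl gg ij mulr0.
have [z0|zn] := eqVneq z 0.
  exists n, g; split=> // w; rewrite inE => /predU1P[->|]; last exact: gys.
  by apply/eqP; rewrite -subr_eq0 -/s -/z z0.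
pose N := complex.Re (ip (B z) z); have N0 : 0 < N by exact: Bp.
have NE : ip (B z) z = N%:C by exact: form_real.
pose c := (Num.sqrt N)^-1.
have cN : c * c * N = 1.
  rewrite -expr2 exprVn sqr_sqrtr ?ltW // mulVf // gt_eqF //.
pose e := c%:C *: z.
have ee : ip (B e) e = 1.
  by rewrite /e opZ ipZl ipZr conjR NE -!rmorphM /= mulrA cN.
have eg j : ip (B e) (g j) = 0 by rewrite /e opZ ipZl zg mulr0.
have ge j : ip (B (g j)) e = 0 by rewrite Bs ipC eg rmorph0.
exists n.+1, (fun i => if unlift ord0 i is Some j then g j else e); split.
- move=> i; case: unliftP => [j _|_] //; rewrite /e -[_ *: _]addr0; exact: Vl.
- move=> i j; case: (unliftP ord0 i) => [i' ->|->]; case: (unliftP ord0 j) => [j' ->|->].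
  + by rewrite gg (inj_eq lift_inj).
  + by rewrite ge eq_sym (negbTE (neq_lift _ _)).
  + by rewrite eg (negbTE (neq_lift _ _)).
  + by rewrite ee eqxx.
move=> w; rewrite inE big_ord_recl unlift_none => hw.
under eq_bigr do rewrite liftK.
case/predU1P: hw => [->|ws].
  rewrite -/s; have -> : ip (B y) e = c%:C * N%:C.
    rewrite -(subrK s y) -/z opD ipDl {1}/e ipZr conjR NE.
    rewrite /s op_sum ip_suml big1 ?addr0 // => i _.
    by rewrite opZ ipZl ge mulr0.
  by rewrite /e scalerA -!rmorphM /= mulrAC cN scale1r subrK.
have we : ip (B w) e = 0.
  rewrite (gys w ws) op_sum ip_suml big1 // => i _.
  by rewrite opZ ipZl ge mulr0.
by rewrite we scale0r add0r; exact: gys.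
Qed.

(** A minimising sequence of the form of B converges weakly to a vector in the
   eigenspace of the infimum m; were the limit zero, the sequence would
   asymptotically satisfy the finitely many constraints and m could not be
   negative. *)
Lemma negative_eigenvector B V (a : seq X) : Defs.subspace V -> approx V `<=` V ->
  (forall u, V u -> V (B u)) -> symmetric ip B -> bounded ip B ->
  (forall u, V u -> (forall x, x \in a -> ip u x = 0) ->
     0 <= complex.Re (ip (B u) u)) ->
  (exists2 u, V u & complex.Re (ip (B u) u) < 0) ->
  exists (m : R) e, [/\ m < 0, V e, nsq e = 1 & B e = m%:C *: e].
Proof.
move=> Vs Vc BV Bs Bb Ba neg; have [V0 Vl] := Vs.
have [m [m0 _ hm]] := numerical_bottom hilbert Vs BV Bs Bb neg.
have ex n : exists u, [/\ V u, nsq u = 1 & nsq (shift B m%:C u) < n.+1%:R^-1].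
  by apply: hm; rewrite invr_gt0.
have [u hu] := choice ex.
have [U [UU Uoo]] := ultraFilterLemma (F := \oo) _.
have UF : Filter U by case: UU => -[].
have [b _ ub] := @weak_limit _ U UU u 1 (fun n => ltac:(by have [_ -> _] := hu n)).
have Vb : V b by apply: (weak_limit_closed UU Vs Vc _ ub) => n; have [] := hu n.
have small (e : R) : 0 < e -> U [set n | nsq (shift B m%:C (u n)) < e].
  move=> e0; apply: Uoo; have [N _ hN] := near_infty_natSinv_lt (PosNum e0).
  exists N => // n Nn; have [_ _ h] := hu n; apply: lt_trans h _; exact: hN.
have eb : shift B m%:C b = 0.
  apply: (ip_ext hilbert) => y; rewrite ip0l (shift_symmetric m Bs).
  apply: (ucvg_unique UU (ub _)); under eq_fun do rewrite -(shift_symmetric m Bs).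
  apply: (ucvg_small UU (nsq_ge0 hilbert y) small) => n; exact: CS.
have [b0|bn] := eqVneq b 0; last first.
  have nb : 0 < nsq b by rewrite lt_def nsq_eq0 // bn nsq_ge0.
  exists m, ((Num.sqrt (nsq b))^-1%:C *: b); split=> //.
  - by rewrite -[_ *: _]addr0; exact: Vl.
  - by rewrite nsqZ // sqnR exprVn sqr_sqrtr ?ltW // mulVf // gt_eqF.
  by rewrite opZ scalerA mulrC -scalerA; congr (_ *: _); apply/eqP; rewrite -subr_eq0 -shiftE eb.
exfalso.
have [P [PV PE Ps Pn Po]] := projection_op hilbert Vs Vc.
have [|||n [g [Vg gg ga]]] := @gram_schmidt idfun V [seq P x | x <- a] Vs.
- by [].
- by move=> w _ w0; rewrite -/(nsq w) lt_def nsq_eq0 // w0 nsq_ge0.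
- by move=> _ /mapP[x _ ->].
pose w i := \sum_j ip (u i) (g j) *: g j.
have Vw i : V (w i).
  rewrite /w; elim/big_ind: _ => // [x y Vx Vy|j _].
    by rewrite -[x]scale1r; exact: Vl.
  by rewrite -[_ *: _]addr0; exact: Vl.
have wg i j : ip (w i) (g j) = ip (u i) (g j).
  rewrite /w ip_suml (bigD1 j) //= ipZl gg eqxx mulr1 big1 ?addr0 // => l /negbTE lj.
  by rewrite ipZl gg lj mulr0.
have pos i : 0 <= complex.Re (ip (B (u i - w i)) (u i - w i)).
  have [Vu _ _] := hu i.
  have Vuw : V (u i - w i) by rewrite -scaleN1r addrC; exact: Vl.
  apply: Ba => // x xa; rewrite -[X in ip X _](PE _ Vuw) Ps.
  rewrite (ga (P x)) ?map_f // ip_sumr big1 // => j _.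
  by rewrite ipZr ipBl wg subrr mulr0.
have wsmall (e : R) : 0 < e -> U [set i | nsq (w i) < e].
  move=> e0; have : ucvg U (fun i => ip (w i) (w i)) (\sum_(j < n) 0 * conjC 0).
    under eq_fun => i.
      rewrite {2}/w ip_sumr; under eq_bigr do rewrite ipZr wg mulrC.
      over.
    apply: ucvg_sum => // j; have := ub (g j); rewrite b0 ip0l => uj.
    by apply: ucvgM => //; exact: ucvgJ.
  rewrite big1 => [|j _]; last by rewrite mul0r.
  move=> /(_ _ (exprn_gt0 2 e0)); apply: filterS => i /=.
  rewrite subr0 nsqE // sqnR ltr_pXn2r // nnegrE ?nsq_ge0 ?ltW //.
have [k k0 Bk] := Bb.
pose e := Num.min ((m / 8) ^+ 2) (Num.min ((m / 8) ^+ 2 / (k + 1)) (- m / (4 * (k + 1)))).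
have e0 : 0 < e.
  rewrite !lt_min; apply/and3P; split; first by rewrite exprn_even_gt0 //=; nra.
    by apply: divr_gt0; [rewrite exprn_even_gt0 //=; nra|lra].
  by apply: divr_gt0; lra.
have [e1 e2 e3] : [/\ e <= (m / 8) ^+ 2, (k + 1) * e <= (m / 8) ^+ 2 & (k + 1) * e <= - m / 4].
  split; first by rewrite /e ge_min lexx.
    rewrite mulrC -ler_pdivlMr; last lra.
    by rewrite /e !ge_min lexx orbT.
  rewrite mulrC -ler_pdivlMr; last lra.
  rewrite -mulrA -invfM /e !ge_min lexx !orbT //.
have [i /= [si wi]] := ultra_common UU (small e e0) (wsmall e e0).
have [_ ui _] := hu i; have := pos i.
have hc := CS hilbert (shift B m%:C (u i)) (u i).
have hb := CS hilbert (B (u i)) (w i).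
have hu1 := Bk (u i); rewrite ui mulr1 in hc hu1.
have hw := le_trans (ler_norm _) (bounded_form hilbert (w i) k0 Bk).
have uE : complex.Re (ip (B (u i)) (u i)) = m + complex.Re (ip (shift B m%:C (u i)) (u i)).
  by rewrite shiftE ipBl ipZl ReD ReN ReZ -/(nsq _) ui; ring.
have swap : complex.Re (ip (B (w i)) (u i)) = complex.Re (ip (B (u i)) (w i)).
  by rewrite Bs ipC ReJ.
rewrite opB !ipBl !ipBr !(ReD, ReN) uE swap.
have hs := le_trans (Re_sqr_le _) hc; have ht := le_trans (Re_sqr_le _) hb.
have := nsq_ge0 hilbert (w i); have := nsq_ge0 hilbert (B (u i)).
move: hw hs ht si wi hu1.
move: (complex.Re (ip (B (w i)) (w i))) (complex.Re (ip (B (u i)) (w i))).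
move: (complex.Re (ip (shift B m%:C (u i)) (u i))).
move: (nsq (shift B m%:C (u i))) (nsq (w i)) (nsq (B (u i))).
move=> x y z s r t hr hs ht xe ye zk z0 y0.
have m8 : - m / 8 = `|m / 8| by rewrite ltr0_norm ?mulNr // pmulr_llt0 ?invr_gt0.
have absle p : p ^+ 2 <= (m / 8) ^+ 2 -> `|p| <= - m / 8.
  rewrite m8 -[X in X <= _]real_normK ?num_real // -[X in _ <= X]real_normK ?num_real //.
  by rewrite ler_pXn2r ?nnegrE ?normr_ge0.
have /absle : s ^+ 2 <= (m / 8) ^+ 2 by lra.
have /absle : t ^+ 2 <= (m / 8) ^+ 2.
  apply: le_trans ht _; apply: le_trans e2; nra.
have : r <= - m / 4 by apply: le_trans hr _; apply: le_trans e3; nra.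
rewrite !ler_norml; lra.
Qed.

Lemma kernel_vector k m (A : 'M[C]_(k, m)) : (m < k)%N ->
  exists c : 'rV[C]_k, c != 0 /\ c *m A = 0.
Proof.
move=> mk; have : kermx A != 0.
  rewrite kermx_eq0; apply: contraTneq mk => <-; rewrite -leqNgt; exact: rank_leq_col.
by move=> /rowV0Pn[c /sub_kermxP cA c0]; exists c.
Qed.

(** Orthonormal families of negative eigenvectors have at most as many members as
   a, since a longer one would have a combination orthogonal to a with negative
   form.  For a maximal family e the form is nonnegative off e: a negative value
   would produce one more eigenvector. *)
Lemma negative_spectral B V (a : seq X) : Defs.subspace V -> approx V `<=` V ->
  (forall u, V u -> V (B u)) -> symmetric ip B -> bounded ip B ->
  (forall u, V u -> (forall x, x \in a -> ip u x = 0) ->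
     0 <= complex.Re (ip (B u) u)) ->
  exists k (e : 'I_k -> X) (beta : 'I_k -> R),
  [/\ (forall i, V (e i)), (forall i j, ip (e i) (e j) = (i == j)%:R),
     (forall i, beta i < 0), (forall i, B (e i) = (beta i)%:C *: e i) &
     (forall u, V u -> (forall i, ip u (e i) = 0) -> 0 <= complex.Re (ip (B u) u))].
Proof.
move=> Vs Vc BV Bs Bb Ba; have [V0 Vl] := Vs.
pose Q k (e : 'I_k -> X) (beta : 'I_k -> R) :=
  [/\ (forall i, V (e i)), (forall i j, ip (e i) (e j) = (i == j)%:R),
     (forall i, beta i < 0) & (forall i, B (e i) = (beta i)%:C *: e i)].
pose P k := `[< exists e beta, @Q k e beta >].
have P0 : exists k, P k.
  by exists 0%N; apply/asboolP; exists (fun=> 0), (fun=> 0); split=> -[].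
have Pb k : P k -> (k <= size a)%N.
  move=> /asboolP[e [beta [Ve ee bn Be]]]; rewrite leqNgt; apply/negP => ak.
  pose A : 'M[C]_(k, size a) := \matrix_(i, j) ip (e i) a`_j.
  have [c [c0 cA]] := kernel_vector A ak.
  pose u := \sum_i c 0 i *: e i.
  have ue i : ip u (e i) = c 0 i.
    rewrite /u ip_suml (bigD1 i) //= ipZl ee eqxx mulr1 big1 ?addr0 // => j /negbTE ji.
    by rewrite ipZl ee ji mulr0.
  have Vu : V u.
    rewrite /u; elim/big_ind: _ => // [x y Vx Vy|j _].
      by rewrite -[x]scale1r; exact: Vl.
    by rewrite -[_ *: _]addr0; exact: Vl.
  have ua x : x \in a -> ip u x = 0.
    move=> xa; have ix : (index x a < size a)%N by rewrite index_mem.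
    have /matrixP/(_ 0 (Ordinal ix)) := cA; rewrite !mxE => <-.
    rewrite /u ip_suml; apply: eq_bigr => i _.
    by rewrite ipZl mxE /= nth_index.
  have := Ba _ Vu ua; rewrite leNgt => /negP; apply.
  have -> : ip (B u) u = (\sum_i beta i * sqn (c 0 i))%:C.
    rewrite {1}/u op_sum ip_suml rmorph_sum; apply: eq_bigr => i _.
    rewrite opZ Be !ipZl (ipC ip (e i)) ue mulrCA sqn_mulJ rmorphM //.
  rewrite ReR; have [i ci] : exists i, c 0 i != 0.
    apply/existsP; rewrite -negb_forall; apply: contra c0 => /forallP h.
    by apply/eqP/rowP => i; rewrite mxE; apply/eqP/h.
  rewrite (bigD1 i) //= ltr_nwDl //.
    by rewrite nmulr_rlt0 // lt_def sqn_eq0 ci sqn_ge0.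
  by apply: sumr_le0 => j _; rewrite nmulr_rle0 ?sqn_ge0.
pose k := ex_maxn P0 Pb.
have [Pk kmax] : P k /\ forall n, P n -> (n <= k)%N.
  by rewrite /k; case: ex_maxnP.
have /asboolP[e [beta [Ve ee bn Be]]] := Pk.
exists k, e, beta; split=> // u Vu ue; rewrite leNgt; apply/negP => un.
pose E := [set e i | i in setT].
pose W := V `&` ortho_compl ip E.
have Ws : Defs.subspace W.
  have [E0 El] := ortho_compl_subspace ip E.
  by split=> // z x y [Vx Ex] [Vy Ey]; split; [exact: Vl|exact: El].
have Wc : approx W `<=` W.
  move=> x Wx; split.
    by apply: Vc => d d0; have [y [Vy _] h] := Wx d d0; exists y.
  by apply: (ortho_compl_closed hilbert) => d d0; have [y [_ Ey] h] := Wx d d0; exists y.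
have BW x : W x -> W (B x).
  move=> [Vx Ex]; split; first exact: BV.
  by move=> _ [i _ <-]; rewrite Bs Be ipZr Ex ?mulr0 //; exists i.
have Wa x : W x -> (forall y, y \in a -> ip x y = 0) -> 0 <= complex.Re (ip (B x) x).
  by move=> [Vx _]; exact: Ba.
have Wu : W u by split=> // _ [i _ <-].
have [m [f [m0 [Vf Ef] f1 Bf]]] :=
  negative_eigenvector Ws Wc BW Bs Bb Wa (ex_intro2 _ _ u Wu un).
have fe i : ip f (e i) = 0 by apply: Ef; exists i.
have ef i : ip (e i) f = 0 by rewrite ipC fe rmorph0.
suff /kmax : P k.+1 by rewrite ltnn.
apply/asboolP.
exists (fun i => if unlift ord0 i is Some j then e j else f).
exists (fun i => if unlift ord0 i is Some j then beta j else m); split.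
- by move=> i; case: unliftP.
- move=> i j; case: (unliftP ord0 i) => [i' ->|->]; case: (unliftP ord0 j) => [j' ->|->].
  + by rewrite ee (inj_eq lift_inj).
  + by rewrite ef eq_sym (negbTE (neq_lift _ _)).
  + by rewrite fe (negbTE (neq_lift _ _)).
  + by rewrite nsqE // f1 eqxx.
- by move=> i; case: unliftP.
- by move=> i; case: unliftP.
Qed.

End Weak.

(** * Invariant nonpositive subspaces of maximal dimension *)

Section Pontryagin.
Variables (R : realType) (X : completeNormedModType R[i]).
Variable ip : {dot X for conjC}.
Hypothesis hilbert : forall u, ip u u = `|u| ^+ 2.
Local Notation nsq := (nsq ip).
Local Notation approx := (approx ip).
Local Notation C := R[i].
Variable H : set X.
Implicit Types (B D S : {linear X -> X}).

Definition injective_sa B :=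
  [/\ (forall u, H (B u)), symmetric ip B, bounded ip B &
      (forall u, H u -> B u = 0 -> u = 0)].

(** A maximal negative orthonormal family of the form of B: its negative
   index in H is k. *)
Definition negative_basis B k (e : 'I_k -> X) :=
  [/\ (forall i, H (e i)), (forall i j, ip (B (e i)) (e j) = - (i == j)%:R) &
     (forall u, H u -> (forall i, ip (B u) (e i) = 0) ->
        0 <= complex.Re (ip (B u) u))].

Lemma sum_form B n (f : 'I_n -> X) (s : C) (c : 'I_n -> C) :
  (forall i j, ip (B (f i)) (f j) = s * (i == j)%:R) ->
  ip (B (\sum_i c i *: f i)) (\sum_i c i *: f i) = s * (\sum_i sqn (c i))%:C.
Proof.
move=> ff; rewrite op_sum ip_suml rmorph_sum mulr_sumr; apply: eq_bigr => i _.
rewrite opZ ipZl ip_sumr (bigD1 i) //= big1 => [|j /negbTE ji]; last first.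
  by rewrite ipZr ff eq_sym ji !mulr0.
by rewrite addr0 ipZr ff eqxx mulr1 mulrA sqn_mulJ mulrC.
Qed.

Lemma sum_in (W : set X) n (f : 'I_n -> X) (c : 'I_n -> C) : Defs.subspace W ->
  (forall i, W (f i)) -> W (\sum_i c i *: f i).
Proof.
move=> [W0 Wl] Wf; elim/big_ind: _ => // [x y Vx Vy|j _].
  by rewrite -[x]scale1r; exact: Wl.
by rewrite -[_ *: _]addr0; exact: Wl.
Qed.

Hypothesis Hs : Defs.subspace H.

Section OneForm.
Variables (B : {linear X -> X}) (k : nat) (e : 'I_k -> X).
Hypotheses (Bsa : injective_sa B) (Be : negative_basis B e).

Let HB u : H (B u). Proof. by case: Bsa. Qed.
Let Bs : symmetric ip B. Proof. by case: Bsa. Qed.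
Let He i : H (e i). Proof. by case: Be. Qed.
Let ee i j : ip (B (e i)) (e j) = - (i == j)%:R. Proof. by case: Be. Qed.

Definition pos_part : set X := [set u | H u /\ forall i, ip (B u) (e i) = 0].

(** The projection onto pos_part along the span of the e i. *)
Definition pos_proj u : X := u + \sum_i ip (B u) (e i) *: e i.

Lemma pos_part_subspace : Defs.subspace pos_part.
Proof.
have [H0 Hl] := Hs; split; first by split=> // i; rewrite op0 ip0l.
move=> a u v [Hu ue] [Hv ve]; split; first exact: Hl.
by move=> i; rewrite opD opZ ipDl ipZl ue ve mulr0 addr0.
Qed.

Lemma pos_projP u : H u -> pos_part (pos_proj u).
Proof.
move=> Hu; have [H0 Hl] := Hs; split.
  by rewrite /pos_proj -[u]scale1r; apply: Hl => //; exact: sum_in.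
move=> i; rewrite /pos_proj opD ipDl op_sum ip_suml (bigD1 i) //= opZ ipZl ee eqxx.
rewrite big1 => [|j /negbTE ji]; last by rewrite opZ ipZl ee ji oppr0 mulr0.
by rewrite addr0 mulrN mulr1 subrr.
Qed.

Lemma form_swap u v : ip (B u) v = conjC (ip (B v) u).
Proof. by rewrite Bs ipC. Qed.

Lemma pos_proj_form u : H u -> complex.Re (ip (B (pos_proj u)) (pos_proj u)) =
  complex.Re (ip (B u) u) + \sum_i sqn (ip (B u) (e i)).
Proof.
move=> Hu; have [_ pe] := pos_projP Hu.
rewrite {2}/pos_proj ipDr ip_sumr big1 ?addr0 => [|i _]; last by rewrite ipZr pe mulr0.
rewrite /pos_proj opD ipDl ReD op_sum ip_suml; congr (_ + _).
have -> : \sum_i sqn (ip (B u) (e i)) = complex.Re (\sum_i (sqn (ip (B u) (e i)))%:C).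
  by rewrite -rmorph_sum.
congr complex.Re; apply: eq_bigr => i _.
by rewrite opZ ipZl (form_swap (e i)) sqn_mulJ.
Qed.

Lemma pos_part_ge0 u : pos_part u -> 0 <= complex.Re (ip (B u) u).
Proof. by case: Be => _ _ h [Hu ue]; exact: h. Qed.

(** By the Cauchy-Schwarz inequality on the complement of the e i, an isotropic
   vector u there is in the kernel of the form: (B u, B u) = 0. *)
Lemma pos_part_gt0 u : pos_part u -> u != 0 -> 0 < complex.Re (ip (B u) u).
Proof.
move=> Pu u0; rewrite lt_def pos_part_ge0 // andbT; apply: contra u0 => /eqP B0.
have [_ _ _ inj] := Bsa; have [Hu ue] := Pu.
apply/eqP; apply: inj => //; have Hw : H (B u) := HB u.
have := form_CS pos_part_subspace (fun u v _ _ => Bs u v) pos_part_ge0 Pu (pos_projP Hw).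
rewrite B0 mul0r /pos_proj ipDr ip_sumr big1 ?addr0 => [|i _]; last first.
  by rewrite ipZr ue mulr0.
move=> le; apply/eqP; rewrite -(nsq_eq0 hilbert).
have := sqn_ge0 (ip (B u) (B u)); rewrite nsqE // sqnR in le *.
by move=> _; rewrite -sqrf_eq0 eq_le le sqr_ge0.
Qed.

(** Adding 2 |(B u, e i)|^2 for all i to the form of B makes it nonnegative, and a
   nonnegative form bounds its operator.  This bounds the vectors B x of the
   finite-dimensional approximations below, although the x need not be bounded. *)
Lemma form_bounds_op : exists M : R, forall i0 x, H x ->
  (forall j, ip (B x) (e j) = - (i0 == j)%:R) ->
  complex.Re (ip (B x) x) <= 0 -> nsq (B x) <= M.
Proof.
pose D u := B u + \sum_i (2 * ip (B u) (e i)) *: B (e i).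
have Dl : linear D.
  move=> a u v; rewrite /D scalerDr scaler_sumr addrACA -big_split /= opD opZ.
  congr (_ + _); apply: eq_bigr => i _.
  by rewrite ipDl ipZl mulrDr scalerDl scalerA mulrCA.
pose D' : {linear X -> X} := HB.pack D (GRing.isLinear.Build _ _ _ _ D Dl).
have HD u : H (D' u).
  have [H0 Hl] := Hs; rewrite /= /D -[B u]scale1r; apply: Hl => //.
  by apply: sum_in.
have conj2 : conjC (2 : C) = 2 by rewrite rmorph_nat.
have Ds : symmetric ip D'.
  move=> u v; rewrite /= /D ipDl ipDr Bs; congr (_ + _).
  rewrite ip_suml ip_sumr; apply: eq_bigr => i _.
  by rewrite ipZl ipZr rmorphM /= conj2 -form_swap -Bs -!mulrA; congr (_ * _); exact: mulrC.
have Db : bounded ip D'.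
  have [_ _ [kB kB0 hB] _] := Bsa.
  have aux (r : seq 'I_k) : exists2 K : R, 0 <= K & forall u,
     nsq (\sum_(i <- r) (2 * ip (B u) (e i)) *: B (e i)) <= K * nsq u.
    elim: r => [|i r [K K0 hK]].
      by exists 0 => // u; rewrite big_nil nsq0 mul0r.
    have c0 : 0 <= 4 * (kB * nsq (e i)) * nsq (B (e i)).
      by rewrite !mulr_ge0 ?nsq_ge0.
    exists (2 * (4 * (kB * nsq (e i)) * nsq (B (e i)) + K)); first lra.
    move=> u; rewrite big_cons; apply: le_trans (nsqD_le hilbert _ _) _.
    suff : nsq ((2 * ip (B u) (e i)) *: B (e i)) <=
        4 * (kB * nsq (e i)) * nsq (B (e i)) * nsq u.
      by have := hK u; move: (4 * _ * _) => c; lra.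
    rewrite nsqZ // sqnM.
    have -> : sqn (2 : C) = 4.
      by rewrite -[2]/(2%:R) -[2%:R](rmorph_nat (real_complex R)) sqnR -natrX.
    have h := CS hilbert (B u) (e i); have h' := hB u.
    have : sqn (ip (B u) (e i)) <= kB * nsq u * nsq (e i).
      by apply: le_trans h _; apply: ler_wpM2r; rewrite ?nsq_ge0.
    move=> /(ler_wpM2r (nsq_ge0 hilbert (B (e i)))).
    by move: (nsq (e i)) (nsq (B (e i))) (nsq u) (sqn _) => *; nra.
  have [K K0 hK] := aux (index_enum 'I_k).
  exists (2 * (kB + K)); first lra.
  move=> u; apply: le_trans (nsqD_le hilbert _ _) _.
  by have := hB u; have := hK u; lra.
have Dform u : complex.Re (ip (D' u) u) =
    complex.Re (ip (B u) u) + 2 * \sum_i sqn (ip (B u) (e i)).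
  rewrite /= /D ipDl ReD; congr (_ + _); rewrite ip_suml.
  have -> : 2 * \sum_i sqn (ip (B u) (e i)) = complex.Re (\sum_i (2 * sqn (ip (B u) (e i)))%:C).
    by rewrite -rmorph_sum mulr_sumr.
  congr complex.Re; apply: eq_bigr => i _.
  rewrite ipZl (form_swap (e i)) -mulrA sqn_mulJ rmorphM /=; congr (_ * _).
  by rewrite (rmorph_nat (real_complex R) 2).
have [K K0 hK] := Db.
have Dp u : H u -> 0 <= complex.Re (ip (D' u) u).
  move=> Hu; rewrite Dform; have := pos_part_ge0 (pos_projP Hu).
  rewrite pos_proj_form //.
  have : 0 <= \sum_i sqn (ip (B u) (e i)) by apply: sumr_ge0 => i _; exact: sqn_ge0.
  lra.
have bnd := nonneg_form_bound hilbert Hs (fun u _ => HD u) Ds K0 hK Dp.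
pose Me := \sum_i nsq (B (e i)).
have MeP i : nsq (B (e i)) <= Me.
  by rewrite /Me (bigD1 i) //= lerDl; apply: sumr_ge0 => j _; exact: nsq_ge0.
exists (4 * (K + 1) + 8 * Me) => i0 x Hx xe xn.
have s1 : \sum_i sqn (ip (B x) (e i)) = 1.
  rewrite (bigD1 i0) //= big1 => [|j ji].
    by rewrite addr0 xe eqxx sqnN -[1%:R](rmorph1 (real_complex R)) sqnR expr1n.
  by rewrite xe eq_sym (negbTE ji) oppr0; apply/eqP; rewrite sqn_eq0.
have BE : B x = D' x + 2 *: B (e i0).
  rewrite /= /D (bigD1 i0) //= big1 => [|j ji]; last first.
    by rewrite xe eq_sym (negbTE ji) oppr0 mulr0 scale0r.
  by rewrite xe eqxx addr0 mulrN mulr1 scaleNr subrK.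
have h := bnd x Hx; rewrite Dform s1 in h.
rewrite BE; apply: le_trans (nsqD_le hilbert _ _) _; rewrite nsqZ //.
have -> : sqn (2 : C) = 4.
  by rewrite -[2]/(2%:R) -[2%:R](rmorph_nat (real_complex R)) sqnR -natrX.
have := MeP i0; have : 0 <= - complex.Re (ip (B x) x) by lra.
have : (K + 1) * (complex.Re (ip (B x) x) + 2 * 1) <= 2 * (K + 1) by nra.
lra.
Qed.

End OneForm.
End Pontryagin.

Section InvariantSubspace.
Variables (R : realType) (X : completeNormedModType R[i]).
Variable ip : {dot X for conjC}.
Hypothesis hilbert : forall u, ip u u = `|u| ^+ 2.
Local Notation nsq := (nsq ip).
Local Notation approx := (approx ip).
Local Notation C := R[i].
Variable H : set X.
Hypotheses (Hs : Defs.subspace H) (Hc : approx H `<=` H).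
Variables (A B : {linear X -> X}) (k : nat) (e : 'I_k -> X).
Hypotheses (Asa : injective_sa ip H A) (Bsa : injective_sa ip H B).
Hypothesis Be : negative_basis ip H B e.

Let As : symmetric ip A. Proof. by case: Asa. Qed.
Let Bs : symmetric ip B. Proof. by case: Bsa. Qed.
Let He i : H (e i). Proof. by case: Be. Qed.
Let ee i j : ip (B (e i)) (e j) = - (i == j)%:R. Proof. by case: Be. Qed.
Let bform_swap := form_swap Bsa.

(** x and T describe a subspace spanned by the x i, a graph over the negative
   family e, that is invariant under an eps-dissipative perturbation of the
   compression of A B to a finite-dimensional space containing the e i and F. *)
Definition approx_invariant (F : seq X) (eps : R) (x : 'I_k -> X) (T : 'M[C]_k) :=
  [/\ (forall i, H (x i)),
     (forall i j, ip (B (x i)) (e j) = - (i == j)%:R),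
     (forall c : 'I_k -> C, complex.Re
        (ip (B (\sum_i c i *: x i)) (\sum_i c i *: x i)) <= 0),
     (forall y, H y -> y \in F \/ (exists j, y = e j) -> forall i,
        ip (B (A (B (x i)))) y + (eps%:C * 'i) * (ip (B (x i)) y - 2 * ip (B (e i)) y)
        = \sum_j T i j * ip (B (x j)) y) &
     (forall a, 0 < complex.Im a -> (complex.Im a ^+ 2) ^+ k <= sqn (\det (a%:M - T)))].

(** In a basis of the span of the e i and of F that is orthonormal for the form up
   to the signs of J, the compression of the form of B A B is a Hermitian matrix
   Sg, and the operator is Sg J. *)
Lemma approx_invariant_exists F eps : 0 < eps ->
  exists x T, approx_invariant F eps x T.
Proof.
move=> eps0; have [H0 Hl] := Hs.
pose V := pos_part ip H B e.
have Vs : Defs.subspace V := pos_part_subspace ip Hs B e.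
have Vproj u : H u -> V (pos_proj ip B e u) := pos_projP Hs Be (u := u).
pose ys := [seq pos_proj ip B e y | y <- F & `[< H y >]].
have [|n [g [Vg gg gys]]] := gram_schmidt (ys := ys) Vs Bs (pos_part_gt0 hilbert Hs Bsa Be).
  by move=> w /mapP[y]; rewrite mem_filter => /andP[/asboolP Hy _] ->; exact: Vproj.
have ge j i : ip (B (g j)) (e i) = 0 by have [_] := Vg j.
have eg i j : ip (B (e i)) (g j) = 0 by rewrite bform_swap ge rmorph0.
pose f (a : 'I_(k + n)) := match fintype.split a with inl i => e i | inr j => g j end.
have fl i : f (lshift n i) = e i by rewrite /f (unsplitK (inl _)).
have fr j : f (rshift k j) = g j by rewrite /f (unsplitK (inr _)).
pose Sg : 'M[C]_(k + n) := \matrix_(a, b) ip (B (A (B (f a)))) (f b).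
have Sgh : adjmx Sg = Sg.
  by apply/matrixP => a b; rewrite !mxE -ipC Bs As Bs.
have [G [T [inv contr spec]]] := dissipative_invariant Sgh eps0.
pose U := row_mx 1%:M G.
pose x i := \sum_a U i a *: f a.
have xE i : x i = e i + \sum_j G i j *: g j.
  rewrite /x big_split_ord /=; congr (_ + _).
    rewrite (bigD1 i) //= fl row_mxEl !mxE eqxx scale1r big1 ?addr0 // => j ji.
    by rewrite row_mxEl mxE eq_sym (negbTE ji) scale0r.
  by apply: eq_bigr => j _; rewrite fr row_mxEr.
have xe i j : ip (B (x i)) (e j) = - (i == j)%:R.
  rewrite xE opD ipDl ee op_sum ip_suml big1 ?addr0 // => l _.
  by rewrite opZ ipZl ge mulr0.
have xg i j : ip (B (x i)) (g j) = G i j.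
  rewrite xE opD ipDl eg add0r op_sum ip_suml (bigD1 j) //= opZ ipZl gg eqxx mulr1.
  by rewrite big1 ?addr0 // => l /negbTE lj; rewrite opZ ipZl gg lj mulr0.
exists x, T; split=> //.
- by move=> i; apply: sum_in => // a; rewrite /f; case: fintype.split => // j; have [] := Vg j.
- move=> c; pose r : 'rV[C]_k := \row_i c i.
  have xcE : \sum_i c i *: x i = \sum_i c i *: e i + \sum_j (r *m G) 0 j *: g j.
    under eq_bigr do rewrite xE scalerDr; rewrite big_split /=; congr (_ + _).
    under eq_bigr do rewrite scaler_sumr; rewrite exchange_big /=.
    apply: eq_bigr => j _; rewrite mxE scaler_suml; apply: eq_bigr => i _.
    by rewrite scalerA mxE.
  have e_form : ip (B (\sum_i c i *: e i)) (\sum_i c i *: e i) =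
      -1 * (\sum_i sqn (c i))%:C.
    by apply: sum_form => i j; rewrite mulN1r ee.
  have g_form : ip (B (\sum_j (r *m G) 0 j *: g j)) (\sum_j (r *m G) 0 j *: g j) =
      1 * (\sum_j sqn ((r *m G) 0 j))%:C.
    by apply: sum_form => i j; rewrite mul1r gg.
  have cross : ip (B (\sum_i c i *: e i)) (\sum_j (r *m G) 0 j *: g j) = 0.
    rewrite op_sum ip_suml big1 // => i _; rewrite ip_sumr big1 // => j _.
    by rewrite opZ ipZl ipZr eg !mulr0.
  rewrite xcE opD ipDl !ipDr e_form g_form cross (bform_swap _ (\sum_i c i *: e i)).
  rewrite cross rmorph0 addr0 add0r mulN1r mul1r ReD ReN !ReR addrC subr_le0.
  have := contr r; rewrite !hform1 !ReR => /le_trans; apply.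
  by rewrite le_eqVlt; apply/orP; left; apply/eqP/eq_bigr => i _; rewrite mxE.
- pose Eq i y := ip (B (A (B (x i)))) y +
     (eps%:C * 'i) * (ip (B (x i)) y - 2 * ip (B (e i)) y)
        = \sum_j T i j * ip (B (x j)) y.
  have UJ j b : (U *m signmx R k n) j b = ip (B (x j)) (f b).
    rewrite /U mul_row_block !mulmx0 addr0 add0r mulmx1 mulmxN mulmx1.
    case: (split_ordP b) => l ->; rewrite ?row_mxEl ?row_mxEr.
      by rewrite fl xe !mxE.
    by rewrite fr xg.
  have Eqf i b : Eq i (f b).
    have M : U *m (Sg + (eps%:C * 'i)%:M) = T *m (U *m signmx R k n).
      by rewrite mulmxA -inv -mulmxA signmxK mulmx1.
    have /matrixP/(_ i b) := M; rewrite [RHS]mxE mulmxDr mul_mx_scalar !mxE.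
    under [in RHS]eq_bigr do rewrite UJ.
    rewrite /Eq => <-; congr (_ + _ * _).
      rewrite /x !op_sum ip_suml; apply: eq_bigr => a _.
      by rewrite !opZ ipZl !mxE.
    case: (split_ordP b) => l ->; rewrite ?row_mxEl ?row_mxEr.
      rewrite fl xe ee mxE; ring.
    by rewrite fr xg eg mulr0 subr0.
  have Eqlin i a y z : Eq i y -> Eq i z -> Eq i (a *: y + z).
    rewrite /Eq !ipDr !ipZr => Ey Ez.
    under eq_bigr do rewrite ipDr ipZr mulrDr mulrCA.
    rewrite big_split -mulr_sumr /= -Ey -Ez; ring.
  have Eq0 i : Eq i 0.
    by rewrite /Eq !ip0r mulr0 subr0 mulr0 addr0 big1 // => j _; rewrite ip0r mulr0.
  have Eqsum i m (h : 'I_m -> X) (c : 'I_m -> C) :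
      (forall j, Eq i (h j)) -> Eq i (\sum_j c j *: h j).
    move=> Eh; elim/big_ind: _ => // [y z Ey Ez|j _].
      by rewrite -[y]scale1r; exact: Eqlin.
    by rewrite -[_ *: _]addr0; exact: Eqlin.
  have Eqe i j : Eq i (e j) by rewrite -fl; exact: Eqf.
  have Eqg i j : Eq i (g j) by rewrite -fr; exact: Eqf.
  move=> y Hy [yF|[j ->]] i; last exact: Eqe.
  have -> : y = -1 *: (\sum_i ip (B y) (e i) *: e i) + pos_proj ip B e y.
    by rewrite scaleN1r /pos_proj addrCA addNr addr0.
  apply: Eqlin; first exact: Eqsum.
  rewrite (gys (pos_proj ip B e y)); first exact: Eqsum.
  by apply: map_f; rewrite mem_filter yF andbT; apply/asboolP.
Qed.

(** The vectors B (x i) of the approximations are bounded, so they have weak limits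
   b i along an ultrafilter on the finite lists F that refines inclusion and for
   which eps, the inverse of the length, tends to zero.  The invariance equation
   is tested against fixed vectors y and passes to the limit; the subspace is
   spanned by the A (b i).  Its form is nonpositive by weak lower semicontinuity
   on the positive part. *)
Theorem invariant_subspace : exists (l : 'I_k -> X) (T : 'M[C]_k),
  [/\ (forall i, H (l i)),
     (forall c : 'I_k -> C, \sum_i c i *: l i = 0 -> forall i, c i = 0),
     (forall i, A (B (l i)) = \sum_j T i j *: l j),
     (forall c : 'I_k -> C, complex.Re
        (ip (B (\sum_i c i *: l i)) (\sum_i c i *: l i)) <= 0) &
     (forall a, eigenvalue T a -> complex.Im a <= 0)].
Proof.
have [H0 Hl] := Hs.
have HB u : H (B u) by case: Bsa.
have HA u : H (A u) by case: Asa.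
pose base : set_system (seq X) := [set P | exists s : seq X, forall t : seq X,
  {subset s <= t} -> (size s <= size t)%N -> P t].
have baseP : ProperFilter base.
  split; first by move=> [s /(_ s) hs]; apply: hs.
  split; first by exists [::].
    move=> P Q [s hs] [t ht]; exists (s ++ t) => r sr szr; split.
      apply: hs => [z zs|]; first by apply: sr; rewrite mem_cat zs.
      by apply: leq_trans szr; rewrite size_cat leq_addr.
    apply: ht => [z zt|]; first by apply: sr; rewrite mem_cat zt orbT.
    by apply: leq_trans szr; rewrite size_cat leq_addl.
  by move=> P Q PQ [s hs]; exists s => t st szt; apply: PQ; exact: hs.
have [U [UU Ub]] := ultraFilterLemma baseP.
have UF : Filter U by case: UU => -[].
pose eps (t : seq X) : R := (size t).+1%:R^-1.
have epsU (d : R) : 0 < d -> U [set t | eps t < d].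
  move=> d0; apply: Ub; have [N _ hN] := near_infty_natSinv_lt (PosNum d0).
  exists (nseq N 0) => t _; rewrite size_nseq => Nt; exact: hN.
have eps0 t : 0 < eps t by rewrite invr_gt0.
have ex t : exists p : ('I_k -> X) * 'M[C]_k, approx_invariant t (eps t) p.1 p.2.
  by have [x [T h]] := approx_invariant_exists t (eps0 t); exists (x, T).
have [p hp] := choice ex.
have [M hM] := form_bounds_op hilbert Hs Bsa Be.
pose x t i := (p t).1 i.
have xM t i : nsq (B (x t i)) <= M.
  have [Hx xe xn _ _] := hp t; apply: (hM i); [exact: Hx|exact: xe|].
  have := xn (fun j => (j == i)%:R); rewrite (bigD1 i) //= eqxx scale1r big1 ?addr0 //.
  by move=> j /negbTE ->; rewrite scale0r.
have exb i : exists b, forall y, ucvg U (fun t => ip (B (x t i)) y) (ip b y).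
  by have [b _ hb] := weak_limit hilbert UU (fun t => xM t i); exists b.
have [b hb] := choice exb.
have Hb i : H (b i).
  by apply: (weak_limit_closed hilbert UU Hs Hc _ (hb i)) => t; exact: HB.
have eps_small (i : 'I_k) y : ucvg U (fun t => ((eps t)%:C * 'i) *
    (ip (B (x t i)) y - 2 * ip (B (e i)) y)) 0.
  pose K := 2 * (M * nsq y + 4 * sqn (ip (B (e i)) y)).
  have MM : 0 <= M := le_trans (nsq_ge0 hilbert _) (xM [::] i).
  have K0 : 0 <= K.
    apply: mulr_ge0 => //; apply: addr_ge0; apply: mulr_ge0 => //.
      exact: (nsq_ge0 hilbert).
    exact: sqn_ge0.
  apply: (ucvg_small UU K0 epsU) => t.
  rewrite sqnM; apply: ler_pM; rewrite ?sqn_ge0 //.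
    rewrite sqnM sqnR (_ : sqn ('i : C) = 1); last first.
      by rewrite /sqn /= expr0n expr1n add0r.
    rewrite mulr1 expr2; apply: ler_piMl; first exact: ltW.
    by rewrite /eps invf_le1 // ler1n.
  apply: le_trans (sqnD_le _ _) _; rewrite /K ler_pM2l // sqnN sqnM lerD //.
    apply: le_trans (CS hilbert _ _) _; apply: ler_wpM2r; rewrite ?nsq_ge0 //.
  rewrite -[2]/(2%:R) -[2%:R](rmorph_nat (real_complex R)) sqnR -natrX //.
pose T : 'M[C]_k := \matrix_(i, j) - ip (b i) (A (B (e j))).
have Tcvg i j : ucvg U (fun t => (p t).2 i j) (T i j).
  have TE t : - ip (B (x t i)) (A (B (e j))) - (((eps t)%:C * 'i) *
    (ip (B (x t i)) (e j) - 2 * ip (B (e i)) (e j))) = (p t).2 i j.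
    have [Hx xe _ eq _] := hp t.
    have := eq (e j) (He j) (or_intror (ex_intro _ j erefl)) i.
    rewrite (bigD1 j) //= big1 => [|l lj]; last first.
      by rewrite xe (negbTE lj) oppr0 mulr0.
    rewrite (xe j j) eqxx addr0 mulrN1 Bs As => E; by rewrite -opprD E opprK.
  have -> : T i j = - ip (b i) (A (B (e j))) - 0 by rewrite mxE subr0.
  under eq_fun do rewrite -TE.
  apply: ucvgB => //.
  by apply: ucvgN => //; exact: hb.
have bT i : B (A (b i)) = \sum_j T i j *: b j.
  apply/eqP; rewrite -subr_eq0 -(nsq_eq0 hilbert) /nsq.
  set q := _ - _; have Hq : H q.
    rewrite /q -scaleN1r addrC; apply: Hl; last exact: HB.
    exact: sum_in.
  suff -> : ip q q = 0 by [].
  rewrite {1}/q ipBl; apply/eqP; rewrite subr_eq0; apply/eqP.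
  rewrite Bs As ip_suml; under eq_bigr do rewrite ipZl.
  have lhs : ucvg U (fun t => ip (B (A (B (x t i)))) q + ((eps t)%:C * 'i) *
    (ip (B (x t i)) q - 2 * ip (B (e i)) q)) (ip (b i) (A (B q))).
    rewrite -[ip (b i) _]addr0; apply: ucvgD => //.
    by under eq_fun do rewrite Bs As; exact: hb.
  have rhs : ucvg U (fun t => \sum_j (p t).2 i j * ip (B (x t j)) q)
     (\sum_j T i j * ip (b j) q).
    by apply: ucvg_sum => // j; apply: ucvgM.
  apply: (ucvg_unique UU _ rhs); apply: (ucvg_eq UU _ lhs).
  apply: Ub; exists [:: q] => t qt _ /=; have [_ _ _ eq _] := hp t.
  by apply: eq => //; left; apply: qt; rewrite inE.
have be i j : ip (b i) (e j) = - (i == j)%:R.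
  apply: (ucvg_unique UU (hb i (e j))).
  under eq_fun => t do (have [_ -> _ _ _] := hp t).
  exact: ucvg_cst.
exists (fun i => A (b i)), T; split.
- by move=> i; exact: HA.
- move=> c; under eq_bigr do rewrite -opZ.
  rewrite -op_sum => Ac; have [_ _ _ Ainj] := Asa.
  have {}Ac := Ainj _ (sum_in c Hs Hb) Ac.
  move=> i; apply/eqP; rewrite -oppr_eq0; apply/eqP.
  have := congr1 (fun v => ip v (e i)) Ac; rewrite ip0l ip_suml (bigD1 i) //=.
  rewrite ipZl be eqxx mulrN1 big1 ?addr0 // => j /negbTE ji.
  by rewrite ipZl be ji oppr0 mulr0.
- by move=> i; rewrite bT op_sum; apply: eq_bigr => j _; rewrite opZ.
- move=> c; pose l := \sum_i c i *: A (b i); rewrite -/l.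
  pose d j := \sum_i c i * T i j.
  have Hl' : H l by apply: sum_in => // i; exact: HA.
  have BlE : B l = \sum_j d j *: b j.
    rewrite /l op_sum; under eq_bigr do rewrite opZ bT scaler_sumr.
    rewrite exchange_big; apply: eq_bigr => j _ /=.
    by rewrite /d scaler_suml; apply: eq_bigr => i _; rewrite scalerA.
  pose nd := \sum_j d j *: e j.
  pose v := l - nd.
  have le j : ip (B l) (e j) = - d j.
    rewrite BlE ip_suml (bigD1 j) //= ipZl be eqxx mulrN1 big1 ?addr0 // => i /negbTE ij.
    by rewrite ipZl be ij oppr0 mulr0.
  have ne j : ip (B nd) (e j) = - d j.
    rewrite /nd op_sum ip_suml (bigD1 j) //= opZ ipZl ee eqxx mulrN1.
    by rewrite big1 ?addr0 // => i /negbTE ij; rewrite opZ ipZl ee ij oppr0 mulr0.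
  have Vv : pos_part ip H B e v.
    split; first by rewrite /v -scaleN1r addrC; apply: Hl => //; exact: sum_in.
    by move=> j; rewrite /v opB ipBl le ne subrr.
  pose Sd := \sum_j sqn (d j).
  have nform : ip (B nd) nd = - Sd%:C.
    by rewrite (@sum_form _ _ ip B _ e (-1)) ?mulN1r // => i j; rewrite mulN1r ee.
  have ven u : (forall j, ip (B u) (e j) = 0) -> ip (B u) nd = 0.
    by move=> ue; rewrite /nd ip_sumr big1 // => j _; rewrite ipZr ue mulr0.
  have add_nd u : (forall j, ip (B u) (e j) = 0) ->
      complex.Re (ip (B (u + nd)) (u + nd)) = complex.Re (ip (B u) u) - Sd.
    move=> /ven ue; rewrite opD ipDl !ipDr nform (bform_swap nd u) ue rmorph0.
    by rewrite addr0 add0r ReD ReN ReR.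
  have lform : complex.Re (ip (B l) l) = complex.Re (ip (B v) v) - Sd.
    by rewrite -(add_nd v Vv.2) /v subrK.
  have v0 : 0 <= complex.Re (ip (B v) v) by exact: (pos_part_ge0 Be).
  (* after applying B, the positive parts gt t of the approximants converge
     weakly to the positive part v of l, and their forms are at most Sd *)
  pose gt t := \sum_j d j *: (x t j - e j).
  have Vg t : pos_part ip H B e (gt t).
    have [Hx xe _ _ _] := hp t; split.
      by apply: sum_in => // j; rewrite -scaleN1r addrC; apply: Hl => //; exact: Hx.
    move=> i; rewrite /gt op_sum ip_suml big1 // => j _.
    by rewrite opZ opB ipZl ipBl xe ee subrr mulr0.
  have gform t : complex.Re (ip (B (gt t)) (gt t)) <= Sd.
    have [_ _ xn _ _] := hp t; have := xn d.
    have -> : \sum_i d i *: (p t).1 i = gt t + nd.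
      rewrite /gt /nd -big_split; apply: eq_bigr => j _ /=.
      by rewrite -scalerDr subrK.
    by rewrite (add_nd _ (Vg t).2); lra.
  have gcvg : ucvg U (fun t => ip (B (gt t)) v) (ip (B v) v).
    have -> : ip (B v) v = \sum_j d j * (ip (b j) v - ip (B (e j)) v).
      rewrite {1}/v opB ipBl BlE ip_suml /nd op_sum ip_suml -sumrB.
      by apply: eq_bigr => j _; rewrite ipZl opZ ipZl mulrBr.
    under eq_fun => t.
      rewrite /gt op_sum ip_suml; under eq_bigr do rewrite opZ opB ipZl ipBl.
      over.
    apply: ucvg_sum => // j; apply: ucvgZ => //; apply: ucvgB => //.
    exact: ucvg_cst.
  have : sqn (ip (B v) v) <= Sd * complex.Re (ip (B v) v).
    apply: (ucvg_sqn_le UU gcvg); apply: filterS filterT => t _ /=.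
    have := form_CS (pos_part_subspace ip Hs B e) (fun u w _ _ => Bs u w)
      (fun u Pu => pos_part_ge0 Be Pu) (Vg t) Vv.
    by move=> /le_trans; apply; apply: ler_wpM2r.
  rewrite (form_real v Bs) sqnR expr2 lform.
  have [-> _|vn] := eqVneq (complex.Re (ip (B v) v)) 0.
    by rewrite sub0r oppr_le0; apply: sumr_ge0 => j _; exact: sqn_ge0.
  by rewrite ler_pM2r ?subr_le0 // lt_def vn.
move=> a; rewrite eigenvalue_root_char /root horner_char_poly => /eqP det0.
rewrite leNgt; apply/negP => a0.
have dcvg : ucvg U (fun t => \det (a%:M - (p t).2)) (\det (a%:M - T)).
  apply: ucvg_det => // i j; under eq_fun do rewrite 2!mxE.
  rewrite 2!mxE; apply: ucvgD => //; first exact: ucvg_cst.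
  by rewrite mxE; under eq_fun do rewrite mxE; exact: ucvgN.
have pos : 0 < (complex.Im a ^+ 2) ^+ k by rewrite !exprn_gt0.
have := ucvg_sqn_ge UU (ltW pos) dcvg.
rewrite det0 (_ : sqn 0 = 0) ?mulr0; last by apply/eqP; rewrite sqn_eq0.
rewrite leNgt pos => /(_ _)/negP; case; last by [].
by apply: filterS filterT => t _ /=; have [_ _ _ _ h] := hp t; exact: h.
Qed.

End InvariantSubspace.

(** * Counting root vectors *)

Section Counting.
Variables (R : realType) (X : completeNormedModType R[i]).
Variable ip : {dot X for conjC}.
Hypothesis hilbert : forall u, ip u u = `|u| ^+ 2.
Local Notation nsq := (nsq ip).
Local Notation approx := (approx ip).
Local Notation C := R[i].
Variable H : set X.
Hypotheses (Hs : Defs.subspace H) (Hc : approx H `<=` H).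
Implicit Types (S : {linear X -> X}) (z : C) (u v : X) (W : set X) (P : set X).

(** Root vectors in terms of polynomials of S, whose coprimality separates the
   points of the spectrum. *)
Definition rootsp S z : set X :=
  [set u | H u /\ exists n, ev S (('X - z%:P) ^+ n) u = 0].

(** P need not be a subspace.  Dimensions of subspaces of W inside P are expressed
   by natural numbers n, for which maxima exist. *)
Definition spans_in W P n := exists f : 'I_n -> X, lin_indep f /\
  forall c : 'I_n -> C, W (\sum_i c i *: f i) /\ P (\sum_i c i *: f i).

Lemma ev_op0 S p : ev S p 0 = 0.
Proof. exact: (op0 (ev S p)). Qed.

Lemma ev_opD S p u v : ev S p (u + v) = ev S p u + ev S p v.
Proof. exact: (opD (ev S p)). Qed.

Lemma ev_opZ S p (a : C) u : ev S p (a *: u) = a *: ev S p u.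
Proof. exact: (opZ (ev S p)). Qed.

Lemma ev_op_sum S p I (r : seq I) (F : I -> X) :
  ev S p (\sum_(i <- r) F i) = \sum_(i <- r) ev S p (F i).
Proof. exact: (op_sum (ev S p)). Qed.

Lemma evMC S p q u : ev S p (ev S q u) = ev S q (ev S p u).
Proof. by rewrite -!evM mulrC. Qed.

Lemma ev_coprime S p q u : coprimep p q -> ev S p u = 0 -> ev S q u = 0 -> u = 0.
Proof.
move=> /Bezout_eq1_coprimepP[[a b] /= e] pu qu.
have := evC S 1 u; rewrite scale1r polyC1 -e evD !evM pu qu !ev_op0 addr0 => <- //.
Qed.

Lemma coprimep_powers (z w : C) m n : z != w ->
  coprimep (('X - z%:P) ^+ m) (('X - w%:P) ^+ n).
Proof.
move=> zw; apply: coprimep_expl; apply: coprimep_expr.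
by rewrite coprimep_XsubC root_XsubC eq_sym.
Qed.

Lemma rootsp_subspace S z : Defs.subspace (rootsp S z).
Proof.
have [H0 Hl] := Hs; split; first by split=> //; exists 0%N; rewrite ev_op0.
move=> a u v [Hu [n un]] [Hv [m vm]]; split; first exact: Hl.
exists (n + m)%N; rewrite exprD ev_opD ev_opZ evM evMC un ev_op0 scaler0 add0r.
by rewrite evM vm ev_op0.
Qed.

Lemma rootsp_ev S z p u : (forall u, H u -> H (S u)) -> rootsp S z u -> rootsp S z (ev S p u).
Proof.
move=> HS [Hu [n un]]; split; first exact: ev_stable.
by exists n; rewrite evMC un ev_op0.
Qed.

Lemma rootsp_inj S z w n u : z != w -> rootsp S z u ->
  ev S (('X - w%:P) ^+ n) u = 0 -> u = 0.
Proof. by move=> zw [_ [m um]]; apply: ev_coprime um; exact: coprimep_powers. Qed.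

Definition rootsum S (Z : seq C) : set X :=
  [set u | exists V : C -> X, (forall z, z \in Z -> rootsp S z (V z)) /\
     u = \sum_(z <- Z) V z].

Lemma rootsum_subspace S Z : Defs.subspace (rootsum S Z).
Proof.
split.
  exists (fun=> 0); rewrite big1 //; split=> // z _; exact: (rootsp_subspace S z).1.
move=> a u v [V [hV ->]] [W [hW ->]]; exists (fun z => a *: V z + W z); split.
  by move=> z zZ; apply: (rootsp_subspace S z).2; [exact: hV|exact: hW].
by rewrite scaler_sumr -big_split.
Qed.

Lemma rootsum_indep S Z z u : (forall u, H u -> H (S u)) -> z \notin Z ->
  rootsp S z u -> rootsum S Z u -> u = 0.
Proof.
move=> HS; elim: Z u => [|w Z IH] u; first by move=> _ _ [V [_ ->]]; rewrite big_nil.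
rewrite inE negb_or => /andP[zw zZ] zu [V [hV uE]].
have [_ [n Vn]] := hV w ltac:(by rewrite inE eqxx).
apply: (rootsp_inj zw zu (n := n)); apply: IH => //; first exact: rootsp_ev.
exists (fun x => ev S (('X - w%:P) ^+ n) (V x)); split.
  by move=> x xZ; apply: rootsp_ev => //; apply: hV; rewrite inE xZ orbT.
by rewrite uE ev_op_sum big_cons Vn add0r.
Qed.

Section TwoForms.
Variables (A B : {linear X -> X}) (k : nat) (e : 'I_k -> X).
Hypotheses (Asa : injective_sa ip H A) (Bsa : injective_sa ip H B).
Hypothesis Be : negative_basis ip H B e.
Local Notation S := (A \o B : {linear X -> X}).

Let HS u : H u -> H (S u).
Proof. by move=> _; case: Asa => HA _ _ _; exact: HA. Qed.

Definition nonpos : set X := [set u | complex.Re (ip (B u) u) <= 0].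

Lemma bform_shift z u v :
  ip (B (ev S ('X - z%:P) u)) v = ip (B u) (ev S ('X - (conjC z)%:P) v).
Proof.
have [_ As _ _] := Asa; have [_ Bs _ _] := Bsa.
rewrite !evXsub !shiftE /= opB opZ ipBl ipBr ipZl ipZr conjCK; congr (_ - _).
by rewrite Bs As.
Qed.

Lemma bform_shift_power z n u v :
  ip (B (ev S (('X - z%:P) ^+ n) u)) v = ip (B u) (ev S (('X - (conjC z)%:P) ^+ n) v).
Proof.
elim: n u v => [|n IH] u v; first by rewrite !expr0 !evC !scale1r.
by rewrite exprS evM bform_shift IH exprSr -evM.
Qed.

(** S - z and S - conj z are adjoint in the form, and a power of X - conj z is
   invertible modulo the power of X - w that kills v. *)
Lemma rootsp_orthogonal z w u v : z != conjC w ->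
  rootsp S z u -> rootsp S w v -> ip (B u) v = 0.
Proof.
move=> zw [_ [n un]] [_ [m vm]].
have zw' : conjC z != w by apply: contra zw => /eqP <-; rewrite conjCK.
have /Bezout_eq1_coprimepP[[a b] /= ab] := coprimep_powers n m zw'.
have -> : v = ev S (('X - (conjC z)%:P) ^+ n) (ev S a v).
  have := evC S 1 v; rewrite scale1r polyC1 -ab evD evM [X in _ + X]evM vm ev_op0 addr0.
  by rewrite evMC.
by rewrite -bform_shift_power un op0 ip0l.
Qed.

(** Where the invariant subspace has its spectrum: S is injective, which excludes
   zero. *)
Definition admissible z := (z != 0) && (complex.Im z <= 0).

Lemma admissible_real (mu : R) : mu != 0 -> admissible mu%:C.
Proof. by move=> mu0; rewrite /admissible -[0]/(0%:C) (inj_eq (@complexI R)) mu0 /= lexx. Qed.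

Lemma admissible_conj z w : admissible z -> admissible w -> z = conjC w -> z = w.
Proof.
move=> /andP[_ z0] /andP[_ w0] zw; have := congr1 (@complex.Im R) zw.
by rewrite ImJ => im; apply: complexP; [rewrite zw ReJ|lra].
Qed.

(** Below the real axis the form vanishes on root spaces; the condition is dropped
   there, so that the whole root space counts. *)
Definition sector z : set X := if complex.Im z == 0 then nonpos else setT.

Lemma sector_nonpos z u : complex.Im z <= 0 -> rootsp S z u -> sector z u -> nonpos u.
Proof.
move=> z0 zu; rewrite /sector; case: eqP => // zn _.
rewrite /nonpos /= (rootsp_orthogonal _ zu zu) //.
by apply/eqP => /(congr1 (@complex.Im R)); rewrite ImJ; lra.
Qed.

(** More than k independent vectors would have a combination in pos_part, where
   the form is positive. *)
Lemma spans_in_bound n : spans_in H nonpos n -> (n <= k)%N.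
Proof.
move=> [f [fi fc]]; rewrite leqNgt; apply/negP => kn.
pose M : 'M[C]_(n, k) := \matrix_(i, j) ip (B (f i)) (e j).
have [c [c0 cM]] := kernel_vector M kn.
pose u := \sum_i c 0 i *: f i.
have [Hu un] := fc (fun i => c 0 i); rewrite -/u in Hu un.
have Pu : pos_part ip H B e u.
  split=> // j; have /matrixP/(_ 0 j) := cM; rewrite !mxE => <-.
  rewrite /u op_sum ip_suml; apply: eq_bigr => i _.
  by rewrite opZ ipZl mxE.
have [u0|u0] := eqVneq u 0.
  move/eqP: c0; apply; apply/rowP => i; rewrite mxE.
  exact: (fi (fun i => c 0 i) u0).
by have := pos_part_gt0 hilbert Hs Bsa Be Pu u0; rewrite ltNge un.
Qed.

Lemma rootsum_orthogonal z Z u v : admissible z -> all admissible Z -> z \notin Z ->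
  rootsp S z u -> rootsum S Z v -> ip (B u) v = 0.
Proof.
move=> az aZ zZ zu [V [hV ->]]; rewrite ip_sumr big1_seq // => w /andP[_ wZ].
apply: rootsp_orthogonal zu (hV w wZ).
apply: contra zZ => /eqP zw; rewrite (admissible_conj az _ zw) //.
exact: (allP aZ).
Qed.

(** Root spaces being independent and orthogonal, families chosen at distinct
   admissible points add up to a nonpositive family. *)
Lemma rootsum_spans (d : C -> nat) (Z : seq C) : uniq Z -> all admissible Z ->
  (forall z, z \in Z -> spans_in (rootsp S z) (sector z) (d z)) ->
  spans_in (rootsum S Z `&` H) nonpos (\sum_(z <- Z) d z).
Proof.
have [H0 Hl] := Hs; have [_ Bs _ _] := Bsa.
elim: Z => [|z Z IH] /=.
  move=> _ _ _; rewrite big_nil; exists (fun=> 0); split; first by move=> ? ? [].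
  move=> c; rewrite big_ord0; split.
    by split=> //; exists (fun=> 0); rewrite big_nil.
  by rewrite /nonpos /= op0 ip0l.
move=> /andP[zZ uZ] /andP[az aZ] hd; rewrite big_cons.
have [f [fi fc]] := hd z ltac:(by rewrite inE eqxx).
have [g [gi gc]] := IH uZ aZ (fun w wZ => hd w ltac:(by rewrite inE wZ orbT)).
set n := \sum_(w <- Z) d w in g gi gc *.
pose h (a : 'I_(d z + n)) := match fintype.split a with inl i => f i | inr j => g j end.
have hl i : h (lshift n i) = f i by rewrite /h (unsplitK (inl _)).
have hr j : h (rshift (d z) j) = g j by rewrite /h (unsplitK (inr _)).
have hE c : \sum_a c a *: h a =
    \sum_i c (lshift n i) *: f i + \sum_j c (rshift (d z) j) *: g j.
  rewrite big_split_ord; congr (_ + _); apply: eq_bigr => i _.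
    by rewrite hl.
  by rewrite hr.
exists h; split.
  move=> c; rewrite hE; set u := \sum_i _; set v := \sum_j _ => uv.
  have [zu _] := fc (fun i => c (lshift n i)); rewrite -/u in zu.
  have [[Zv _] _] := gc (fun j => c (rshift (d z) j)); rewrite -/v in Zv.
  have u0 : u = 0.
    apply: (rootsum_indep HS zZ zu).
    have -> : u = -1 *: v + 0.
      by rewrite addr0 scaleN1r; apply/eqP; rewrite -addr_eq0 uv.
    by apply: (rootsum_subspace S Z).2 => //; exact: (rootsum_subspace S Z).1.
  move: uv; rewrite u0 add0r => v0 a; case: (split_ordP a) => i ->.
    exact: (fi (fun i => c (lshift n i)) u0).
  exact: (gi (fun j => c (rshift (d z) j)) v0).
move=> c; rewrite hE; set u := \sum_i _; set v := \sum_j _.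
have [zu su] := fc (fun i => c (lshift n i)); rewrite -/u in zu su.
have [[Zv Hv] nv] := gc (fun j => c (rshift (d z) j)); rewrite -/v in Zv Hv nv.
split.
  split; last by rewrite -[u]scale1r; apply: Hl => //; exact: zu.1.
  have [V [hV vE]] := Zv.
  exists (fun w => if w == z then u else V w); split.
    move=> w; rewrite inE; case: eqP => [->|_] //=; exact: hV.
  rewrite big_cons eqxx vE; congr (_ + _); apply: eq_big_seq => w wZ.
  by case: eqP wZ zZ => // -> ->.
have uv : ip (B u) v = 0 by exact: rootsum_orthogonal zu Zv.
have un : nonpos u by apply: sector_nonpos zu su; case/andP: az.
rewrite /nonpos /= opD ipDl !ipDr uv (form_swap Bsa v) uv rmorph0 addr0 add0r ReD.
by rewrite /nonpos /= in un nv; lra.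
Qed.

Lemma sum_spans_le (d : C -> nat) (Z : seq C) : uniq Z -> all admissible Z ->
  (forall z, z \in Z -> spans_in (rootsp S z) (sector z) (d z)) ->
  (\sum_(z <- Z) d z <= k)%N.
Proof.
move=> uZ aZ hd; have [f [fi fc]] := rootsum_spans uZ aZ hd.
by apply: spans_in_bound; exists f; split=> // c; have [[_ ?] ?] := fc c.
Qed.

Lemma ev_matrix_ker n (D : {linear X -> X}) (l : 'I_n -> X) (T : 'M[C]_n) p
    (x : 'rV[C]_n) :
  (forall i, D (l i) = \sum_j T i j *: l j) -> (x <= kermxpoly T p)%MS ->
  ev D p (\sum_i x 0 i *: l i) = 0.
Proof.
move=> lT; have LT (c : 'rV[C]_n) :
    D (\sum_i c 0 i *: l i) = \sum_i (c *m T) 0 i *: l i.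
  rewrite op_sum; under eq_bigr do rewrite opZ lT scaler_sumr.
  rewrite exchange_big; apply: eq_bigr => j _ /=; rewrite mxE scaler_suml.
  by apply: eq_bigr => i _; rewrite scalerA.
case: n l T x {lT} LT => [|n] l T x LT xK; first by rewrite big_ord0 ev_op0.
have Lev q (y : 'rV[C]_n.+1) : ev D q (\sum_i y 0 i *: l i) =
    \sum_i (y *m horner_mx T q) 0 i *: l i.
  elim/poly_ind: q y => [|q a IH] y.
    rewrite rmorph0 mulmx0 -polyC0 evC scale0r big1 // => i _.
    by rewrite mxE scale0r.
  rewrite evD evMX evC LT IH rmorphD rmorphM /= horner_mx_X horner_mx_C mulmxDr.
  rewrite mul_mx_scalar scaler_sumr -big_split; apply: eq_bigr => i _ /=.
  rewrite [in RHS]mxE scalerDl [(a *: y) 0 i]mxE scalerA; congr (_ *: _ + _).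
  rewrite -mulmxA; congr ((_ *m _) 0 i).
  by have := comm_mx_horner q (comm_mx_refl T); rewrite /comm_mx.
rewrite Lev; move/sub_kermxP: xK => ->; rewrite big1 // => i _.
by rewrite mxE scale0r.
Qed.

(** The invariant subspace of dimension k is the sum of its root spaces. *)
Theorem spans_total : exists Z : seq C, exists d : C -> nat,
  [/\ uniq Z, all admissible Z,
     (forall z, z \in Z -> spans_in (rootsp S z) (sector z) (d z)) &
     (k <= \sum_(z <- Z) d z)%N].
Proof.
have [l [T [Hl' li lT ln Tn]]] := invariant_subspace hilbert Hs Hc Asa Bsa Be.
pose L n (c : 'rV[C]_n) (f : 'I_n -> X) := \sum_i c 0 i *: f i.
have LT (c : 'rV[C]_k) : S (L _ c l) = L _ (c *m T) l.
  rewrite /L op_sum; under eq_bigr do rewrite opZ /= lT scaler_sumr.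
  rewrite exchange_big; apply: eq_bigr => j _ /=; rewrite mxE scaler_suml.
  by apply: eq_bigr => i _; rewrite scalerA.
have L0 (c : 'rV[C]_k) : L _ c l = 0 -> c = 0.
  by move=> c0; apply/rowP => i; rewrite mxE; exact: (li (fun i => c 0 i) c0).
have [rs [chT _]] := char_poly_split T.
pose Z := undup rs; pose m z := count_mem z rs.
pose Ker z := kermxpoly T (('X - z%:P) ^+ m z).
have chTE : char_poly T = \prod_(z <- Z) ('X - z%:P) ^+ m z.
  by rewrite chT -prodr_undup_exp_count.
have Zeig z : z \in Z -> eigenvalue T z.
  by rewrite mem_undup eigenvalue_root_char chT root_prod_XsubC.
exists Z, (fun z => \rank (Ker z)); split; first exact: undup_uniq.
- apply/allP => z zZ; rewrite /admissible (Tn _ (Zeig _ zZ)) andbT.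
  apply: contraTneq (Zeig _ zZ) => ->; apply/negP => /eigenvalueP[v vT v0].
  have [_ _ _ Ainj] := Asa; have [HB _ _ Binj] := Bsa.
  have := LT v; rewrite vT scale0r /L.
  under [in RHS]eq_bigr do rewrite mxE scale0r.
  rewrite [RHS]big1 // => /(Ainj _ (HB _))/(Binj _ (sum_in _ Hs Hl'))/L0 v00.
  by rewrite v00 eqxx in v0.
- move=> z _; pose N := row_base (Ker z).
  exists (fun i => L _ (row i N) l).
  have LN (c : 'I_(\rank (Ker z)) -> C) :
      \sum_i c i *: L _ (row i N) l = L _ ((\row_i c i) *m N) l.
    under eq_bigr do rewrite /L scaler_sumr.
    rewrite exchange_big; apply: eq_bigr => j _ /=; rewrite mxE scaler_suml.
    by apply: eq_bigr => i _; rewrite scalerA !mxE.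
  split.
    move=> c; rewrite LN => /L0 cN i.
    have /rowP/(_ i) : \row_i c i = 0.
      by apply: (row_free_inj (row_base_free (Ker z))); rewrite -/N cN mul0mx.
    by rewrite !mxE.
  move=> c; rewrite LN; set x := (\row_i c i) *m N.
  have xK : (x <= Ker z)%MS by rewrite /x (submx_trans (submxMl _ _)) // eq_row_base.
  split; last first.
    rewrite /sector; case: eqP => // _; exact: (ln (fun i => x 0 i)).
  split; first exact: sum_in.
  exists (m z).
  exact: (@ev_matrix_ker _ S l T _ x lT xK).
have := rank_kermxpoly_prod T (undup_uniq rs) (fun z w => @coprimep_powers z w (m z) (m w)).
by rewrite -/Z -chTE rank_kermxpoly_char.
Qed.

End TwoForms.
End Counting.

(** * Exchanging the two operators *)

Section Exchange.
Variables (R : realType) (X : completeNormedModType R[i]).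
Variable ip : {dot X for conjC}.
Hypothesis hilbert : forall u, ip u u = `|u| ^+ 2.
Local Notation nsq := (nsq ip).
Local Notation approx := (approx ip).
Local Notation C := R[i].
Variable H : set X.
Hypotheses (Hs : Defs.subspace H) (Hc : approx H `<=` H).

(** Hensel lifting of the inverse square root of X / mu along powers of
   X - mu. *)
Lemma inverse_sqrt_poly (mu : R) n : mu != 0 ->
  exists q : {poly R}, ('X - mu%:P) ^+ n %| q * q * 'X - mu%:P.
Proof.
move=> mu0; suff [q [_ hq]] : exists q : {poly R}, q.[mu] != 0 /\
    ('X - mu%:P) ^+ n.+1 %| q * q * 'X - mu%:P.
  exists q; apply: dvdp_trans hq; exact: dvdp_exp2l.
elim: n => [|n [q [qn /dvdpP[r hr]]]].
  by exists 1; rewrite hornerC oner_neq0 !mul1r expr1; split.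
pose D := ('X - mu%:P) ^+ n.+1; pose c := - r.[mu] / (2 * q.[mu] * mu).
have Dmu : D.[mu] = 0 by rewrite horner_exp hornerXsubC subrr expr0n.
exists (q + c%:P * D); split; first by rewrite hornerD hornerM Dmu mulr0 addr0.
have c2 : (2 * c)%:P = c%:P + c%:P by rewrite -polyCD; congr (_%:P); ring.
have -> : (q + c%:P * D) * (q + c%:P * D) * 'X - mu%:P =
    (r + (2 * c)%:P * (q * 'X) + c%:P * c%:P * (D * 'X)) * D.
  have -> : (q + c%:P * D) * (q + c%:P * D) * 'X - mu%:P = (q * q * 'X - mu%:P) +
      ((2 * c)%:P * (q * 'X) + c%:P * c%:P * (D * 'X)) * D by rewrite c2; ring.
  by rewrite hr -/D; ring.
rewrite exprSr -/D [_ * ('X - _)]mulrC; apply: dvdp_mul => //.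
rewrite dvdp_XsubCl /root !(hornerD, hornerM, hornerC) hornerX Dmu.
by rewrite mul0r mulr0 addr0 /c; apply/eqP; field; rewrite mu0 qn.
Qed.

Section TwoOperators.
Variables (A B : {linear X -> X}).
Hypotheses (Asa : injective_sa ip H A) (Bsa : injective_sa ip H B).
Local Notation S := (A \o B : {linear X -> X}).
Local Notation S' := (B \o A : {linear X -> X}).

Definition signed_form (D : {linear X -> X}) (s : R) : set X :=
  [set u | s * complex.Re (ip (D u) u) <= 0].

Lemma ev_intertwine p v : ev S' p (B v) = B (ev S p v).
Proof.
elim/poly_ind: p v => [|p a IH] v; first by rewrite -polyC0 !evC !scale0r op0.
by rewrite !evD !evMX !evC /= IH opD opZ.
Qed.

Lemma bform_ev (q : {poly R}) u v :
  ip (B (ev S (map_poly (real_complex R) q) u)) v =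
  ip (B u) (ev S (map_poly (real_complex R) q) v).
Proof.
have [_ As _ _] := Asa; have [_ Bs _ _] := Bsa.
elim/poly_ind: q u v => [|q c IH] u v.
  by rewrite rmorph0 /= -polyC0 !evC !scale0r op0 ip0l ip0r.
rewrite rmorphD rmorphM /= map_polyX map_polyC /= !evD !evMX !evC opD opZ.
rewrite ipDl ipDr ipZl ipZr conjR IH; congr (_ + _).
by rewrite ev_comm /= Bs As.
Qed.

Lemma rootsp_transfer z u : rootsp H S z u -> rootsp H S' z (B u).
Proof.
have [HB _ _ _] := Bsa.
by move=> [Hu [n un]]; split=> //; exists n; rewrite ev_intertwine un op0.
Qed.

(** B is injective and intertwines A B with B A. *)
Lemma spans_transfer z n : spans_in (rootsp H S z) setT n ->
  spans_in (rootsp H S' z) setT n.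
Proof.
have [_ _ _ Binj] := Bsa; move=> [f [fi fc]]; exists (fun i => B (f i)).
have BE (c : 'I_n -> C) : \sum_i c i *: B (f i) = B (\sum_i c i *: f i).
  by rewrite op_sum; apply: eq_bigr => i _; rewrite opZ.
split=> [c|c]; rewrite BE; last first.
  by split=> //; apply: rootsp_transfer; exact: (fc c).1.
by move=> /(Binj _ (fc c).1.1); exact: fi.
Qed.

(** On the root space of A B at mu, with q^2 X = mu there, u -> B q(A B) u
   carries mu times the form of B to the form of A. *)
Lemma spans_exchange mu s n : mu != 0 ->
  spans_in (rootsp H S mu%:C) (signed_form B (mu * s)) n ->
  spans_in (rootsp H S' mu%:C) (signed_form A s) n.
Proof.
have [HA As _ _] := Asa; have [_ Bs _ Binj] := Bsa.
have HS u : H u -> H (S u) by move=> _; exact: HA.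
move=> mu0 [f [fi fc]].
have ex i : exists N, ev S (('X - (mu%:C)%:P) ^+ N) (f i) = 0.
  have [[_ [N hN]] _] := fc (fun j => (j == i)%:R); exists N.
  move: hN; rewrite (bigD1 i) //= eqxx scale1r big1 ?addr0 // => j /negbTE ->.
  by rewrite scale0r.
have [Nf hN] := choice ex; pose N := (\sum_i Nf i)%N.
have fN i : ev S (('X - (mu%:C)%:P) ^+ N) (f i) = 0.
  by rewrite /N (bigD1 i) //= exprD mulrC evM hN ev_op0.
have [q hq] := inverse_sqrt_poly N mu0.
pose Q := map_poly (real_complex R) q.
have QX u : ev S (('X - (mu%:C)%:P) ^+ N) u = 0 -> ev S Q (ev S Q (S u)) = mu%:C *: u.
  move=> uN; apply/eqP; rewrite -subr_eq0; apply/eqP.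
  have -> : ev S Q (ev S Q (S u)) - mu%:C *: u = ev S (Q * Q * 'X - (mu%:C)%:P) u.
    by rewrite evB evMX evM evC.
  have /dvdpP[r hr] := hq.
  have -> : Q * Q * 'X - (mu%:C)%:P = map_poly (real_complex R) (q * q * 'X - mu%:P).
    by rewrite rmorphB !rmorphM /= map_polyX map_polyC.
  by rewrite hr rmorphM rmorphXn rmorphB /= map_polyX map_polyC evM uN; exact: ev_op0.
have sumN (c : 'I_n -> C) : ev S (('X - (mu%:C)%:P) ^+ N) (\sum_i c i *: f i) = 0.
  by rewrite ev_op_sum big1 // => i _; rewrite ev_opZ fN scaler0.
have muC : mu%:C != 0 :> C by rewrite -[0]/(0%:C) (inj_eq (@complexI R)).
exists (fun i => B (ev S Q (f i))).
have BE (c : 'I_n -> C) :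
    \sum_i c i *: B (ev S Q (f i)) = B (ev S Q (\sum_i c i *: f i)).
  by rewrite ev_op_sum op_sum; apply: eq_bigr => i _; rewrite ev_opZ opZ.
split=> c; rewrite BE; have [cr cs] := fc c; have cN := sumN c.
  have Hev : H (ev S Q (\sum_i c i *: f i)) by apply: ev_stable => //; exact: cr.1.
  move=> /(Binj _ Hev) Q0; apply: fi; apply: (scalerI muC); rewrite scaler0.
  by rewrite -QX // !(ev_comm S Q) Q0 /= !op0.
move: cr cs cN; move: (\sum_i _) => u cr cs cN; split.
  by apply: rootsp_transfer; exact: rootsp_ev.
rewrite /signed_form /=; have -> : ip (A (B (ev S Q u))) (B (ev S Q u)) = mu%:C * ip (B u) u.
  rewrite -Bs -[A (B _)]/(S _) -ipZl -opZ -QX // bform_ev; congr (ip (B _) _).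
  by rewrite ev_comm.
by rewrite ReZ mulrCA mulrA.
Qed.

End TwoOperators.

Lemma sup_lindim (W P : set X) d : Defs.subspace W -> spans_in W P d ->
  (forall n, spans_in W P n -> (n <= d)%N) ->
  ereal_sup [set lindim V | V in [set V | [/\ Defs.subspace V, V `<=` W & V `<=` P]]] =
  d%:R%:E :> \bar R.
Proof.
move=> [W0 Wl] [f [fi fc]] dmax; apply/le_anti/andP; split.
  apply: ge_ereal_sup => _ [V [Vs VW VP] <-]; apply: lindim_le => n g gi Vg.
  apply: dmax; exists g; split=> // c.
  by split; [apply: VW|apply: VP]; exact: sum_in.
pose V := [set u | exists c : 'I_d -> C, u = \sum_i c i *: f i].
apply: (le_trans (y := lindim V)).
  apply: lindim_ge fi _ => i; exists (fun j => (j == i)%:R).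
  by rewrite (bigD1 i) //= eqxx scale1r big1 ?addr0 // => j /negbTE ->; rewrite scale0r.
apply: ereal_sup_ubound; exists V => //; split.
- split; first by exists (fun=> 0); rewrite big1 // => i _; rewrite scale0r.
  move=> a _ _ [c ->] [c' ->]; exists (fun i => a * c i + c' i).
  by rewrite scaler_sumr -big_split; apply: eq_bigr => i _; rewrite scalerDl scalerA.
- by move=> _ [c ->]; exact: (fc c).1.
by move=> _ [c ->]; exact: (fc c).2.
Qed.

Lemma lindim_spans (W : set X) d : Defs.subspace W -> spans_in W setT d ->
  (forall n, spans_in W setT n -> (n <= d)%N) -> lindim W = d%:R%:E.
Proof.
move=> Ws [f [fi fc]] dmax; apply/le_anti/andP; split.
  by apply: lindim_le => n g gi Wg; apply: dmax; exists g; split=> // c; split=> //; exact: sum_in.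
apply: lindim_ge fi _ => i; have [+ _] := fc (fun j => (j == i)%:R).
by rewrite (bigD1 i) //= eqxx scale1r big1 ?addr0 // => j /negbTE ->; rewrite scale0r.
Qed.

Lemma spans_in0 (W P : set X) : Defs.subspace W -> P 0 -> spans_in W P 0.
Proof.
move=> [W0 _] P0; exists (fun=> 0); split; first by move=> ? ? [].
by move=> c; rewrite big_ord0.
Qed.

Lemma spans_max (W P : set X) k : Defs.subspace W -> P 0 ->
  (forall n, spans_in W P n -> (n <= k)%N) ->
  exists d, spans_in W P d /\ forall n, spans_in W P n -> (n <= d)%N.
Proof.
move=> Ws P0 bound; pose Q n := `[< spans_in W P n >].
have Q0 : exists n, Q n by exists 0%N; apply/asboolP; exact: spans_in0.
have Qb n : Q n -> (n <= k)%N by move=> /asboolP /bound.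
case: (ex_maxnP Q0 Qb) => d /asboolP hd dmax; exists d; split=> // n hn.
by apply: dmax; apply/asboolP.
Qed.

End Exchange.

(** * The negative spectral subspace *)

Section NegativeSpace.
Variables (R : realType) (X : completeNormedModType R[i]).
Variable ip : {dot X for conjC}.
Hypothesis hilbert : forall u, ip u u = `|u| ^+ 2.
Local Notation nsq := (nsq ip).
Local Notation approx := (approx ip).
Local Notation C := R[i].
Variable H : set X.
Hypotheses (Hs : Defs.subspace H) (Hc : approx H `<=` H).

Definition negative_eigenbasis (B : {linear X -> X}) k (e : 'I_k -> X) (beta : 'I_k -> R) :=
  [/\ (forall i, H (e i)), (forall i j, ip (e i) (e j) = (i == j)%:R),
     (forall i, beta i < 0), (forall i, B (e i) = (beta i)%:C *: e i) &
     (forall u, H u -> (forall i, ip u (e i) = 0) -> 0 <= complex.Re (ip (B u) u))].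

Section Eigenbasis.
Variables (B : {linear X -> X}) (k : nat) (e : 'I_k -> X) (beta : 'I_k -> R).
Hypotheses (Bsa : injective_sa ip H B) (Be : negative_eigenbasis B e beta).

Let HB u : H (B u). Proof. by case: Bsa. Qed.
Let Bs : symmetric ip B. Proof. by case: Bsa. Qed.
Let He i : H (e i). Proof. by case: Be. Qed.
Let ee i j : ip (e i) (e j) = (i == j)%:R. Proof. by case: Be. Qed.
Let beta0 i : beta i < 0. Proof. by case: Be. Qed.
Let Bei i : B (e i) = (beta i)%:C *: e i. Proof. by case: Be. Qed.

Lemma negative_basis_of_eigenbasis : exists f : 'I_k -> X, negative_basis ip H B f.
Proof.
have [H0 Hl] := Hs.
pose c i := (Num.sqrt (- beta i))^-1; exists (fun i => (c i)%:C *: e i).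
have ci i : c i * c i * beta i = -1.
  rewrite /c -expr2 exprVn sqr_sqrtr ?oppr_ge0 ?ltW // invrN mulNr mulVf //.
  by rewrite lt_eqF.
have cC i : (c i)%:C != 0 :> C.
  rewrite -[0]/(0%:C) (inj_eq (@complexI R)); apply/eqP => c0; have := ci i.
  by rewrite c0 !mul0r => /eqP; rewrite eq_sym oppr_eq0 oner_eq0.
split.
- by move=> i; rewrite -[_ *: _]addr0; exact: Hl.
- move=> i j; rewrite opZ Bei !ipZl ipZr ee conjR.
  have [->|_] := eqVneq i j; last by rewrite !mulr0 oppr0.
  rewrite mulr1 mulrCA mulrC -!rmorphM /= ci; apply: complexP; rewrite /= ?oppr0 //.
move=> u Hu ue; have [_ _ _ _ pos] := Be; apply: pos => // i.
have := ue i; rewrite ipZr conjR Bs Bei ipZr conjR => /eqP.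
rewrite !mulf_eq0 (negbTE (cC i)) /= => /orP[|/eqP //].
by rewrite -[0]/(0%:C) (inj_eq (@complexI R)) lt_eqF.
Qed.

Definition espan : set X := [set u | exists c : 'I_k -> C, u = \sum_i c i *: e i].

Definition eproj u : X := \sum_i ip u (e i) *: e i.

Lemma ip_espan (c : 'I_k -> C) j : ip (\sum_i c i *: e i) (e j) = c j.
Proof.
rewrite ip_suml (bigD1 j) //= ipZl ee eqxx mulr1 big1 ?addr0 // => i /negbTE ij.
by rewrite ipZl ee ij mulr0.
Qed.

Lemma espan_subspace : Defs.subspace espan.
Proof.
split; first by exists (fun=> 0); rewrite big1 // => i _; rewrite scale0r.
move=> a _ _ [c ->] [c' ->]; exists (fun i => a * c i + c' i).
by rewrite scaler_sumr -big_split; apply: eq_bigr => i _; rewrite scalerDl scalerA.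
Qed.

Lemma espan_op u : espan u -> espan (B u).
Proof.
move=> [c ->]; exists (fun i => c i * (beta i)%:C); rewrite op_sum.
by apply: eq_bigr => i _; rewrite opZ Bei scalerA.
Qed.

Definition ecompl : set X := [set u | H u /\ forall i, ip u (e i) = 0].

Lemma ecompl_subspace : Defs.subspace ecompl.
Proof.
have [H0 Hl] := Hs; split; first by split=> // i; rewrite ip0l.
move=> a u v [Hu ue] [Hv ve]; split; first exact: Hl.
by move=> i; rewrite ipDl ipZl ue ve mulr0 addr0.
Qed.

Lemma ecompl_closed : approx ecompl `<=` ecompl.
Proof.
move=> x Wx; split.
  by apply: Hc => d d0; have [y [Vy _] h] := Wx d d0; exists y.
suff : ortho_compl ip [set e i | i in setT] x by move=> h i; apply: h; exists i.
apply: (ortho_compl_closed hilbert) => d d0; have [y [_ Ey] h] := Wx d d0.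
by exists y => // _ [i _ <-].
Qed.

Lemma ecompl_op u : ecompl u -> ecompl (B u).
Proof. by move=> [Hu ue]; split=> // i; rewrite Bs Bei ipZr ue mulr0. Qed.

Lemma ecompl_proj u : H u -> ecompl (u - eproj u).
Proof.
have [H0 Hl] := Hs; move=> Hu; split; last by move=> i; rewrite ipBl ip_espan subrr.
by rewrite -scaleN1r addrC; apply: Hl => //; exact: sum_in.
Qed.

Lemma shift_ecompl w u : ecompl u -> ecompl (shift B w u).
Proof.
move=> Eu; rewrite shiftE -scaleNr addrC; apply: ecompl_subspace.2 => //.
exact: ecompl_op.
Qed.

Lemma shift_below w u : complex.Re w < 0 -> ecompl u ->
  complex.Re w ^+ 2 * nsq u <= nsq (shift B w u).
Proof.
move=> w0 [Hu ue]; have [_ _ _ _ pos] := Be; have := pos u Hu ue => p0.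
have [->|un] := eqVneq u 0; first by rewrite nsq0 mulr0 nsq_ge0.
have np : 0 < nsq u by rewrite lt_def nsq_eq0 // un nsq_ge0.
have := CS hilbert (shift B w u) u; have := Re_sqr_le (ip (shift B w u) u).
have -> : complex.Re (ip (shift B w u) u) =
    complex.Re (ip (B u) u) - complex.Re w * nsq u.
  by rewrite shiftE ipBl ipZl nsqE // !reimE; ring.
move: (sqn _) (nsq (shift B w u)) (complex.Re (ip (B u) u)) (nsq u) (complex.Re w) w0 p0 np.
move=> s t p n r r0 p0 n0 h1 h2; rewrite -(ler_pM2r n0).
apply: le_trans h2; apply: le_trans h1.
have : 0 <= p * (- r * n) by apply: mulr_ge0 => //; nra.
nra.
Qed.

(** On the span of the e i the operator is diagonal, and on the complement it is
   bounded below and has dense range. *)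
Lemma shift_onto w f : complex.Re w < 0 -> (forall i, w != (beta i)%:C) -> H f ->
  exists2 u, H u & shift B w u = f.
Proof.
have [H0 Hl] := Hs; move=> w0 wb Hf.
have [_ _ Bb _] := Bsa; have [kD _ hkD] := shift_bounded hilbert w Bb.
have r2 : 0 < complex.Re w ^+ 2 by rewrite exprn_even_gt0 //= lt_eqF.
have [v [Hv ve] vf] : exists2 v, ecompl v & shift B w v = f - eproj f.
  apply: (bounded_below_onto hilbert ecompl_subspace ecompl_closed
    (shift_ecompl w) r2 (fun u => shift_below w0 (u := u)) (ex_intro _ kD hkD)) => //.
    move=> v Ev hv.
    have sv : shift B (conjC w) v = 0.
      apply/eqP; rewrite -(nsq_eq0 hilbert) /nsq.
      have := hv _ (shift_ecompl (conjC w) Ev).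
      rewrite !shiftE ipBl ipZl Bs -[w in w * _]conjCK -ipZr -ipBr => ->.
      by rewrite eqxx.
    have := shift_below (w := conjC w) (u := v); rewrite ReJ sv nsq0 => /(_ w0 Ev).
    have n0 := nsq_ge0 hilbert v; rewrite pmulr_rle0 // => n1.
    by apply/eqP; rewrite -(nsq_eq0 hilbert) eq_le n1.
  exact: ecompl_proj.
exists (v + \sum_i (ip f (e i) / ((beta i)%:C - w)) *: e i).
  by rewrite -[v]scale1r; apply: Hl => //; exact: sum_in.
suff ef : shift B w (\sum_i (ip f (e i) / ((beta i)%:C - w)) *: e i) = eproj f.
  by rewrite opD vf ef subrK.
rewrite op_sum; apply: eq_bigr => i _; rewrite opZ shiftE Bei -scalerBl scalerA.
by rewrite divfK // subr_eq0 eq_sym; exact: wb.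
Qed.

Lemma nsq_eproj u : nsq u = \sum_i sqn (ip u (e i)) + nsq (u - eproj u).
Proof.
have cross v : (forall i, ip v (e i) = 0) -> ip (eproj u) v = 0.
  by move=> ve; rewrite ip_suml big1 // => i _; rewrite ipZl (ipC ip (e i) v) ve rmorph0 mulr0.
have ne : nsq (eproj u) = \sum_i sqn (ip u (e i)).
  rewrite /nsq /eproj.
  have := @sum_form _ _ ip idfun _ e 1 (fun i => ip u (e i)).
  move=> /= ->; last by move=> i j; rewrite mul1r ee.
  by rewrite mul1r ReR.
have := nsqD ip (eproj u) (u - eproj u); rewrite [eproj u + _]addrC subrK ne => ->.
rewrite cross; first by rewrite mulr0 addr0.
by move=> i; rewrite ipBl ip_espan subrr.
Qed.

Lemma shift_bounded_below w : complex.Re w < 0 -> (forall i, w != (beta i)%:C) ->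
  exists2 c : R, 0 < c & forall u, H u -> c * nsq u <= nsq (shift B w u).
Proof.
move=> w0 wb; have r2 : 0 < complex.Re w ^+ 2 by rewrite exprn_even_gt0 //= lt_eqF.
have [c [c0 cw cb]] := finite_gap [seq sqn ((beta i)%:C - w) | i <- index_enum 'I_k] r2.
exists c => // u Hu; rewrite (nsq_eproj u) (nsq_eproj (shift B w u)).
have se i : ip (shift B w u) (e i) = ((beta i)%:C - w) * ip u (e i).
  by rewrite shiftE ipBl ipZl Bs Bei ipZr conjR mulrBl.
have pe : shift B w u - eproj (shift B w u) = shift B w (u - eproj u).
  rewrite opB; congr (_ - _); rewrite /eproj op_sum; apply: eq_bigr => i _.
  by rewrite se opZ shiftE Bei -scalerBl scalerA mulrC.
rewrite pe mulrDr lerD //; last first.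
  apply: le_trans (shift_below w0 (ecompl_proj Hu)).
  by apply: ler_wpM2r => //; exact: nsq_ge0.
rewrite mulr_sumr; apply: ler_sum => i _; rewrite se sqnM.
apply: ler_wpM2r; first exact: sqn_ge0.
have := cb (sqn ((beta i)%:C - w)) (map_f _ (mem_index_enum i)).
rewrite ger0_norm ?sqn_ge0 //; apply.
by rewrite sqn_eq0 subr_eq0 eq_sym.
Qed.

Lemma shift_espan z u : z < 0 -> H u -> espan (shift B z%:C u) -> espan u.
Proof.
move=> z0 Hu su; have [N0 Nl] := espan_subspace.
have pu : espan (eproj u) by eexists.
have Nv : espan (shift B z%:C (u - eproj u)).
  rewrite opB -scaleN1r addrC.
  apply: (Nl) => //; rewrite shiftE -scaleNr addrC; apply: Nl => //.
  exact: espan_op.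
have v0 : shift B z%:C (u - eproj u) = 0.
  have [_ ve] := shift_ecompl z%:C (ecompl_proj Hu).
  have [c cE] := Nv; rewrite cE big1 // => i _.
  by rewrite -(ip_espan c i) -cE ve scale0r.
have := shift_below (w := z%:C) z0 (ecompl_proj Hu); rewrite v0 nsq0 ReR.
have r2 : 0 < z ^+ 2 by rewrite exprn_even_gt0 //= lt_eqF.
have n0 := nsq_ge0 hilbert (u - eproj u); rewrite pmulr_rle0 // => n1.
have /eqP : nsq (u - eproj u) = 0 by apply/eqP; rewrite eq_le n1.
by rewrite nsq_eq0 // subr_eq0 => /eqP ->.
Qed.

Lemma lindim_espan_le (W : set X) : W `<=` espan -> (lindim W <= k%:R%:E)%E.
Proof.
move=> WE; apply: lindim_le => n f fi Wf; rewrite leqNgt; apply/negP => kn.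
pose M : 'M[C]_(n, k) := \matrix_(i, j) ip (f i) (e j).
have [c [c0 cM]] := kernel_vector M kn.
move/eqP: c0; apply; apply/rowP => i; rewrite mxE; apply: (fi (fun i => c 0 i)).
have [d dE] : espan (\sum_i c 0 i *: f i) by apply: (sum_in _ espan_subspace) => j; exact/WE/Wf.
rewrite dE big1 // => j _; rewrite -(ip_espan d j) -dE.
have /rowP/(_ j) := cM; rewrite !mxE => cj.
suff -> : ip (\sum_i0 c 0 i0 *: f i0) (e j) = 0 by rewrite scale0r.
by rewrite -cj ip_suml; apply: eq_bigr => l _; rewrite ipZl mxE.
Qed.

(** The s i are isolated, as there is no other spectrum in the left half-plane, and
   the root spaces are contained in the span of the e i.  Both the operator B and
   the inverse relation of B satisfy the hypotheses, with s i = beta i and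
   1 / beta i. *)
Lemma neg_space_dim (Q : set (X * X)) (s : 'I_k -> R) :
  (forall i, s i < 0) -> (forall i, Q (e i, (s i)%:C *: e i)) ->
  (forall w, complex.Re w < 0 -> (forall i, w != (s i)%:C) -> resolvent_set H Q w) ->
  (forall z u v, z < 0 -> Q (u, z%:C *: u + v) -> espan v -> espan u) ->
  lindim (neg_space H Q) = k%:R%:E.
Proof.
move=> s0 Qe Qr Qn.
have root_espan z u : z < 0 -> root_space Q z%:C u -> espan u.
  move=> z0 [n]; elim: n u => [|n IH] u /=.
    by move=> ->; exact: espan_subspace.1.
  by move=> [v Quv /IH]; exact: (Qn z u v z0 Quv).
have e_neq0 i : e i != 0.
  apply/eqP => e0; have := ee i i; rewrite e0 ip0l eqxx => /eqP.
  by rewrite eq_sym oner_eq0.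
have spec i : Defs.spectrum H Q (s i)%:C.
  move=> [_ [K hK]]; have := hK _ _ (Qe i).
  by rewrite subrr normr0 mulr0 normr_le0 (negbTE (e_neq0 i)).
have disc i : discrete_spectrum H Q (s i)%:C.
  split; last first.
  - apply: le_lt_trans (_ : _ <= k%:R%:E)%E (ltry _).
    by apply: lindim_espan_le => u; exact: root_espan.
  - by exists (e i).
  split; first by apply/mem_set; exact: spec.
  have si : 0 < - s i by rewrite oppr_gt0.
  have [eta [eta0 etas etaE]] := finite_gap [seq s j - s i | j <- index_enum 'I_k] si.
  exists (ball ((s i)%:C : C^o) eta%:C).
    by apply: nbhsx_ballx; rewrite ltcR.
  apply/seteqP; split=> [w [wb ws]|_ ->]; last first.
    by split; [apply: ballxx; rewrite ltcR|exact: spec].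
  move: wb; rewrite -ball_normE /ball_ /= => wb.
  have {}wb : sqn ((s i)%:C - w) < eta ^+ 2.
    rewrite -ltcR -sqn_normE rmorphXn /= ltr_pXn2r // nnegrE ?normr_ge0 //.
    by rewrite lecR ltW.
  apply/eqP; apply: contrapT => /negP wn; apply: ws; apply: Qr.
    rewrite ltNge; apply/negP => w0; move: wb; rewrite ltNge => /negP; apply.
    apply: le_trans (Re_sqr_le _); rewrite !reimE.
    by move: (s i) (complex.Re w) w0 eta0 etas => a b w0' e0 ea; nra.
  move=> j; apply/eqP => wj; move: wb; rewrite wj -rmorphB /= sqnR ltNge => /negP; apply.
  rewrite -[X in _ <= X]sqrrN opprB -[X in _ <= X]real_normK ?num_real //.
  rewrite ler_pXn2r ?nnegrE ?(ltW eta0) //.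
  apply: etaE; first by apply/mapP; exists j => //; exact: mem_index_enum.
  by apply: contra wn => /eqP; move/eqP; rewrite subr_eq0 => /eqP sj; rewrite wj sj.
apply/le_anti/andP; split.
  apply: lindim_espan_le => _ [n [c [f [hf ->]]]].
  apply: (sum_in _ espan_subspace) => i; have [_ [z _ [z0 Qz]]] := hf i.
  have zE : z = (complex.Re z)%:C.
    by apply: complexP => //; rewrite ImR; move: z0; rewrite ltcE => /andP[/eqP/= ->].
  apply: (Qn (complex.Re z) _ 0).
  - by move: z0; rewrite ltcE => /andP[].
  - by rewrite addr0 -zE.
  - exact: espan_subspace.1.
apply: (@lindim_ge _ _ _ _ e) => [c ce i|i].
  by rewrite -(ip_espan c i) ce ip0l.
exists 1%N, (fun=> 1), (fun=> e i); split; last by rewrite big_ord1 scale1r.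
move=> _; split=> //; exists (s i)%:C => //; split=> //.
by rewrite ltcR.
Qed.

Lemma neg_space_operator (Q : set (X * X)) :
  (forall u w, Q (u, w) <-> H u /\ w = B u) -> lindim (neg_space H Q) = k%:R%:E.
Proof.
move=> QE; apply: (neg_space_dim beta0).
- by move=> i; apply/QE; rewrite Bei.
- move=> w w0 wb; split.
    move=> f Hf; have [u Hu uf] := shift_onto w0 wb Hf; exists u; apply/QE.
    by split=> //; rewrite -uf shiftE subrK.
  have [c c0 hc] := shift_bounded_below w0 wb.
  exists (Num.sqrt c^-1)%:C => u v /QE[Hu ->].
  apply: (nsq_le_norm hilbert); first by rewrite invr_ge0 ltW.
  by rewrite ler_pdivlMl //; exact: hc.
- move=> z u v z0 /QE[Hu uv] Nv; apply: (shift_espan z0 Hu).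
  by rewrite shiftE -uv addrC addKr.
Qed.

Lemma neg_space_inverse (Q : set (X * X)) :
  (forall u w, Q (u, w) <-> H w /\ u = B w) -> lindim (neg_space H Q) = k%:R%:E.
Proof.
have [H0 Hl] := Hs; move=> QE.
have HZ a u : H u -> H (a *: u) by move=> Hu; rewrite -[_ *: _]addr0; exact: Hl.
apply: (neg_space_dim (s := fun i => (beta i)^-1)).
- by move=> i; rewrite invr_lt0.
- move=> i; apply/QE; split; first exact: HZ.
  by rewrite opZ Bei scalerA -rmorphM /= mulVf ?lt_eqF // scale1r.
- move=> w w0 wb.
  have wn : w != 0 by apply: contraTneq w0 => ->; rewrite ltxx.
  have sw : 0 < sqn w by rewrite lt_def sqn_ge0 sqn_eq0 wn.
  have wi0 : complex.Re w^-1 < 0.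
    have : sqn w * complex.Re w^-1 = complex.Re w.
      by rewrite -ReZ -sqn_mulJ mulrAC mulfV // mul1r ReJ.
    by move=> e1; rewrite -(pmulr_rlt0 _ sw) e1.
  have wib i : w^-1 != (beta i)%:C.
    by apply: contra (wb i) => /eqP e1; apply/eqP; rewrite -[LHS]invrK e1 /=; symmetry; exact: fmorphV.
  split.
    move=> f Hf; have [y Hy yf] := shift_onto wi0 wib (HZ (- w^-1) f Hf).
    exists (B y); apply/QE.
    suff e1 : f + w *: B y = y by rewrite e1.
    move: yf; rewrite shiftE => /(congr1 (fun x => w *: x)).
    rewrite scalerBr !scalerA mulrN mulfV // scale1r scaleN1r => /eqP.
    by rewrite subr_eq addrC => /eqP ->; rewrite addrCA subrr addr0.
  have [c c0 hc] := shift_bounded_below wi0 wib.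
  have [_ _ [kB kB0 hB] _] := Bsa.
  exists (Num.sqrt (kB * (c^-1 * (sqn w)^-1)))%:C => u v /QE[Hv uE].
  apply: (nsq_le_norm hilbert).
    by rewrite !mulr_ge0 // invr_ge0 ltW.
  rewrite {1}uE; apply: le_trans (hB _) _; rewrite -!mulrA; apply: ler_wpM2l => //.
  rewrite ler_pdivlMl // ler_pdivlMl // mulrC.
  have := hc v Hv; rewrite shiftE -uE.
  have -> : u - w^-1 *: v = - w^-1 *: (v - w *: u).
    by rewrite scalerBr scalerA !scaleNr mulNr mulVf // scaleN1r opprK addrC.
  rewrite nsqZ // sqnN => h; rewrite -(ler_pM2l (x := sqn w^-1)); last first.
    by rewrite lt_def sqn_ge0 sqn_eq0 invr_eq0 wn.
  have ww : sqn w^-1 * sqn w = 1.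
    by rewrite -sqnM mulVf // -[1]/(1%:C) sqnR expr1n.
  by rewrite [leLHS]mulrC -mulrA [sqn w * _]mulrC ww mulr1.
- move=> z u v z0 /QE[Hw uE] Nv.
  have zC : z%:C != 0 :> C by rewrite -[0]/(0%:C) (inj_eq (@complexI R)) lt_eqF.
  have Ny : espan (z%:C *: u + v).
    have zi : z^-1 < 0 by rewrite invr_lt0.
    apply: (shift_espan zi Hw); rewrite shiftE -uE scalerDr scalerA fmorphV mulVf //.
    rewrite scale1r opprD addrA subrr add0r -scaleNr -[_ *: _]addr0.
    by apply: espan_subspace.2 => //; exact: espan_subspace.1.
  by rewrite uE; exact: espan_op.
Qed.

End Eigenbasis.
End NegativeSpace.

(** * Compressions as bounded operators *)

Section Compressions.
Variables (R : realType) (X : completeNormedModType R[i]).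
Variable ip : {dot X for conjC}.
Hypothesis hilbert : forall u, ip u u = `|u| ^+ 2.
Implicit Types (L Q : set (X * X)) (u v w y f : X) (E : seq R).
Local Notation nsq := (nsq ip).
Local Notation approx := (approx ip).

Definition operator_on (H : set X) (B : {linear X -> X}) Q :=
  forall u w, Q (u, w) <-> H u /\ w = B u.

Definition inverse_on (H : set X) (B : {linear X -> X}) Q :=
  forall u w, Q (u, w) <-> H w /\ u = B w.

(** The form of B is nonnegative on a subspace of finite codimension. *)
Definition finite_negative (H : set X) (B : {linear X -> X}) :=
  exists a : seq X, forall u, H u -> (forall x, x \in a -> ip u x = 0) ->
    0 <= complex.Re (ip (B u) u).

Section OnSubspace.
Variables (H : set X) (P : {linear X -> X}).
Hypotheses (PH : forall u, H (P u)) (Pid : forall u, H u -> P u = u).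
Hypotheses (Ps : symmetric ip P) (Pn : forall u, nsq (P u) <= nsq u).
Hypothesis Po : forall u m, H m -> ip (u - P u) m = 0.

Lemma compressionE L u w : H u ->
  compression ip H L (u, w) <-> exists2 y, L (u, y) & w = P y.
Proof.
have projE y p : Defs.proj ip H (y, p) <-> p = P y.
  split=> [[/= Hp yp]|->]; last by split=> //= m Hm; exact: Po.
  apply: (ip_ext hilbert) => m; rewrite -[in RHS](Pid (PH y)) !Ps.
  have := yp _ (PH m); rewrite ipBl => /eqP; rewrite subr_eq0 => /eqP e.
  by rewrite [in RHS](Pid (PH m)) e -Ps (Pid Hp).
move=> Hu; split=> [[_ [y [v /projE]]]|[y Luy wE]] /=.
  by rewrite Pid // => -> Luy /projE ->; exists y.
split=> //; exists y; last by apply/projE.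
by exists u => //; apply/projE; rewrite Pid.
Qed.

Lemma ipP u v : H u -> ip u (P v) = ip u v.
Proof. by move=> Hu; rewrite -Ps Pid. Qed.

End OnSubspace.

Section Inverse.
Variables (L : set (X * X)) (P : {linear X -> X}) (w : R) (E : seq R).
Local Notation H := (ortho_compl ip (ker L)).
Hypotheses (PH : forall u, H (P u)) (Pid : forall u, H u -> P u = u).
Hypotheses (Ps : symmetric ip P) (Pn : forall u, nsq (P u) <= nsq u).
Hypothesis Po : forall u m, H m -> ip (u - P u) m = 0.
Hypotheses (Lsa : self_adjoint ip setT L) (w0 : 0 < w) (LE : spectrum_above L w E).

(** L y = f has exactly one solution y in H for every f in H, and compressing to H
   removes the component of a solution along the kernel.  The form at f is
   (y, L y), so its negative index is controlled by that of L. *)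
Lemma compressed_inverse : exists B : {linear X -> X},
  [/\ injective_sa ip H B, finite_negative H B &
      operator_on H B (compression ip H (L^-1)%relation)].
Proof.
have [[L0 Ll] _ Lsv _ _] := Lsa.
have [H0 Hl] := ortho_compl_subspace ip (ker L).
have Lc a u v u' v' : L (u, v) -> L (u', v') -> L (a *: u + u', a *: v + v').
  exact: Ll.
have [k k0 hk] := self_adjoint_closed_range hilbert Lsa w0 LE.
have [g hg] := choice (fun f => hk (P f) (PH f)).
have gL f : L (g f, P f) by case: (hg f).
have gH f : H (g f) by case: (hg f).
have uniq y y' f : H y -> H y' -> L (y, f) -> L (y', f) -> y = y'.
  move=> Hy Hy' Ly Ly'; have := Lc (-1) _ _ _ _ Ly' Ly.
  rewrite !scaleN1r addNr => Kyy.
  have Hyy : H (- y' + y) by rewrite -scaleN1r; exact: Hl.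
  apply/eqP; rewrite -subr_eq0 addrC -(nsq_eq0 hilbert) /nsq.
  by rewrite (Hyy _ Kyy).
have glin : linear g.
  move=> a u v; apply: (uniq _ _ (P (a *: u + v))) => //; first exact: Hl.
  by rewrite opD opZ; exact: Lc.
pose B : {linear X -> X} := HB.pack g (GRing.isLinear.Build _ _ _ _ g glin).
have Bs : symmetric ip B.
  move=> u v /=; have := self_adjoint_sym Lsa (gL u) (gL v).
  by rewrite Ps (Pid (gH v)) (ipP Pid Ps).
exists B; split; first split=> //.
- exists k => // u; have [_ _ h] := hg u.
  by apply: le_trans h _; rewrite ler_wpM2l.
- move=> u Hu /= gu; apply: Lsv; by have := gL u; rewrite (Pid Hu) gu.
- have [a ha] := self_adjoint_neg_index hilbert Lsa (ltW w0) LE.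
  exists (map B a) => u Hu ua; rewrite Bs; have := gL u; rewrite (Pid Hu) => Lu.
  apply: ha Lu _ => x xa; rewrite -[g u]/(B u) Bs.
  by apply: ua; exact: map_f.
have PK z : ker L z -> P z = 0.
  move=> Kz; apply/eqP; rewrite -(nsq_eq0 hilbert) /nsq Ps Pid //.
  by rewrite (ipC ip) (PH z Kz) rmorph0.
move=> u v; split=> [Kuv|[Hu ->]]; last first.
  apply/(compressionE PH Pid Ps Po) => //; exists (g u); last by rewrite Pid.
  by have := gL u; rewrite Pid.
have Hu : H u by case: Kuv.
split=> //; move/(compressionE PH Pid Ps Po): Kuv => /(_ Hu)[y /= Ly ->].
have := Lc (-1) _ _ _ _ (gL u) Ly; rewrite Pid // !scaleN1r addNr => /PK.
by rewrite opD opN (Pid (gH u)) => /eqP; rewrite addrC subr_eq0 => /eqP.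
Qed.

End Inverse.

Section Sum.
Variables (L : set (X * X)) (H : set X) (P B : {linear X -> X}) (w d : R) (E : seq R).
Variables (K : set (X * X)).
Hypothesis Hs : Defs.subspace H.
Hypotheses (PH : forall u, H (P u)) (Pid : forall u, H u -> P u = u).
Hypotheses (Ps : symmetric ip P) (Pn : forall u, nsq (P u) <= nsq u).
Hypothesis Po : forall u m, H m -> ip (u - P u) m = 0.
Hypotheses (Lsa : self_adjoint ip setT L) (w0 : 0 <= w) (LE : spectrum_above L w E).
Hypotheses (Bsa : injective_sa ip H B) (Bfin : finite_negative H B) (d0 : 0 < d).
Hypothesis KE : operator_on H B K.
Local Notation AdK := (addZ (compression ip H L) d%:C K).

Lemma sumE u f : AdK (u, f) <-> H u /\ exists2 y, L (u, y) & f = P y + d%:C *: B u.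
Proof.
split=> [[v [z [/= Auv /KE[Hu ->] ->]]]|[Hu [y Luy ->]]].
  by move/(compressionE PH Pid Ps Po): Auv => /(_ Hu)[y Luy ->]; split=> //; exists y.
exists (P y), (B u); split=> //=; last exact/KE.
by apply/(compressionE PH Pid Ps Po) => //; exists y.
Qed.

(** The form of the inverse at f is that of A + delta K at the preimage u, the sum
   of (L u, u) and delta (B u, u). *)
Lemma sum_inverse : resolvent_set H AdK 0 -> exists G : {linear X -> X},
  [/\ injective_sa ip H G, finite_negative H G & inverse_on H G AdK].
Proof.
have [[L0 Ll] _ Lsv _ _] := Lsa; have [H0 Hl] := Hs; have [HB Bs Bb Binj] := Bsa.
move=> res.
have Ssub : Defs.subspace AdK.
  split; first by apply/sumE; split=> //; exists 0; rewrite ?op0 ?scaler0 ?addr0.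
  move=> a [u f] [u' f'] /sumE[Hu [y Ly ->]] /sumE[Hu' [y' Ly' ->]].
  apply/sumE; split; first exact: Hl.
  exists (a *: y + y'); first exact: (Ll a _ _ Ly Ly').
  rewrite (opD P) (opZ P) (opD B) (opZ B) !scalerDr addrACA; congr (_ + (_ + _)).
  by rewrite /= scalerDr !scalerA mulrC.
have [G [Gb GS SG]] := resolvent_op hilbert Ssub PH Pid Pn res.
have {}GS f : AdK (G f, P f) by have := GS f; rewrite scale0r addr0.
have GH f : H (G f) by have /sumE[] := GS f.
have GE : inverse_on H G AdK.
  move=> u f; split=> [Suf|[Hf ->]]; last by have := GS f; rewrite Pid.
  have Hf : H f.
    have /sumE[_ [y _ ->]] := Suf; rewrite addrC; exact: Hl.
  by split=> //; have := SG _ _ Suf; rewrite scale0r subr0; apply.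
have Gs : symmetric ip G.
  move=> f h; have /sumE[Hu [y Ly fE]] := GS f; have /sumE[Hv [y' Ly' hE]] := GS h.
  rewrite -[LHS](ipP Pid Ps) // -[in RHS](Pid (GH h)) -[RHS]Ps fE hE.
  rewrite ipDl ipDr ipZl ipZr conjR (ipP Pid Ps) // Ps (Pid Hv).
  by rewrite (self_adjoint_sym Lsa Ly Ly') Bs.
exists G; split=> //.
- split=> // f Hf Gf; have := GS f; rewrite Gf (Pid Hf) => /sumE[_ [y Ly ->]].
  by rewrite (Lsv _ Ly) (op0 P) (op0 B) scaler0 addr0.
have [a ha] := self_adjoint_neg_index hilbert Lsa w0 LE; have [b hb] := Bfin.
exists (map G (a ++ b)) => f Hf fa.
have /sumE[Hu [y Ly fE]] : AdK (G f, f) by apply/GE.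
have ortho x : x \in a ++ b -> ip (G f) x = 0.
  by move=> xab; rewrite Gs; apply: fa; exact: map_f.
rewrite Gs {1}fE ipDl ipZl Ps (Pid Hu) ReD ReZ; apply: addr_ge0.
  by apply: ha Ly _ => x xa; apply: ortho; rewrite mem_cat xa.
apply: mulr_ge0; first exact: ltW.
by apply: hb => // x xb; apply: ortho; rewrite mem_cat xb orbT.
Qed.

End Sum.
End Compressions.

(** * Counting eigenvalues *)

Section Eigenvalues.
Variables (R : realType) (X : completeNormedModType R[i]).
Variable ip : {dot X for conjC}.
Hypothesis hilbert : forall u, ip u u = `|u| ^+ 2.
Local Notation approx := (approx ip).
Local Notation C := R[i].
Implicit Types (u v w : X) (z g : C) (n : nat).

Lemma root_space_eigenvalue (T : set (X * X)) g u :
  root_space T g u -> u != 0 -> Defs.eigenvalue T g.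
Proof.
move=> [n]; elim: n u => [|n IH] u /=; first by move=> -> /eqP.
move=> [v Tuv rv] u0; have [v0|v0] := eqVneq v 0; last exact: IH rv v0.
by exists u => //; rewrite v0 addr0 in Tuv.
Qed.

Variable H : set X.
Hypotheses (Hs : Defs.subspace H) (Hc : approx H `<=` H).

(** Only admissible points are considered, where these dimensions are bounded by
   the negative index of the form of B. *)
Definition sector_index (A B : {linear X -> X}) (d : C -> nat) := forall z,
  admissible z -> spans_in (rootsp H (A \o B) z) (sector ip B z) (d z) /\
  forall n, spans_in (rootsp H (A \o B) z) (sector ip B z) n -> (n <= d z)%N.

Section OneForm.
Variables (A B : {linear X -> X}) (k : nat) (e : 'I_k -> X) (beta : 'I_k -> R).
Hypotheses (Asa : injective_sa ip H A) (Bsa : injective_sa ip H B).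
Hypothesis Be : negative_eigenbasis ip H B e beta.

Lemma sector_index_exists : exists d, sector_index A B d.
Proof.
have [f Bf] := negative_basis_of_eigenbasis Hs Bsa Be.
suff ex z : exists dz, admissible z ->
    spans_in (rootsp H (A \o B) z) (sector ip B z) dz /\
    forall n, spans_in (rootsp H (A \o B) z) (sector ip B z) n -> (n <= dz)%N.
  by have [d hd] := choice ex; exists d.
have [/andP[z0 zi]|_] := boolP (admissible z); last by exists 0%N.
have [d hd] : exists d, spans_in (rootsp H (A \o B) z) (sector ip B z) d /\
    forall n, spans_in (rootsp H (A \o B) z) (sector ip B z) n -> (n <= d)%N.
  apply: (spans_max (k := k)); first exact: rootsp_subspace.
    by rewrite /sector; case: ifP => // _; rewrite /nonpos /= op0 ip0l.
  move=> n [h [hi hc]]; apply: (spans_in_bound hilbert Hs Bsa Bf).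
  exists h; split=> // c; have [rc sc] := hc c; split; first by case: rc.
  exact: (sector_nonpos Asa Bsa zi rc sc).
by exists d.
Qed.

(** Every sufficiently large list of points exhausts the negative index. *)
Lemma sum_sector_index d : sector_index A B d ->
  exists Z0 : seq C, all (@admissible R) Z0 /\ forall Z : seq C, uniq Z ->
    all (@admissible R) Z -> {subset Z0 <= Z} -> (\sum_(z <- Z) d z)%N = k.
Proof.
move=> hd; have [f Bf] := negative_basis_of_eigenbasis Hs Bsa Be.
have [Z0 [d0 [uZ0 aZ0 hd0 kd0]]] := spans_total hilbert Hs Hc Asa Bsa Bf.
exists Z0; split=> // Z uZ aZ ZZ; apply/eqP; rewrite eqn_leq; apply/andP; split.
  apply: (sum_spans_le hilbert Hs Asa Bsa Bf uZ aZ) => z zZ.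
  by have [] := hd z (allP aZ z zZ).
apply: leq_trans kd0 _; apply: leq_trans (_ : \sum_(z <- Z0) d z <= _)%N.
  rewrite big_seq [leqRHS]big_seq; apply: leq_sum => z zZ0.
  by have [_] := hd z (allP aZ0 z zZ0); apply; exact: hd0.
rewrite [leqRHS](bigID (mem Z0)) /= -[leqLHS]addn0 leq_add // -[leqRHS]big_filter.
rewrite (perm_big [seq z <- Z | z \in Z0]) //; apply: uniq_perm => //.
  exact: filter_uniq.
move=> z; rewrite mem_filter; apply/esym; have [/ZZ|] := boolP (z \in Z0) => //.
Qed.

End OneForm.

Section Exchange.
Variables (A B : {linear X -> X}) (d1 d2 : C -> nat).
Hypotheses (Asa : injective_sa ip H A) (Bsa : injective_sa ip H B).
Hypotheses (hd1 : sector_index A B d1) (hd2 : sector_index B A d2).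

Lemma sector_index_nonreal z : complex.Im z < 0 -> d1 z = d2 z.
Proof.
move=> zi; have az : admissible z.
  by rewrite /admissible (ltW zi) andbT; apply: contraTneq zi => ->; rewrite ltxx.
have sT D : sector ip D z = setT by rewrite /sector lt_eqF.
have [s1 m1] := hd1 az; have [s2 m2] := hd2 az.
rewrite !sT in s1 m1 s2 m2; apply/eqP; rewrite eqn_leq m2 ?m1 //.
  exact: (spans_transfer Asa s2).
exact: (spans_transfer Bsa s1).
Qed.

Lemma spans_signed D W s n : 0 < s ->
  spans_in W (signed_form ip D s) n <-> spans_in W (nonpos ip D) n.
Proof.
move=> s0; suff -> : signed_form ip D s = nonpos ip D by [].
by apply/seteqP; split=> u; rewrite /signed_form /nonpos /= pmulr_rle0.
Qed.

(** The sign of the form of B on a root space at a real point mu is, up to the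
   sign of mu, that of the form of A on the corresponding root space. *)
Lemma spans_signed_index mu s : mu != 0 -> 0 < mu * s ->
  spans_in (rootsp H (A \o B) mu%:C) (signed_form ip B s) (d2 mu%:C) /\
  forall n, spans_in (rootsp H (A \o B) mu%:C) (signed_form ip B s) n ->
    (n <= d2 mu%:C)%N.
Proof.
move=> mu0 s0; have az := admissible_real mu0.
have sT D : sector ip D mu%:C = nonpos ip D by rewrite /sector eqxx.
have [s2 m2] := hd2 az; rewrite !sT in s2 m2; split.
  by apply: spans_exchange mu0 _ => //; apply/spans_signed.
have mus : mu * (mu^-1 * s) = s by rewrite mulrA mulfV // mul1r.
have s1 : 0 < mu^-1 * s.
  have m2' : 0 < mu ^+ 2 by rewrite exprn_even_gt0.
  by rewrite -(pmulr_rgt0 _ m2') expr2 -mulrA mus.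
move=> n hn; apply: m2; apply/(spans_signed _ _ _ s1).
by apply: spans_exchange mu0 _ => //; rewrite mus.
Qed.

Lemma sector_index_pos mu : 0 < mu -> d1 mu%:C = d2 mu%:C.
Proof.
move=> mu0; have mun : mu != 0 by rewrite gt_eqF.
have az := admissible_real mun.
have [s1 m1] := hd1 az; rewrite /sector eqxx in s1 m1.
have [|s2 m2] := @spans_signed_index mu 1 mun; first by rewrite mulr1.
apply/eqP; rewrite eqn_leq; apply/andP; split; [apply: m2|apply: m1].
  exact: (spans_signed B _ _ ltr01).2 s1.
exact: (spans_signed B _ _ ltr01).1 s2.
Qed.

End Exchange.
End Eigenvalues.

Section Counts.
Variables (R : realType) (X : completeNormedModType R[i]).
Variable ip : {dot X for conjC}.
Hypothesis hilbert : forall u, ip u u = `|u| ^+ 2.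
Local Notation approx := (approx ip).
Local Notation C := R[i].
Implicit Types (u v w : X) (z g : C) (n : nat).
Variable H : set X.
Hypotheses (Hs : Defs.subspace H) (Hc : approx H `<=` H).
Variables (A B : {linear X -> X}) (K T : set (X * X)) (delta : R).
Hypotheses (Asa : injective_sa ip H A) (Bsa : injective_sa ip H B).
Hypotheses (KE : operator_on H B K) (delta0 : 0 < delta).
Hypothesis TE : forall u w, T (u, w) <-> [/\ H u, H w & u = A (B (w + delta%:C *: u))].
Local Notation S := (A \o B : {linear X -> X}).
Local Notation shifted g := (g + delta%:C)^-1.

(** By a Bezout relation between X and (X - mu)^n. *)
Lemma rootsp_preimage mu n v : mu != 0 -> H v -> ev S (('X - mu%:P) ^+ n) v = 0 ->
  exists w, [/\ H w, S w = v & ev S (('X - mu%:P) ^+ n) w = 0].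
Proof.
have [HA _ _ _] := Asa; move=> mu0 Hv vn.
have /Bezout_eq1_coprimepP[[a b] /= ab] : coprimep 'X (('X - mu%:P) ^+ n).
  by apply: coprimep_expr; rewrite coprimep_XsubC rootX.
exists (ev S a v); split.
- by apply: ev_stable => // u _; exact: HA.
- have := evC S 1 v; rewrite scale1r polyC1 -ab evD evM [X in _ + X]evM vn.
  by rewrite ev_op0 addr0 evX ev_comm.
- by rewrite evMC vn ev_op0.
Qed.

(** With mu = 1 / (g + delta), the equation T u = g u + v says that
   (S - mu) u = - mu S v, and on root spaces away from zero S can be inverted. *)
Lemma root_space_shifted g : g + delta%:C != 0 ->
  root_space T g = rootsp H S (shifted g).
Proof.
have [H0 Hl] := Hs; have [HA _ _ _] := Asa.
move=> gd0; set mu := shifted g.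
have HZ a u : H u -> H (a *: u) by move=> Hu; rewrite -[_ *: _]addr0; exact: Hl.
have mu0 : mu != 0 by rewrite invr_eq0.
have gE u v : g *: u + v + delta%:C *: u = mu^-1 *: u + v.
  by rewrite /mu invrK scalerDl addrAC.
apply/seteqP; split=> u; last first.
  move=> [Hu [n un]]; exists n; elim: n u Hu un => [|n IH] u Hu.
    by rewrite expr0 evC scale1r.
  rewrite exprSr evM evXsub => un.
  have [|w [Hw Sw wn]] := rootsp_preimage mu0 _ un.
    by rewrite shiftE -scaleNr addrC; apply: Hl => //; exact: HA.
  have Hv : H (- mu^-1 *: w) by exact: HZ.
  exists (- mu^-1 *: w); last by apply: IH => //; rewrite ev_opZ wn scaler0.
  apply/TE; split=> //; first exact: Hl.
  rewrite gE -[A (B _)]/(S _) opD !(opZ S) Sw shiftE scaleNr scalerBr opprB addrCA.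
  by rewrite subrr addr0 scalerA mulVf // scale1r.
move=> [n]; elim: n u => [|n IH] u /=.
  by move=> ->; exact: (rootsp_subspace Hs S mu).1.
move=> [v /TE[Hu _ +] /IH[Hv [m vm]]]; rewrite gE => uE; split=> //; exists m.+1.
have e : shift S mu u = - mu *: S v.
  have := congr1 (fun x => mu *: x) uE; rewrite -[A (B _)]/(S _) opD (opZ S).
  rewrite scalerDr scalerA mulfV // scale1r shiftE => ->.
  by rewrite opprD addNKr scaleNr.
by rewrite exprSr evM evXsub e ev_opZ ev_comm vm op0 scaler0.
Qed.

Lemma eigenvalue_shifted g : Defs.eigenvalue T g -> g + delta%:C != 0.
Proof.
move=> [u u0 /TE[_ _ uE]]; apply: contra u0 => /eqP gd; apply/eqP; rewrite uE.
by rewrite -scalerDl gd scale0r !op0.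
Qed.

Section Indices.
Variables d1 d2 : C -> nat.
Hypotheses (hd1 : sector_index ip H A B d1) (hd2 : sector_index ip H B A d2).

Lemma nonreal_multiplicity z : complex.Im z < 0 ->
  multiplicity T (z^-1 - delta%:C) = (d1 z)%:R%:E.
Proof.
move=> zi; have z0 : z != 0 by apply: contraTneq zi => ->; rewrite ltxx.
have az : admissible z by rewrite /admissible z0 ltW.
rewrite /multiplicity root_space_shifted subrK ?invr_eq0 // invrK.
have [s1 m1] := hd1 az; rewrite /sector lt_eqF // in s1 m1.
by apply: lindim_spans => //; exact: rootsp_subspace.
Qed.

Lemma real_root_space (mu : R) : mu != 0 ->
  root_space T (mu^-1 - delta)%:C = rootsp H S mu%:C.
Proof.
move=> mu0; have muC : mu%:C != 0 :> C by rewrite -[0]/(0%:C) (inj_eq (@complexI R)).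
have e : (mu^-1 - delta)%:C + delta%:C = mu%:C^-1 :> C.
  by rewrite -rmorphD /= subrK fmorphV.
by rewrite root_space_shifted e ?invr_eq0 // invrK.
Qed.

Lemma Nn_index (mu : R) : mu != 0 -> Nn ip K T (mu^-1 - delta) = (d1 mu%:C)%:R%:E.
Proof.
have [_ Bs _ _] := Bsa; move=> mu0; have [s1 m1] := hd1 (admissible_real mu0).
rewrite /sector eqxx in s1 m1.
rewrite -(sup_lindim (rootsp_subspace Hs _ _) s1 m1) /Nn real_root_space //.
congr (ereal_sup [set lindim V | V in _]); apply/seteqP; split=> W [Ws WR WP]; split=> //.
  move=> u Wu; have := WP u (B u) Wu; rewrite /nonpos /= => h.
  have {}h : ip (B u) u <= 0 by apply: h; apply/KE; split=> //; case: (WR _ Wu).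
  by rewrite (form_real u Bs) lecR in h.
move=> u w Wu /KE[_ ->]; rewrite (form_real u Bs) lecR; exact: WP.
Qed.

Lemma Np_index (mu : R) : mu < 0 -> Np ip K T (mu^-1 - delta) = (d2 mu%:C)%:R%:E.
Proof.
have [_ Bs _ _] := Bsa; move=> mu0; have mun : mu != 0 by rewrite lt_eqF.
have [|s2 m2] := spans_signed_index Hs Asa Bsa hd2 (mu := mu) (s := -1) mun.
  by rewrite mulrN1 oppr_gt0.
rewrite -(sup_lindim (rootsp_subspace Hs _ _) s2 m2) /Np real_root_space //.
congr (ereal_sup [set lindim V | V in _]); apply/seteqP; split=> W [Ws WR WP]; split=> //.
  move=> u Wu; have := WP u (B u) Wu; rewrite /signed_form /= => h.
  have {}h : 0 <= ip (B u) u by apply: h; apply/KE; split=> //; case: (WR _ Wu).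
  by rewrite (form_real u Bs) lecR in h; rewrite mulN1r oppr_le0.
move=> u w Wu /KE[_ ->]; rewrite (form_real u Bs) lecR.
by have := WP u Wu; rewrite /signed_form /= mulN1r oppr_le0.
Qed.

End Indices.
End Counts.

(** * Sums over the eigenvalues *)

Lemma esum_seq (R : realType) (T : choiceType) (D : set T) (F : T -> \bar R) (s : seq T) :
  uniq s -> (forall x, 0 <= F x)%E ->
  (forall x, D x -> x \notin s -> F x = 0%E) ->
  (forall x, x \in s -> ~ D x -> F x = 0%E) ->
  (\esum_(x in D) F x = \sum_(x <- s) F x)%E.
Proof.
move=> us F0 hD hs.
have -> : (\esum_(x in D) F x = \esum_(x in [set` s]) F x)%E.
  rewrite esum_mkcond [RHS]esum_mkcond; apply: eq_esum => x _.
  case: ifPn => [/set_mem Dx|/negP nDx]; case: ifPn => [/set_mem /= xs|/negP nxs] //.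
  - by apply: hD => //; apply/negP => xs; apply: nxs; apply/mem_set.
  - by apply/esym/hs => // Dx; apply: nDx; apply/mem_set.
rewrite esum_fset; last by [].
  by rewrite -(fsbig_seq _ _ us).
exact: finite_seq.
Qed.

Lemma esum_image (R : realType) (I T : choiceType) (D : set T) (F : T -> \bar R)
    (g : I -> T) (Q : pred I) (d : I -> nat) (Z : seq I) :
  uniq Z -> {in Q &, injective g} -> (forall x, 0 <= F x)%E ->
  (forall z, Q z -> F (g z) = (d z)%:R%:E) ->
  (forall z, Q z -> d z != 0%N -> D (g z)) ->
  (forall x, D x -> exists z, [/\ Q z, x = g z & z \notin Z -> d z = 0%N]) ->
  (\esum_(x in D) F x = (\sum_(z <- Z | Q z) d z)%:R%:E)%E.
Proof.
move=> uZ gi F0 Fg dD Dg; rewrite (esum_seq (s := [seq g z | z <- Z & Q z])) //.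
- rewrite big_map big_filter natr_sum -sumEFin; exact: eq_bigr.
- rewrite map_inj_in_uniq ?filter_uniq // => z w.
  by rewrite !mem_filter => /andP[Qz _] /andP[Qw _]; exact: gi.
- move=> _ /Dg[z [Qz -> zZ]] gz; rewrite Fg // zZ //; apply: contra gz => zZ'.
  by apply/mapP; exists z => //; rewrite mem_filter Qz.
- move=> x /mapP[z]; rewrite mem_filter => /andP[Qz _] -> nD.
  by rewrite Fg //; have [->|/(dD _ Qz)/nD] := eqVneq (d z) 0%N.
Qed.

Section Totals.
Variables (R : realType) (X : completeNormedModType R[i]).
Variable ip : {dot X for conjC}.
Hypothesis hilbert : forall u, ip u u = `|u| ^+ 2.
Local Notation approx := (approx ip).
Local Notation C := R[i].
Implicit Types (u v w : X) (z : C) (n : nat).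

Lemma lindim_ge0 (W : set X) : (0 <= lindim W)%E.
Proof. by apply: (@lindim_ge _ _ W 0 (fun=> 0)) => [? ? []|[]]. Qed.

Lemma subspace0 : Defs.subspace [set 0 : X].
Proof. by split=> // a u v -> ->; rewrite scaler0 addr0. Qed.

Lemma Nn_ge0 K T (g : R) : (0 <= Nn ip K T g)%E.
Proof.
apply: le_trans (lindim_ge0 [set 0]) _; apply: ereal_sup_ubound; exists [set 0] => //.
split; [exact: subspace0|by move=> _ ->; exists 0%N|].
by move=> u w -> _; rewrite ip0r.
Qed.

Lemma Np_ge0 K T (g : R) : (0 <= Np ip K T g)%E.
Proof.
apply: le_trans (lindim_ge0 [set 0]) _; apply: ereal_sup_ubound; exists [set 0] => //.
split; [exact: subspace0|by move=> _ ->; exists 0%N|].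
by move=> u w -> _; rewrite ip0r.
Qed.

Lemma spans_eigenvalue (T : set (X * X)) g P n :
  spans_in (root_space T g) P n -> n != 0%N -> Defs.eigenvalue T g.
Proof.
case: n => // n [f [fi fc]] _; have [rf _] := fc (fun j => (j == ord0)%:R).
apply: (root_space_eigenvalue rf); apply/eqP => /fi/(_ ord0)/eqP.
by rewrite eqxx oner_eq0.
Qed.

Definition at_neg z := (complex.Im z == 0) && (complex.Re z < 0).
Definition at_pos (x : R) z := [&& complex.Im z == 0, 0 < complex.Re z & complex.Re z != x].
Definition at_nonreal z := complex.Im z < 0.

Lemma sum_admissible (f : C -> nat) (Z : seq C) (x : R) : uniq Z ->
  all (@admissible R) Z -> 0 < x -> x%:C \in Z ->
  (\sum_(z <- Z) f z = \sum_(z <- Z | at_neg z) f z +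
    (f x%:C + \sum_(z <- Z | at_pos x z) f z) + \sum_(z <- Z | at_nonreal z) f z)%N.
Proof.
move=> uZ aZ x0 xZ; rewrite (bigID (fun z => complex.Im z == 0)) /=; congr (_ + _)%N.
  rewrite (bigID (fun z => complex.Re z < 0)) /=; congr (_ + _)%N.
  rewrite big_mkcond (bigD1_seq x%:C) //= eqxx /= ltNge (ltW x0) /=; congr (_ + _)%N.
  rewrite -big_mkcondr big_seq_cond [RHS]big_seq_cond; apply: eq_bigl => z.
  have [zZ|] //= := boolP (z \in Z); have /andP[z0 _] := allP aZ z zZ.
  have e (y : R) : complex.Im z == 0 -> (z == y%:C) = (complex.Re z == y).
    by move=> /eqP zi; apply/eqP/eqP => [->//|zy]; exact: complexP.
  rewrite /at_pos; have [zi|] /= := boolP (complex.Im z == 0); last by rewrite andbF.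
  by rewrite e // -leNgt lt_def -(e 0) // z0 andbC.
rewrite big_seq_cond [RHS]big_seq_cond; apply: eq_bigl => z.
have [zZ|] //= := boolP (z \in Z); have /andP[_ zi] := allP aZ z zZ.
by rewrite /at_nonreal lt_neqAle zi andbT.
Qed.

End Totals.

Section Index.
Variables (R : realType) (X : completeNormedModType R[i]).
Variable ip : {dot X for conjC}.
Hypothesis hilbert : forall u, ip u u = `|u| ^+ 2.
Local Notation approx := (approx ip).
Local Notation C := R[i].
Implicit Types (u v w : X) (z : C).
Variable H : set X.
Hypotheses (Hs : Defs.subspace H) (Hc : approx H `<=` H).
Variables (A B : {linear X -> X}) (K T : set (X * X)) (delta : R).
Hypotheses (Asa : injective_sa ip H A) (Bsa : injective_sa ip H B).
Hypotheses (KE : operator_on H B K) (delta0 : 0 < delta).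
Hypothesis TE : forall u w, T (u, w) <-> [/\ H u, H w & u = A (B (w + delta%:C *: u))].
Hypothesis Tneg : forall g : R, neg_eigenvalue T g -> delta < `|g|.

Let real_point z : complex.Im z == 0 -> z = (complex.Re z)%:C.
Proof. by move=> /eqP zi; apply: complexP. Qed.

Section Sums.
Variables (d1 d2 : C -> nat) (Z : seq C).
Hypotheses (hd1 : sector_index ip H A B d1) (hd2 : sector_index ip H B A d2).
Hypotheses (uZ : uniq Z) (Z1 : forall z, admissible z -> z \notin Z -> d1 z = 0%N).
Hypothesis Z2 : forall z, admissible z -> z \notin Z -> d2 z = 0%N.

Let real_inj : {in [pred z : C | complex.Im z == 0] &,
  injective (fun z : C => (complex.Re z)^-1 - delta)}.
Proof.
move=> z w; rewrite !inE => /real_point zE /real_point wE /addIr/invr_inj e.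
by rewrite zE wE e.
Qed.

Let real_eigenvalue (mu : R) : mu != 0 -> d1 mu%:C != 0%N ->
  Defs.eigenvalue T (mu^-1 - delta)%:C.
Proof.
move=> mu0; have [s1 _] := hd1 (admissible_real mu0).
by move: s1; rewrite -(real_root_space Hs Asa TE mu0) => s1; exact: spans_eigenvalue s1.
Qed.

Let neg_point (x : R) : neg_eigenvalue T x -> x + delta < 0.
Proof. by move=> Tx; have := Tneg Tx; have [x0 _] := Tx; rewrite ltr0_norm //; lra. Qed.

Lemma sum_Nn_neg : (\esum_(g in neg_eigenvalue T) Nn ip K T g)%E =
  (\sum_(z <- Z | at_neg z) d1 z)%:R%:E.
Proof.
apply: (esum_image (g := fun z => (complex.Re z)^-1 - delta)) => //.
- by move=> z w /andP[zi _] /andP[wi _]; exact: real_inj.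
- exact: Nn_ge0.
- move=> z /andP[/real_point zE z0]; rewrite [in RHS]zE; apply: (Nn_index Hs Asa Bsa KE TE hd1).
  by rewrite lt_eqF.
- move=> z /andP[/real_point zE z0]; rewrite {1}zE => dz; split.
    have zi : (complex.Re z)^-1 < 0 by rewrite invr_lt0.
    by rewrite /= subr_lt0; exact: lt_trans zi delta0.
  by apply: real_eigenvalue dz; rewrite lt_eqF.
move=> x Tx; have xd := neg_point Tx; exists ((x + delta)^-1)%:C; split.
- by rewrite /at_neg /= eqxx invr_lt0.
- by rewrite /= invrK addrK.
- by apply: Z1; apply: admissible_real; rewrite invr_eq0 lt_eqF.
Qed.

Lemma sum_Np_neg : (\esum_(g in neg_eigenvalue T) Np ip K T g)%E =
  (\sum_(z <- Z | at_neg z) d2 z)%:R%:E.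
Proof.
apply: (esum_image (g := fun z => (complex.Re z)^-1 - delta)) => //.
- by move=> z w /andP[zi _] /andP[wi _]; exact: real_inj.
- exact: Np_ge0.
- move=> z /andP[/real_point zE z0]; rewrite [in RHS]zE.
  exact: (Np_index Hs Asa Bsa KE TE hd2).
- move=> z /andP[/real_point zE z0]; rewrite {1}zE => dz; split.
    have zi : (complex.Re z)^-1 < 0 by rewrite invr_lt0.
    by rewrite /= subr_lt0; exact: lt_trans zi delta0.
  have zn : complex.Re z != 0 by rewrite lt_eqF.
  have [|s2 _] := spans_signed_index Hs Asa Bsa hd2 (s := -1) zn.
    by rewrite mulrN1 oppr_gt0.
  rewrite -(real_root_space Hs Asa TE zn) in s2; exact: spans_eigenvalue s2 dz.
move=> x Tx; have xd := neg_point Tx; exists ((x + delta)^-1)%:C; split.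
- by rewrite /at_neg /= eqxx invr_lt0.
- by rewrite /= invrK addrK.
- by apply: Z2; apply: admissible_real; rewrite invr_eq0 lt_eqF.
Qed.

Lemma Nn_zero_index : Nn ip K T 0 = (d1 (delta^-1)%:C)%:R%:E.
Proof.
have di : delta^-1 != 0 by rewrite invr_eq0 gt_eqF.
by have := Nn_index Hs Asa Bsa KE TE hd1 di; rewrite invrK subrr.
Qed.

(** Points of the list between 1 / delta and infinity would be eigenvalues in
   the interval from - delta to 0, which contains none. *)
Lemma sum_Nn_pos : (\esum_(g in pos_eigenvalue T) Nn ip K T g)%E =
  (\sum_(z <- Z | at_pos delta^-1 z) d1 z)%:R%:E.
Proof.
apply: (esum_image (g := fun z => (complex.Re z)^-1 - delta)) => //.
- by move=> z w /and3P[zi _ _] /and3P[wi _ _]; exact: real_inj.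
- exact: Nn_ge0.
- move=> z /and3P[/real_point zE z0 _]; rewrite [in RHS]zE.
  by apply: (Nn_index Hs Asa Bsa KE TE hd1); rewrite gt_eqF.
- move=> z /and3P[/real_point zE z0 zd]; rewrite {1}zE => dz.
  have Tz : Defs.eigenvalue T ((complex.Re z)^-1 - delta)%:C.
    by apply: real_eigenvalue dz; rewrite gt_eqF.
  have zi : 0 < (complex.Re z)^-1 by rewrite invr_gt0.
  have [//|g0|/eqP] := ltgtP 0 ((complex.Re z)^-1 - delta); last first.
    rewrite eq_sym subr_eq0 => /eqP zdE; move: zd.
    by rewrite -zdE invrK eqxx.
  have := Tneg (conj g0 Tz); rewrite ltr0_norm // opprB ltrBrDr gtrDl.
  by rewrite ltNge (ltW zi).
move=> x [x0 Tx]; have xd : 0 < x + delta := addr_gt0 x0 delta0.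
exists ((x + delta)^-1)%:C; split.
- rewrite /at_pos /= eqxx invr_gt0 xd /= (inj_eq invr_inj).
  by rewrite -subr_eq0 addrK gt_eqF.
- by rewrite /= invrK addrK.
- by apply: Z1; apply: admissible_real; rewrite invr_eq0 gt_eqF.
Qed.

Lemma im_inv z : z != 0 -> sqn z * complex.Im z^-1 = - complex.Im z.
Proof.
move=> z0; have : (sqn z)%:C * z^-1 = conjC z by rewrite -sqn_mulJ mulrAC mulfV // mul1r.
by move=> /(congr1 (@complex.Im R)); rewrite ImM ReR ImR mul0r addr0 ImJ.
Qed.

Lemma im_inv_lt0 z : (complex.Im z^-1 < 0) = (0 < complex.Im z).
Proof.
have [->|z0] := eqVneq z 0; first by rewrite invr0 ltxx.
have sz : 0 < sqn z by rewrite lt_def sqn_ge0 sqn_eq0 z0.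
by rewrite -(pmulr_rlt0 _ sz) im_inv // oppr_lt0.
Qed.

Lemma sum_multiplicity : (\esum_(z in upper_eigenvalue T) multiplicity T z)%E =
  (\sum_(z <- Z | at_nonreal z) d1 z)%:R%:E.
Proof.
apply: (esum_image (g := fun z => z^-1 - delta%:C)) => //.
- by move=> z w _ _ /addIr/invr_inj.
- by move=> z; exact: lindim_ge0.
- by move=> z zi; apply: (nonreal_multiplicity Hs Asa TE hd1).
- move=> z zi dz; have z0 : z != 0 by apply: contraTneq zi => ->; rewrite /at_nonreal ltxx.
  split; first by rewrite /= ImD ImN ImR subr0 -im_inv_lt0 invrK.
  have [|s1 _] := hd1 (z := z); first by rewrite /admissible z0 ltW.
  move: s1 dz; rewrite -{1}[z]invrK -{1}[z^-1](subrK delta%:C).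
  rewrite -(root_space_shifted Hs Asa TE) ?subrK ?invr_eq0 //; exact: spans_eigenvalue.
move=> z [zi Tz]; have zd := eigenvalue_shifted TE Tz.
exists (z + delta%:C)^-1; split.
- by rewrite /at_nonreal im_inv_lt0 ImD ImR addr0.
- by rewrite invrK addrK.
- apply: Z1; rewrite /admissible invr_eq0 zd ltW // im_inv_lt0 ImD ImR addr0 //.
Qed.

End Sums.

Variables (kA kB : nat) (eA : 'I_kA -> X) (eB : 'I_kB -> X) (bA : 'I_kA -> R) (bB : 'I_kB -> R).
Hypotheses (Ae : negative_eigenbasis ip H A eA bA) (Be : negative_eigenbasis ip H B eB bB).

(** Each of the two negative indices is a sum over the closed lower half-plane;
   the two sums agree except on the negative axis, where they count the two
   signs of the form. *)
Theorem index_count : exists np nn n0 npos nc : nat,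
  [/\ [/\ (\esum_(g in neg_eigenvalue T) Np ip K T g)%E = np%:R%:E,
     (\esum_(g in neg_eigenvalue T) Nn ip K T g)%E = nn%:R%:E &
     Nn ip K T 0 = n0%:R%:E],
     (\esum_(g in pos_eigenvalue T) Nn ip K T g)%E = npos%:R%:E,
     (\esum_(z in upper_eigenvalue T) multiplicity T z)%E = nc%:R%:E &
     (kA + kB = np + nn + 2 * nc + 2 * npos + 2 * n0)%N].
Proof.
have [d1 hd1] := sector_index_exists hilbert Hs Asa Bsa Be.
have [d2 hd2] := sector_index_exists hilbert Hs Bsa Asa Ae.
have [Z1 [aZ1 s1]] := sum_sector_index hilbert Hs Hc Asa Bsa Be hd1.
have [Z2 [aZ2 s2]] := sum_sector_index hilbert Hs Hc Bsa Asa Ae hd2.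
have di : 0 < delta^-1 by rewrite invr_gt0.
pose Z := undup ((delta^-1)%:C :: Z1 ++ Z2).
have uZ : uniq Z := undup_uniq _.
have aZ : all (@admissible R) Z.
  rewrite (eq_all_r (mem_undup _)) /= all_cat aZ1 aZ2 !andbT.
  by apply: admissible_real; rewrite gt_eqF.
have ZZ1 : {subset Z1 <= Z} by move=> z zZ; rewrite mem_undup inE mem_cat zZ orbT.
have ZZ2 : {subset Z2 <= Z} by move=> z zZ; rewrite mem_undup inE mem_cat zZ !orbT.
have dZ : (delta^-1)%:C \in Z by rewrite mem_undup inE eqxx.
have out (d : C -> nat) k (Z0 : seq C) : (forall Z : seq C, uniq Z -> all (@admissible R) Z ->
    {subset Z0 <= Z} -> (\sum_(z <- Z) d z)%N = k) -> {subset Z0 <= Z} ->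
    forall z, admissible z -> z \notin Z -> d z = 0%N.
  move=> s ZZ z az zZ; have := s (z :: Z).
  rewrite big_cons (s Z uZ aZ ZZ) /= zZ uZ az aZ => /(_ isT isT) h.
  have /h : {subset Z0 <= z :: Z} by move=> w /ZZ wZ; rewrite inE wZ orbT.
  by move=> /eqP; rewrite -[X in _ == X]add0n eqn_add2r => /eqP.
have o1 := out _ _ _ s1 ZZ1; have o2 := out _ _ _ s2 ZZ2.
exists (\sum_(z <- Z | at_neg z) d2 z)%N, (\sum_(z <- Z | at_neg z) d1 z)%N,
  (d1 (delta^-1)%:C), (\sum_(z <- Z | at_pos delta^-1 z) d1 z)%N,
  (\sum_(z <- Z | at_nonreal z) d1 z)%N; split.
- split; [exact: sum_Np_neg|exact: sum_Nn_neg|exact: Nn_zero_index].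
- exact: sum_Nn_pos.
- exact: sum_multiplicity.
rewrite -(s1 Z uZ aZ ZZ1) -(s2 Z uZ aZ ZZ2).
rewrite (sum_admissible d1 uZ aZ di dZ) (sum_admissible d2 uZ aZ di dZ).
have -> : d2 (delta^-1)%:C = d1 (delta^-1)%:C.
  exact/esym/(sector_index_pos Hs Asa Bsa hd1 hd2).
have -> : (\sum_(z <- Z | at_pos delta^-1 z) d2 z = \sum_(z <- Z | at_pos delta^-1 z) d1 z)%N.
  apply: eq_bigr => z /and3P[/real_point -> z0 _].
  exact/esym/(sector_index_pos Hs Asa Bsa hd1 hd2).
have -> : (\sum_(z <- Z | at_nonreal z) d2 z = \sum_(z <- Z | at_nonreal z) d1 z)%N.
  by apply: eq_bigr => z zi; apply/esym/(sector_index_nonreal Asa Bsa hd1 hd2).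
move: (\sum_(_ <- _ | _) _)%N (\sum_(_ <- _ | _) _)%N (\sum_(_ <- _ | _) _)%N (\sum_(_ <- _ | _) _)%N.
move=> a b c e; rewrite !mul2n -!addnn; ring.
Qed.

End Index.

Theorem corollary4p20 (R : realType) (X : completeNormedModType R[i])
    (ip : {dot X for conjC}) (Lp Lm : set (X * X)) (wp wm delta : R)
    (hilbert : forall u, ip u u = `|u| ^+ 2)
    (Lp_sa : self_adjoint ip setT Lp) (Lm_sa : self_adjoint ip setT Lm)
    (wp_ge0 : 0 <= wp) (wm_gt0 : 0 < wm)
    (Lp_P1 : essential_spectrum_cond ip Lp wp)
    (Lm_P1 : essential_spectrum_cond ip Lm wm)
    (Lp_P2 : discrete_spectrum_cond Lp) (Lm_P2 : discrete_spectrum_cond Lm) :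
  let H := ortho_compl ip (ker Lm) in
  let A := compression ip H Lp in
  let K := compression ip H (Lm^-1)%relation in
  let T := (K^-1 \; A)%relation in
  let AdK := addZ A delta%:C K in
  0 < delta ->
  (forall g, neg_eigenvalue T g -> delta < `|g|) ->
  (0 < ereal_inf [set (complex.Re z)%:E | z in cont_spectrum ip H AdK])%E ->
  resolvent_set H AdK 0 ->
  (forall z, embedded_eigenvalue H T z -> multiplicity T z = 1%E) ->
  let Nneg := (lindim (neg_space H AdK) + lindim (neg_space H K))%E in
  let Np_minus := (\esum_(g in neg_eigenvalue T) Np ip K T g)%E in
  let Nn_minus := (\esum_(g in neg_eigenvalue T) Nn ip K T g)%E in
  let Nn_zero := Nn ip K T 0 in
  let Nn_plus := (\esum_(g in pos_eigenvalue T) Nn ip K T g)%E in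
  let Nc_plus := (\esum_(z in upper_eigenvalue T) multiplicity T z)%E in
  let Nunst := (Np_minus + Nn_minus + 2%:E * Nc_plus)%E in
  let DeltaN := (Nneg - Nunst)%E in
  [/\ Nneg \is a fin_num,
      DeltaN = (2%:E * Nn_plus + 2%:E * Nn_zero)%E &
      (0 <= DeltaN)%E].
Proof.
move=> H A K T AdK delta0 Tneg _ res _ Nneg NpM NnM Nn0 NnP NcP Nunst DeltaN.
have [El hEl] := essential_spectrum_above hilbert Lm_sa Lm_P1 Lm_P2.
have [Ep hEp] := essential_spectrum_above hilbert Lp_sa Lp_P1 Lp_P2.
have Hs := ortho_compl_subspace ip (ker Lm).
have Hc := ortho_compl_closed hilbert (V := ker Lm).
have [P [PH Pid Ps Pn Po]] := projection_op hilbert Hs Hc.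
have [B [Bsa Bfin KE]] := compressed_inverse hilbert PH Pid Ps Pn Po Lm_sa wm_gt0 hEl.
have [G [Gsa Gfin GE]] := sum_inverse hilbert Hs PH Pid Ps Pn Po Lp_sa wp_ge0 hEp
  Bsa Bfin delta0 KE res.
have eigenbasis D : injective_sa ip H D -> finite_negative ip H D ->
    exists k (e : 'I_k -> X) (b : 'I_k -> R), negative_eigenbasis ip H D e b.
  move=> [HD Ds Db _] [a ha].
  by have [k [e [b h]]] := negative_spectral hilbert Hs Hc (fun u _ => HD u) Ds Db ha;
    exists k, e, b.
have [kB [eB [bB Be]]] := eigenbasis B Bsa Bfin.
have [kG [eG [bG Ge]]] := eigenbasis G Gsa Gfin.
have TE u w : T (u, w) <-> [/\ H u, H w & u = G (B (w + delta%:C *: u))].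
  have [HB _ _ _] := Bsa; split=> [[z /= Auz /KE[Hw zE]]|[Hu Hw uE]].
    have Hu : H u by case: Auz.
    split=> //; suff /GE[_ uE] : AdK (u, B (w + delta%:C *: u)) by [].
    exists z, (B u); split=> //=; first exact/KE.
    by rewrite (opD B) (opZ B) zE.
  have : AdK (u, B (w + delta%:C *: u)) by apply/GE.
  move=> [v [y [/= Auv /KE[_ ->]]]]; rewrite (opD B) (opZ B) => /addIr vE.
  by exists v => //=; apply/KE; split.
have [np [nn [n0 [npos [nc [[e1 e2 e3] e4 e5 tot]]]]]] :=
  index_count hilbert Hs Hc Gsa Bsa KE delta0 TE Tneg Ge Be.
have NnegE : Nneg = (kG + kB)%:R%:E.
  rewrite /Nneg (neg_space_inverse hilbert Hs Hc Gsa Ge GE).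
  by rewrite (neg_space_operator hilbert Hs Hc Bsa Be KE) natrD.
have DeltaE : DeltaN = (2 * npos%:R + 2 * n0%:R)%:E.
  rewrite /DeltaN NnegE /Nunst /NpM /NnM /NcP e1 e2 e5 tot -EFinM -!EFinD.
  by congr (_%:E); rewrite 4!natrD !natrM; ring.
split; first by rewrite NnegE.
  by rewrite DeltaE /NnP /Nn0 e3 e4 -!EFinM -EFinD.
by rewrite DeltaE lee_fin addr_ge0 // mulr_ge0.
Qed.
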